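(* Let $r\ge1$, $\mathbf{m}\in\mathbb{N}^r$, $m=m_1+\cdots+m_r$, $\mathbf{f}\in\mathbb{C}^r$, $a,b\in\mathbb{C}$ and $p\in\mathbb{N}$. Then for $|x|<1$ $$ (1-x)^a{}_{r+2}F_{r+1}\!\left(\begin{matrix}a, b,\mathbf{f}+\mathbf{m}\\ b+p,\mathbf{f}\end{matrix}\,\middle|\, x\right)=\frac{T_{p-1}(0)}{\Gamma(b)(\mathbf{f})_{\mathbf{m}}}{}_{p+1}F_{p}\!\left(\begin{matrix}a, 1,-\boldsymbol{\lambda}+1\\ b+p,-\boldsymbol{\lambda}\end{matrix}\,\middle|\, \frac{x}{x-1}\right) +\sum_{q=1}^p\frac{(-1)^{q-1}(b)_{p}}{(b+q-1)(q-1)!(p-q)!} \sum_{l=0}^{m-1}Y_l(b+q-1,\mathbf{f},\mathbf{m})\frac{(a)_lx^l}{(1-x)^l}, $$ where $\boldsymbol{\lambda}=(\lambda_1,\ldots,\lambda_{p-1})$ are the roots of the polynomial $$ T_{p-1}(z)=\sum_{q=1}^p\frac{(-1)^{q-1}(\mathbf{f}-b-q+1)_{\mathbf{m}}\Gamma(b+q-1)}{(q-1)!(p-q)!}(b+q+z)_{p-q} $$ of degree $p-1$. Furthermore, $$ (1-x)^{a-1}{}_{r+2}F_{r+1}\!\left(\begin{matrix}a, b,\mathbf{f}+\mathbf{m}\\ b+p,\mathbf{f}\end{matrix}\,\middle|\, x\right) =\frac{\Gamma(b-a+1)T^*_{p-1}(0)}{\Gamma(b)(\mathbf{f})_{\mathbf{m}}}{}_{p+1}F_{p}\!\left(\begin{matrix}1,b+1-a,-\boldsymbol{\lambda}^*+1\\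 b+p,-\boldsymbol{\lambda}^*\end{matrix}\,\middle|\, x\right) +\sum_{q=1}^p\frac{(-1)^{q-1}(b)_{p}}{(b+q-1)(q-1)!(p-q)!} \sum_{l=0}^{m-1}Y_l(b+q-1,\mathbf{f},\mathbf{m})\frac{(a)_lx^l}{(1-x)^{l+1}}, $$ where $\boldsymbol{\lambda}^*=(\lambda_1^*,\ldots,\lambda^*_{p-1})$ are the roots of the polynomial $$ T^*_{p-1}(z)=\sum_{q=1}^p \frac{(-1)^{q-1}(\mathbf{f}-b-q+1)_{\mathbf{m}}\Gamma(b+q-1)}{\Gamma(b+q-a)(q-1)!(p-q)!}(b+q+z)_{p-q}(b+1-a+z)_{q-1} $$ of degree $p-1$.
   Context: $(a)_k=\Gamma(a+k)/\Gamma(a)$. For vectors: $(\mathbf{f})_{\mathbf{m}}=\prod_i(f_i)_{m_i}$, $(\mathbf{f}+\gamma)_{\mathbf{m}}=\prod_i(f_i+\gamma)_{m_i}$, $(\mathbf{f})_n=\prod_i(f_i)_n$; $\mathbf{f}+\mathbf{m}$, $\pm\boldsymbol{\lambda}+1$ componentwise; a vector among hypergeometric parameters means its components are listed. ${}_pF_q(\cdot;\cdot;x)$ is the generalized hypergeometric function (principal branch). For $\beta\in\mathbb{C}$: $W_{m-1}(\beta,\mathbf{f},\mathbf{m};n)=\frac{\beta((\mathbf{f}+n)_{\mathbf{m}}-(\mathbf{f}-\beta)_{\mathbf{m}})}{(\beta+n)(\mathbf{f})_{\mathbf{m}}}=\sum_{k=0}^{m-1}\delta_k(\beta)n^k$ (a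 polynomial in $n$ of degree $m-1$), and $Y_l(\beta,\mathbf{f},\mathbf{m})=\sum_{k=l}^{m-1}\delta_k(\beta)\mathbf{S}_k^{(l)}$, with $\mathbf{S}_k^{(l)}$ Stirling numbers of the second kind. Roots listed with multiplicity. Parameters are assumed such that all expressions are defined. *)

(* Defs.v *)
From Stdlib Require Import Reals Lra List Factorial.
From Coquelicot Require Import Coquelicot.
Import ListNotations.

Local Open Scope C_scope.

Fixpoint csum (n : nat) (g : nat -> C) : C :=
  match n with O => 0 | S n' => csum n' g + g n' end.
Fixpoint cprod (n : nat) (g : nat -> C) : C :=
  match n with O => 1 | S n' => cprod n' g * g n' end.
Fixpoint nsum (n : nat) (g : nat -> nat) : nat :=
  match n with O => O | S n' => (nsum n' g + g n')%nat end.

Fixpoint poch (a : C) (k : nat) : C :=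
  match k with O => 1 | S k' => poch a k' * (a + RtoC (INR k')) end.

Definition vpoch (r : nat) (f : nat -> C) (m : nat -> nat) : C :=
  cprod r (fun i => poch (f i) (m i)).

(** Complex exponential, principal argument (in (-pi, pi]) and logarithm,
    principal power w^a = exp(a Log w). *)
Definition Cexp (z : C) : C :=
  (exp (Re z) * cos (Im z), exp (Re z) * sin (Im z))%R.
Definition Carg (w : C) : R :=
  if Rlt_dec 0 (Re w) then atan (Im w / Re w)
  else if Rlt_dec (Re w) 0 then
    (if Rle_dec 0 (Im w) then atan (Im w / Re w) + PI else atan (Im w / Re w) - PI)%R
  else if Rlt_dec 0 (Im w) then (PI / 2)%R
  else if Rlt_dec (Im w) 0 then (- (PI / 2))%R else 0%R.
Definition Clog (w : C) : C := (ln (Cmod w), Carg w).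
Definition Cpowc (w a : C) : C := Cexp (a * Clog w).

(** Euler's Gamma function on C, via Gauss' limit
    Gamma(z) = lim_n n! n^z / (z (z+1) ... (z+n)) (valid off the poles). *)
Definition Gamma_seq (z : C) (n : nat) : C :=
  RtoC (INR (fact n)) * Cexp (z * RtoC (ln (INR n))) / cprod (S n) (fun k => z + RtoC (INR k)).
Definition CGamma (z : C) : C :=
  (real (Lim_seq (fun n => Re (Gamma_seq z n))), real (Lim_seq (fun n => Im (Gamma_seq z n)))).

(** Generalized hypergeometric series with upper parameters [us] and lower
    parameters [ls]; its sum (as a total function, meaningful where it converges,
    in particular for |z| < 1 when #us = #ls + 1). *)
Definition hyp_term (us ls : list C) (z : C) (n : nat) : C :=
  fold_right Cmult 1 (map (fun u => poch u n) us)
  / fold_right Cmult 1 (map (fun l => poch l n) ls)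
  * Cpow z n / RtoC (INR (fact n)).
Definition hyp_series (us ls : list C) (z : C) : C :=
  (Series (fun n => Re (hyp_term us ls z n)), Series (fun n => Im (hyp_term us ls z n))).

(** [F] is the principal branch of pFq(us; ls; .): it is complex-differentiable on
    the cut plane C \ [1, +oo) and coincides with the series on the unit disc.
    (By the identity theorem such an F is unique.) *)
Definition principal_branch (us ls : list C) (F : C -> C) : Prop :=
  (forall z : C, Cmod z < 1 -> F z = hyp_series us ls z) /\
  (forall z : C, ~ (Im z = 0 /\ 1 <= Re z)%R -> ex_derive (K := C_AbsRing) F z).

Fixpoint stirling2 (n k : nat) : nat :=
  match n, k with
  | O, O => 1%nat
  | O, S _ => 0%nat
  | S _, O => 0%nat
  | S n', S k' => (S k' * stirling2 n' (S k') + stirling2 n' k')%nat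
  end.

Definition Wfun (r : nat) (f : nat -> C) (m : nat -> nat) (beta n : C) : C :=
  beta * (vpoch r (fun i => f i + n) m - vpoch r (fun i => f i - beta) m)
  / ((beta + n) * vpoch r f m).

Definition W_coeffs (r : nat) (f : nat -> C) (m : nat -> nat) (mtot : nat)
  (delta : C -> nat -> C) : Prop :=
  forall beta n : C, beta + n <> 0 ->
    Wfun r f m beta n = csum mtot (fun k => delta beta k * Cpow n k).

Definition Yfun (delta : C -> nat -> C) (mtot : nat) (beta : C) (l : nat) : C :=
  csum mtot (fun k => if Nat.leb l k then delta beta k * RtoC (INR (stirling2 k l)) else 0).

Definition Tpoly (r : nat) (f : nat -> C) (m : nat -> nat) (b : C) (p : nat) (z : C) : C :=
  csum p (fun q0 => let q := S q0 in
    Cpow (RtoC (-1)) q0 * vpoch r (fun i => f i - b - RtoC (INR q) + 1) m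
    * CGamma (b + RtoC (INR q) - 1)
    / (RtoC (INR (fact q0)) * RtoC (INR (fact (p - q))))
    * poch (b + RtoC (INR q) + z) (p - q)).

Definition Tstar (r : nat) (f : nat -> C) (m : nat -> nat) (a b : C) (p : nat) (z : C) : C :=
  csum p (fun q0 => let q := S q0 in
    Cpow (RtoC (-1)) q0 * vpoch r (fun i => f i - b - RtoC (INR q) + 1) m
    * CGamma (b + RtoC (INR q) - 1)
    / (CGamma (b + RtoC (INR q) - a) * RtoC (INR (fact q0)) * RtoC (INR (fact (p - q))))
    * poch (b + RtoC (INR q) + z) (p - q) * poch (b + 1 - a + z) q0).

Definition roots_of (P : C -> C) (d : nat) (lam : nat -> C) : Prop :=
  exists c : C, c <> 0 /\ forall z : C, P z = c * cprod d (fun i => z - lam i).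

Definition not_nonpos_int (z : C) : Prop := forall k : nat, z <> RtoC (- INR k).

Definition idx (n : nat) : list nat := seq 0 n.

Definition Cnat (n : nat) : C := RtoC (INR n).

(* Main.v *)
Require Import Defs.
From Stdlib Require Import ZArith Reals Lra Lia Psatz List Factorial.
From Coquelicot Require Import Coquelicot.

(** The coefficient (b)_n (f+m)_n / ((b+p)_n (f)_n) is a rational function of n whose
    partial fractions are indexed by the poles n = -(b+q), q < p.  At each pole it splits into
    the polynomial [Wfun] and a multiple of 1/(b+q+n).  The polynomial parts, written in falling
    factorials by Stirling numbers, sum to multiples of x^l (1-x)^(-a-l).  The polar parts
    U(x) = sum_n (a)_n x^n / (n! (beta+n)) are rewritten by Euler's and Pfaff's transformations;
    brought over the common denominator (b+p)_n they recombine into the polynomials [Tstar] and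
    [Tpoly], whose roots turn them into one hypergeometric series.

    Both transformations hold because the two sides solve x D' + beta D = (1-x)^(-a), and the
    homogeneous equation has no nonzero solution holomorphic at 0.  Pfaff's series in x/(x-1)
    converges only for part of the disc |x| < 1; for the principal branch, known merely to be
    complex differentiable, the formula extends to the disc by the identity theorem, obtained
    here from Goursat's theorem. *)

Local Open Scope R_scope.
Local Open Scope C_scope.


(** * Complex derivatives *)

(** The hypothesis on the principal branch gives a derivative at each point and nothing about its
    continuity, so Green's theorem with continuous partials does not apply and integrals are
    controlled by subdivision. Only rectangles are integrated over: composing with the exponential
    turns an annulus into a rectangle, which yields mean values over circles and, after a disc
    automorphism, the identity theorem without Cauchy's formula. Uniqueness for x D' + beta D = 0
    replaces a comparison of coefficients, which would require re-expanding a series in x/(x-1) in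
    powers of x. Gauss' limit for Gamma is read through a total limit operator, so its convergence
    and nonvanishing have to be proved; beyond these only Gamma(z+1) = z Gamma(z) is used. A root
    lambda enters through (1-lambda)_n / (-lambda)_n = (n-lambda)/(-lambda), so that the product
    over all roots of T is T(n)/T(0); roots that avoid the natural numbers make T(0) nonzero. *)

Definition Cder (f : C -> C) (z L : C) : Prop :=
  forall eps : R, (0 < eps) -> exists d : R, (0 < d) /\
    forall h : C, (Cmod h < d) ->
      (Cmod (f (z + h) - f z - L * h) <= eps * Cmod h).

Lemma Cder_ext_loc (f g : C -> C) (z L : C) (r : R) :
  (0 < r) -> (forall h, (Cmod h < r) -> f (z + h) = g (z + h)) ->
  Cder f z L -> Cder g z L.
Proof.
  intros Hr He Hf e Pe. destruct (Hf e Pe) as [d [Pd Hd]].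
  exists (Rmin d r). split. now apply Rmin_pos.
  intros h Hh. pose proof (Rmin_l d r). pose proof (Rmin_r d r).
  rewrite <- He by lra.
  assert (E : g z = f z).
  { replace z with (z + 0) by ring. symmetry. apply He. rewrite Cmod_0. lra. }
  rewrite E. apply Hd. lra.
Qed.

Lemma Cder_ext (f g : C -> C) (z L : C) :
  (forall w, f w = g w) -> Cder f z L -> Cder g z L.
Proof. intros He. apply Cder_ext_loc with 1%R; auto. lra. Qed.

Lemma Cder_const (c z : C) : Cder (fun _ => c) z 0.
Proof.
  intros e Pe. exists 1%R. split. lra. intros h _.
  replace (c - c - 0 * h) with (RtoC 0) by ring. rewrite Cmod_0.
  pose proof (Cmod_ge_0 h). nra.
Qed.

Lemma Cder_id (z : C) : Cder (fun w => w) z 1.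
Proof.
  intros e Pe. exists 1%R. split. lra. intros h _.
  replace (z + h - z - 1 * h) with (RtoC 0) by ring. rewrite Cmod_0.
  pose proof (Cmod_ge_0 h). nra.
Qed.

Lemma Cder_plus (f g : C -> C) (z L M : C) :
  Cder f z L -> Cder g z M -> Cder (fun w => f w + g w) z (L + M).
Proof.
  intros Hf Hg e Pe.
  destruct (Hf (e / 2)%R) as [d [Pd Hd]]. lra.
  destruct (Hg (e / 2)%R) as [d' [Pd' Hd']]. lra.
  exists (Rmin d d'). split. now apply Rmin_pos.
  intros h Hh. pose proof (Rmin_l d d'). pose proof (Rmin_r d d').
  replace (f (z + h) + g (z + h) - (f z + g z) - (L + M) * h)
    with ((f (z + h) - f z - L * h) + (g (z + h) - g z - M * h)) by ring.
  eapply Rle_trans. apply Cmod_triangle.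
  specialize (Hd h ltac:(lra)). specialize (Hd' h ltac:(lra)). lra.
Qed.

Lemma Cder_lipschitz (f : C -> C) (z L : C) : Cder f z L ->
  exists d, (0 < d) /\
    forall h, (Cmod h < d) -> (Cmod (f (z + h) - f z) <= (Cmod L + 1) * Cmod h).
Proof.
  intros Hf. destruct (Hf 1%R) as [d [Pd Hd]]. lra.
  exists d. split. exact Pd. intros h Hh. specialize (Hd h Hh).
  replace (f (z + h) - f z) with ((f (z + h) - f z - L * h) + L * h) by ring.
  eapply Rle_trans. apply Cmod_triangle. rewrite Cmod_mult. lra.
Qed.

Lemma Cder_cont (f : C -> C) (z L : C) : Cder f z L ->
  forall eps, (0 < eps) -> exists d, (0 < d) /\
    forall h, (Cmod h < d) -> (Cmod (f (z + h) - f z) < eps).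
Proof.
  intros Hf e Pe. destruct (Cder_lipschitz _ _ _ Hf) as [d [Pd Hd]].
  pose proof (Cmod_ge_0 L).
  assert (P : (0 < e / (Cmod L + 1))) by (apply Rdiv_lt_0_compat; lra).
  exists (Rmin d (e / (Cmod L + 1))). split. now apply Rmin_pos.
  intros h Hh. pose proof (Rmin_l d (e / (Cmod L + 1))). pose proof (Rmin_r d (e / (Cmod L + 1))).
  eapply Rle_lt_trans. apply Hd. lra.
  replace e with ((Cmod L + 1) * (e / (Cmod L + 1)))%R at 1 by (field; lra).
  apply Rmult_lt_compat_l; lra.
Qed.

Lemma Cder_mult (f g : C -> C) (z L M : C) :
  Cder f z L -> Cder g z M -> Cder (fun w => f w * g w) z (L * g z + f z * M).
Proof.
  intros Hf Hg e Pe.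
  pose proof (Cmod_ge_0 L) as PL. pose proof (Cmod_ge_0 (f z)) as Pf.
  pose proof (Cmod_ge_0 (g z)) as Pg.
  (* The three error terms of the product carry the factors |g z| + 1, |f z| and |L|, and [K] is
     their sum; capping e' at 1 bounds |g (z + h)| by |g z| + 1. *)
  set (K := (Cmod (g z) + 1 + Cmod (f z) + Cmod L)%R).
  assert (PK : (0 < K)) by (unfold K; lra).
  assert (Pe' : (0 < Rmin (e / K) 1)) by (apply Rmin_pos; [apply Rdiv_lt_0_compat|]; lra).
  pose proof (Rmin_l (e / K) 1). pose proof (Rmin_r (e / K) 1).
  set (e' := Rmin (e / K) 1) in *.
  destruct (Hf e' Pe') as [d1 [P1 H1]].
  destruct (Hg e' Pe') as [d2 [P2 H2]].
  destruct (Cder_cont _ _ _ Hg e' Pe') as [d3 [P3 H3]].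
  exists (Rmin d1 (Rmin d2 d3)). split. repeat apply Rmin_pos; lra.
  intros h Hh. pose proof (Rmin_l d1 (Rmin d2 d3)). pose proof (Rmin_r d1 (Rmin d2 d3)).
  pose proof (Rmin_l d2 d3). pose proof (Rmin_r d2 d3).
  specialize (H1 h ltac:(lra)). specialize (H2 h ltac:(lra)). specialize (H3 h ltac:(lra)).
  replace (f (z + h) * g (z + h) - f z * g z - (L * g z + f z * M) * h)
    with ((f (z + h) - f z - L * h) * (g z + (g (z + h) - g z))
          + (f z * (g (z + h) - g z - M * h) + L * (g (z + h) - g z) * h)) by ring.
  eapply Rle_trans. apply Cmod_triangle.
  eapply Rle_trans. apply Rplus_le_compat_l, Cmod_triangle.
  rewrite !Cmod_mult.
  assert (Q1 : (Cmod (g z + (g (z + h) - g z)) <= Cmod (g z) + 1)).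
  { eapply Rle_trans. apply Cmod_triangle. lra. }
  pose proof (Cmod_ge_0 h) as Ph.
  apply Rle_trans with (e' * Cmod h * (Cmod (g z) + 1) + (Cmod (f z) * (e' * Cmod h) + Cmod L * e' * Cmod h))%R.
  - apply Rplus_le_compat.
    + apply Rmult_le_compat; auto using Cmod_ge_0.
    + apply Rplus_le_compat.
      * now apply Rmult_le_compat_l.
      * apply Rmult_le_compat_r. exact Ph. apply Rmult_le_compat_l. exact PL. lra.
  - replace (e' * Cmod h * (Cmod (g z) + 1) + (Cmod (f z) * (e' * Cmod h) + Cmod L * e' * Cmod h))%R
      with (e' * K * Cmod h)%R by (unfold K; ring).
    apply Rmult_le_compat_r. exact Ph.
    replace e with (e / K * K)%R by (field; lra).
    apply Rmult_le_compat_r; lra.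
Qed.

Lemma Cder_scal (c : C) (f : C -> C) (z L : C) :
  Cder f z L -> Cder (fun w => c * f w) z (c * L).
Proof.
  intros Hf. replace (c * L) with (0 * f z + c * L) by ring.
  apply (Cder_mult (fun _ => c) f); auto. apply Cder_const.
Qed.

Lemma Cder_minus (f g : C -> C) (z L M : C) :
  Cder f z L -> Cder g z M -> Cder (fun w => f w - g w) z (L - M).
Proof.
  intros Hf Hg. replace (L - M) with (L + (-(1)) * M) by ring.
  apply Cder_ext with (fun w => f w + (-(1)) * g w). intros; ring.
  apply Cder_plus; auto. now apply Cder_scal.
Qed.

Lemma Cder_comp (g f : C -> C) (z L M : C) :
  Cder f z L -> Cder g (f z) M -> Cder (fun w => g (f w)) z (M * L).
Proof.
  intros Hf Hg e Pe.
  pose proof (Cmod_ge_0 L) as PL. pose proof (Cmod_ge_0 M) as PM.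
  assert (Pe1 : (0 < e / (2 * (Cmod L + 1)))) by (apply Rdiv_lt_0_compat; lra).
  assert (Pe2 : (0 < e / (2 * (Cmod M + 1)))) by (apply Rdiv_lt_0_compat; lra).
  destruct (Hg _ Pe1) as [d1 [P1 H1]].
  destruct (Hf _ Pe2) as [d2 [P2 H2]].
  destruct (Cder_cont _ _ _ Hf d1 P1) as [d3 [P3 H3]].
  destruct (Cder_lipschitz _ _ _ Hf) as [d4 [P4 H4]].
  exists (Rmin (Rmin d2 d3) d4). split. repeat apply Rmin_pos; lra.
  intros h Hh. pose proof (Rmin_l (Rmin d2 d3) d4). pose proof (Rmin_r (Rmin d2 d3) d4).
  pose proof (Rmin_l d2 d3). pose proof (Rmin_r d2 d3).
  specialize (H3 h ltac:(lra)). specialize (H1 _ H3). specialize (H2 h ltac:(lra)).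
  specialize (H4 h ltac:(lra)).
  replace (f z + (f (z + h) - f z)) with (f (z + h)) in H1 by ring.
  replace (g (f (z + h)) - g (f z) - M * L * h)
    with ((g (f (z + h)) - g (f z) - M * (f (z + h) - f z)) + M * (f (z + h) - f z - L * h)) by ring.
  eapply Rle_trans. apply Cmod_triangle. rewrite (Cmod_mult M).
  pose proof (Cmod_ge_0 h) as Ph.
  assert (Q1 : (e / (2 * (Cmod L + 1)) * Cmod (f (z + h) - f z) <= e / 2 * Cmod h)).
  { replace (e / 2 * Cmod h)%R with (e / (2 * (Cmod L + 1)) * ((Cmod L + 1) * Cmod h))%R by (field; lra).
    apply Rmult_le_compat_l; lra. }
  assert (Q2 : (Cmod M * Cmod (f (z + h) - f z - L * h) <= e / 2 * Cmod h)).
  { apply Rle_trans with ((Cmod M + 1) * (e / (2 * (Cmod M + 1)) * Cmod h))%R.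
    apply Rmult_le_compat; auto using Cmod_ge_0; lra.
    right. field. lra. }
  lra.
Qed.

Lemma Cder_inv (z : C) : z <> 0 -> Cder (fun w => / w) z (- / (z * z)).
Proof.
  intros Hz e Pe. assert (Pz : (0 < Cmod z)) by now apply Cmod_gt_0.
  set (a := Cmod z) in *.
  (* The remainder is h^2 / (z^2 (z + h)), and |h| < a/2 keeps the modulus of its denominator above
     a^3 / 2. *)
  assert (Pe' : (0 < e * (a * a * a) / 2)).
  { apply Rdiv_lt_0_compat; [|lra]. repeat apply Rmult_lt_0_compat; lra. }
  exists (Rmin (a / 2) (e * (a * a * a) / 2)). split. apply Rmin_pos; lra.
  intros h Hh. pose proof (Rmin_l (a / 2) (e * (a * a * a) / 2)).
  pose proof (Rmin_r (a / 2) (e * (a * a * a) / 2)).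
  assert (Q : (a / 2 < Cmod (z + h))).
  { pose proof (Cmod_triangle (z + h) (- h)) as T.
    replace (z + h + - h) with z in T by ring. rewrite Cmod_opp in T. fold a in T. lra. }
  assert (Hzh : z + h <> 0) by (apply Cmod_gt_0; lra).
  replace (/ (z + h) - / z - - / (z * z) * h) with (h * h / (z * z * (z + h))) by (field; auto).
  rewrite Cmod_div by (repeat apply Cmult_neq_0; auto).
  rewrite !Cmod_mult. fold a. pose proof (Cmod_ge_0 h) as Ph.
  assert (Pd : (0 < a * a * Cmod (z + h))) by (repeat apply Rmult_lt_0_compat; lra).
  apply Rmult_le_reg_r with (a * a * Cmod (z + h))%R. exact Pd.
  replace (Cmod h * Cmod h / (a * a * Cmod (z + h)) * (a * a * Cmod (z + h)))%R
    with (Cmod h * Cmod h)%R by (field; split; lra).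
  replace (e * Cmod h * (a * a * Cmod (z + h)))%R with ((e * (a * a * Cmod (z + h))) * Cmod h)%R by ring.
  apply Rmult_le_compat_r. exact Ph.
  apply Rle_trans with (e * (a * a * a) / 2)%R. lra.
  replace (e * (a * a * a) / 2)%R with (e * (a * a * (a / 2)))%R by field.
  repeat apply Rmult_le_compat_l; try lra. apply Rmult_le_pos; lra.
Qed.

Lemma Cder_div (f g : C -> C) (z L M : C) : g z <> 0 ->
  Cder f z L -> Cder g z M ->
  Cder (fun w => f w / g w) z ((L * g z - f z * M) / (g z * g z)).
Proof.
  intros Hz Hf Hg.
  replace ((L * g z - f z * M) / (g z * g z))
    with (L * / g z + f z * (- / (g z * g z) * M)) by (field; auto).
  apply (Cder_mult f (fun w => / g w)); auto.
  apply (Cder_comp Cinv g); auto. now apply Cder_inv.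
Qed.

Lemma Cder_pow (f : C -> C) (z L : C) (n : nat) :
  Cder f z L -> exists M, Cder (fun w => (f w ^ n)%C) z M.
Proof.
  intros Hf. induction n as [|n [M HM]].
  - exists 0. apply (Cder_const 1).
  - eexists. apply (Cder_mult f (fun w => f w ^ n)%C); eassumption.
Qed.

Lemma Cder_csum (n : nat) (f : nat -> C -> C) (L : nat -> C) (z : C) :
  (forall k, (k < n)%nat -> Cder (f k) z (L k)) ->
  Cder (fun w => csum n (fun k => f k w)) z (csum n L).
Proof.
  induction n as [|n IH]; intros H; simpl.
  - apply (Cder_const 0).
  - apply Cder_plus. apply IH. intros; apply H; lia. apply H; lia.
Qed.

(** * Modulus estimates and the complex exponential *)

Lemma Cmod_le_ReIm (z : C) : (Cmod z <= Rabs (Re z) + Rabs (Im z)).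
Proof.
  apply Rsqr_incr_0_var.
  - unfold Rsqr. replace (Cmod z * Cmod z)%R with (Cmod z ^ 2)%R by ring.
    rewrite Cmod2_alt, <- (pow2_abs (Re z)), <- (pow2_abs (Im z)).
    pose proof (Rabs_pos (Re z)). pose proof (Rabs_pos (Im z)). nra.
  - pose proof (Rabs_pos (Re z)). pose proof (Rabs_pos (Im z)). lra.
Qed.

Lemma im_le_Cmod (z : C) : (Rabs (Im z) <= Cmod z).
Proof. eapply Rle_trans; [|apply Rmax_Cmod]. apply Rmax_r. Qed.

Lemma C_ext (z w : C) : Re z = Re w -> Im z = Im w -> z = w.
Proof. destruct z, w; simpl; intros; subst; auto. Qed.

Lemma Cexp_0 : Cexp 0 = 1.
Proof. unfold Cexp. simpl. rewrite exp_0, cos_0, sin_0. apply C_ext; simpl; ring. Qed.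

Lemma Cexp_plus (z w : C) : Cexp (z + w) = Cexp z * Cexp w.
Proof.
  destruct z as [x y], w as [u v]. unfold Cexp. simpl.
  rewrite exp_plus, cos_plus, sin_plus. apply C_ext; simpl; ring.
Qed.

Lemma Cmod_Cexp (z : C) : Cmod (Cexp z) = exp (Re z).
Proof.
  destruct z as [x y]. unfold Cexp, Cmod; simpl.
  pose proof (sin2_cos2 y) as H. unfold Rsqr in H.
  replace (exp x * cos y * (exp x * cos y * 1) + exp x * sin y * (exp x * sin y * 1))%R
    with (exp x * exp x * (sin y * sin y + cos y * cos y))%R by ring.
  rewrite H, Rmult_1_r. apply sqrt_square. left. apply exp_pos.
Qed.

Lemma Cexp_neq_0 (z : C) : Cexp z <> 0.
Proof. apply Cmod_gt_0. rewrite Cmod_Cexp. apply exp_pos. Qed.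

Lemma derivable_pt_lim_eps (f : R -> R) (l : R) : f 0%R = 0%R -> derivable_pt_lim f 0 l ->
  forall eps, (0 < eps) -> exists d, (0 < d) /\
   forall h, (Rabs h < d) -> (Rabs (f h - l * h) <= eps * Rabs h).
Proof.
  intros H0 Hf e Pe. destruct (Hf e Pe) as [d Hd]. exists d. split. apply cond_pos.
  intros h Hh. destruct (Req_dec h 0) as [->|Nz].
  - rewrite H0, Rabs_R0. replace (0 - l * 0)%R with 0%R by ring. rewrite Rabs_R0. lra.
  - specialize (Hd h Nz Hh). rewrite Rplus_0_l, H0 in Hd.
    replace (f h - l * h)%R with (((f h - 0) / h - l) * h)%R by (field; auto).
    rewrite Rabs_mult. apply Rmult_le_compat_r. apply Rabs_pos. lra.
Qed.

Lemma Cder_exp_0 : Cder Cexp 0 1.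
Proof.
  intros e Pe.
  (* The real and imaginary errors below come to at most 3 k |h| and 4 k |h|, so e/10 leaves room; k
     <= 1 gives |x| <= 1 and hence |1 + x| <= 2. *)
  set (k := Rmin (e / 10) 1).
  assert (Pk : (0 < k)) by (apply Rmin_pos; lra).
  assert (K1 : (k <= e / 10)) by apply Rmin_l. assert (K2 : (k <= 1)) by apply Rmin_r.
  destruct (derivable_pt_lim_eps (fun x => exp x - 1)%R 1) with (eps := k) as [d1 [P1 H1]].
  { rewrite exp_0; ring. }
  { replace 1%R with (exp 0 - 0)%R by (rewrite exp_0; ring).
    apply (derivable_pt_lim_minus exp (fun _ => (exp 0 - 0)%R)).
    apply derivable_pt_lim_exp. apply derivable_pt_lim_const. }
  { exact Pk. }
  destruct (derivable_pt_lim_eps sin 1) with (eps := k) as [d2 [P2 H2]].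
  { apply sin_0. } { rewrite <- cos_0. apply derivable_pt_lim_sin. } { exact Pk. }
  destruct (derivable_pt_lim_eps (fun x => cos x - 1)%R 0) with (eps := k) as [d3 [P3 H3]].
  { rewrite cos_0; ring. }
  { replace 0%R with (- sin 0 - 0)%R at 2 by (rewrite sin_0; ring).
    apply (derivable_pt_lim_minus cos (fun _ => 1%R)).
    apply derivable_pt_lim_cos. apply derivable_pt_lim_const. }
  { exact Pk. }
  exists (Rmin k (Rmin d1 (Rmin d2 d3))). split. repeat apply Rmin_pos; lra.
  intros h Hh.
  pose proof (Rmin_l k (Rmin d1 (Rmin d2 d3))). pose proof (Rmin_r k (Rmin d1 (Rmin d2 d3))).
  pose proof (Rmin_l d1 (Rmin d2 d3)). pose proof (Rmin_r d1 (Rmin d2 d3)).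
  pose proof (Rmin_l d2 d3). pose proof (Rmin_r d2 d3).
  pose proof (re_le_Cmod h) as Rh. pose proof (im_le_Cmod h) as Ih.
  rewrite Cplus_0_l, Cexp_0.
  destruct h as [x y]. simpl in Rh, Ih. set (c := Cmod (x, y)) in *.
  specialize (H1 x ltac:(lra)). specialize (H2 y ltac:(lra)). specialize (H3 y ltac:(lra)).
  rewrite Rmult_1_l in H1, H2. rewrite Rmult_0_l, Rminus_0_r in H3.
  eapply Rle_trans. apply Cmod_le_ReIm. unfold Cexp. simpl.
  replace (exp x * cos y + - (1) + - (1 * x - 0 * y))%R
    with ((exp x - 1 - x) * cos y + (1 + x) * (cos y - 1))%R by ring.
  replace (exp x * sin y + - 0 + - (1 * y + 0 * x))%R
    with ((exp x - 1 - x) * sin y + (1 + x) * (sin y - y) + x * y)%R by ring.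
  assert (B1 : (Rabs (cos y) <= 1)) by (apply Rabs_le; pose proof (COS_bound y); lra).
  assert (B2 : (Rabs (sin y) <= 1)) by (apply Rabs_le; pose proof (SIN_bound y); lra).
  assert (B3 : (Rabs (1 + x) <= 2)).
  { eapply Rle_trans. apply Rabs_triang. rewrite Rabs_R1. lra. }
  pose proof (Rabs_pos x). pose proof (Rabs_pos y).
  assert (Hc : (0 <= c)) by apply Cmod_ge_0.
  assert (X1 : (Rabs (exp x - 1 - x) <= k * c)).
  { eapply Rle_trans. exact H1. apply Rmult_le_compat_l; lra. }
  assert (X2 : (Rabs (sin y - y) <= k * c)).
  { eapply Rle_trans. exact H2. apply Rmult_le_compat_l; lra. }
  assert (X3 : (Rabs (cos y - 1) <= k * c)).
  { eapply Rle_trans. exact H3. apply Rmult_le_compat_l; lra. }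
  assert (X4 : (Rabs (x * y) <= k * c)).
  { rewrite Rabs_mult. apply Rmult_le_compat; lra. }
  assert (T1 : (Rabs ((exp x - 1 - x) * cos y + (1 + x) * (cos y - 1)) <= k * c * 1 + 2 * (k * c))).
  { eapply Rle_trans. apply Rabs_triang. rewrite !Rabs_mult.
    apply Rplus_le_compat; apply Rmult_le_compat; auto using Rabs_pos. }
  assert (T2 : (Rabs ((exp x - 1 - x) * sin y + (1 + x) * (sin y - y) + x * y) <= k * c * 1 + 2 * (k * c) + k * c)).
  { eapply Rle_trans. apply Rabs_triang. apply Rplus_le_compat; auto.
    eapply Rle_trans. apply Rabs_triang. rewrite !Rabs_mult.
    apply Rplus_le_compat; apply Rmult_le_compat; auto using Rabs_pos. }
  assert (Z : (k * c <= e / 10 * c)) by (apply Rmult_le_compat_r; lra).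
  nra.
Qed.

Lemma Cder_exp (z : C) : Cder Cexp z (Cexp z).
Proof.
  replace (Cexp z) with (Cexp z * (1 * 1)) by ring.
  apply Cder_ext with (fun w => Cexp z * Cexp (w - z)).
  { intros w. rewrite <- Cexp_plus. f_equal. ring. }
  apply (Cder_scal _ (fun w => Cexp (w - z))). apply (Cder_comp Cexp (fun w => w - z)).
  - replace (RtoC 1) with (1 - 0) by ring. apply (Cder_minus (fun w => w) (fun _ => z)). apply Cder_id. apply Cder_const.
  - replace (z - z) with (RtoC 0) by ring. apply Cder_exp_0.
Qed.

(** * Derivatives along a real parameter *)

(** Componentwise, so that the real mean value theorem applies to each part; [Rder_eps] gives the
    equivalent remainder form, which serves for the chain rule with [Cder]. *)
Definition Rder (f : R -> C) (t : R) (L : C) : Prop :=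
  is_derive (fun s => Re (f s)) t (Re L) /\ is_derive (fun s => Im (f s)) t (Im L).

Lemma Rder_eps (f : R -> C) (t : R) (L : C) : Rder f t L <->
  forall eps : R, (0 < eps) -> exists d : R, (0 < d) /\
    forall h : R, (Rabs h < d) ->
      (Cmod (f (t + h)%R - f t - L * h) <= eps * Rabs h).
Proof.
  split.
  - intros [H1 H2] e Pe. apply is_derive_Reals in H1. apply is_derive_Reals in H2.
    destruct (H1 (e / 2)%R) as [d1 D1]. lra.
    destruct (H2 (e / 2)%R) as [d2 D2]. lra.
    exists (Rmin d1 d2). split. apply Rmin_pos; apply cond_pos.
    intros h Hh. pose proof (Rmin_l d1 d2). pose proof (Rmin_r d1 d2).
    destruct (Req_dec h 0) as [->|Nz].
    { rewrite Rplus_0_r. replace (f t - f t - L * 0) with (RtoC 0) by ring.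
      rewrite Cmod_0, Rabs_R0. lra. }
    specialize (D1 h Nz ltac:(lra)). specialize (D2 h Nz ltac:(lra)).
    pose proof (Rabs_pos_lt h Nz).
    eapply Rle_trans. apply Cmod_le_ReIm.
    replace (Re (f (t + h)%R - f t - L * h))
      with (((Re (f (t + h)%R) - Re (f t)) / h - Re L) * h)%R
      by (destruct (f (t+h)%R), (f t), L; simpl; field; auto).
    replace (Im (f (t + h)%R - f t - L * h))
      with (((Im (f (t + h)%R) - Im (f t)) / h - Im L) * h)%R
      by (destruct (f (t+h)%R), (f t), L; simpl; field; auto).
    rewrite !Rabs_mult. nra.
  - intros H. split; apply is_derive_Reals; intros e Pe;
      destruct (H (e / 2)%R) as [d [Pd Hd]]; try lra;
      exists (mkposreal d Pd); intros h Nz Hh; simpl in Hh; specialize (Hd h Hh);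
      pose proof (Rabs_pos_lt h Nz); apply Rmult_lt_reg_r with (Rabs h); auto;
      rewrite <- Rabs_mult.
    + replace (((Re (f (t + h)%R) - Re (f t)) / h - Re L) * h)%R
        with (Re (f (t + h)%R - f t - L * h))
        by (destruct (f (t+h)%R), (f t), L; simpl; field; auto).
      eapply Rle_lt_trans. apply re_le_Cmod. nra.
    + replace (((Im (f (t + h)%R) - Im (f t)) / h - Im L) * h)%R
        with (Im (f (t + h)%R - f t - L * h))
        by (destruct (f (t+h)%R), (f t), L; simpl; field; auto).
      eapply Rle_lt_trans. apply im_le_Cmod. nra.
Qed.

Lemma Rder_comp (g : C -> C) (f : R -> C) (t : R) (L M : C) :
  Rder f t L -> Cder g (f t) M -> Rder (fun s => g (f s)) t (M * L).
Proof.
  intros Hf Hg. rewrite Rder_eps in *. intros e Pe.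
  pose proof (Cmod_ge_0 L) as PL. pose proof (Cmod_ge_0 M) as PM.
  assert (Pe1 : (0 < e / (2 * (Cmod L + 1)))) by (apply Rdiv_lt_0_compat; lra).
  assert (Pe2 : (0 < e / (2 * (Cmod M + 1)))) by (apply Rdiv_lt_0_compat; lra).
  destruct (Hg _ Pe1) as [d1 [P1 H1]].
  destruct (Hf _ Pe2) as [d2 [P2 H2]].
  destruct (Hf 1%R) as [d4 [P4 H4]]. lra.
  assert (P3 : (0 < d1 / (Cmod L + 1))) by (apply Rdiv_lt_0_compat; lra).
  exists (Rmin (Rmin d2 (d1 / (Cmod L + 1))) d4). split. repeat apply Rmin_pos; lra.
  intros h Hh.
  pose proof (Rmin_l (Rmin d2 (d1 / (Cmod L + 1))) d4). pose proof (Rmin_r (Rmin d2 (d1 / (Cmod L + 1))) d4).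
  pose proof (Rmin_l d2 (d1 / (Cmod L + 1))). pose proof (Rmin_r d2 (d1 / (Cmod L + 1))).
  specialize (H2 h ltac:(lra)). specialize (H4 h ltac:(lra)).
  assert (Lip : (Cmod (f (t + h)%R - f t) <= (Cmod L + 1) * Rabs h)).
  { replace (f (t + h)%R - f t) with ((f (t + h)%R - f t - L * h) + L * h) by ring.
    eapply Rle_trans. apply Cmod_triangle. rewrite Cmod_mult, Cmod_R. lra. }
  assert (Sm : (Cmod (f (t + h)%R - f t) < d1)).
  { eapply Rle_lt_trans. exact Lip.
    replace d1 with ((Cmod L + 1) * (d1 / (Cmod L + 1)))%R by (field; lra).
    apply Rmult_lt_compat_l; lra. }
  specialize (H1 _ Sm).
  replace (f t + (f (t + h)%R - f t)) with (f (t + h)%R) in H1 by ring.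
  replace (g (f (t + h)%R) - g (f t) - M * L * h)
    with ((g (f (t + h)%R) - g (f t) - M * (f (t + h)%R - f t)) + M * (f (t + h)%R - f t - L * h)) by ring.
  eapply Rle_trans. apply Cmod_triangle. rewrite (Cmod_mult M).
  pose proof (Rabs_pos h) as Ph.
  assert (Q1 : (e / (2 * (Cmod L + 1)) * Cmod (f (t + h)%R - f t) <= e / 2 * Rabs h)).
  { replace (e / 2 * Rabs h)%R with (e / (2 * (Cmod L + 1)) * ((Cmod L + 1) * Rabs h))%R by (field; lra).
    apply Rmult_le_compat_l; lra. }
  assert (Q2 : (Cmod M * Cmod (f (t + h)%R - f t - L * h) <= e / 2 * Rabs h)).
  { apply Rle_trans with ((Cmod M + 1) * (e / (2 * (Cmod M + 1)) * Rabs h))%R.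
    apply Rmult_le_compat; auto using Cmod_ge_0; lra.
    right. field. lra. }
  lra.
Qed.

Lemma Rder_mult (f g : R -> C) (t : R) (L M : C) :
  Rder f t L -> Rder g t M -> Rder (fun s => f s * g s) t (L * g t + f t * M).
Proof.
  intros [F1 F2] [G1 G2]. split; simpl.
  - replace (fst L * fst (g t) - snd L * snd (g t) + (fst (f t) * fst M - snd (f t) * snd M))%R
      with (Re L * Re (g t) + Re (f t) * Re M - (Im L * Im (g t) + Im (f t) * Im M))%R by (unfold Re, Im; ring).
    apply (is_derive_minus (fun s => Re (f s) * Re (g s))%R (fun s => Im (f s) * Im (g s))%R);
      apply (is_derive_mult (K := R_AbsRing)); auto; intros; apply Rmult_comm.
  - replace (fst L * snd (g t) + snd L * fst (g t) + (fst (f t) * snd M + snd (f t) * fst M))%R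
      with ((Re L * Im (g t) + Re (f t) * Im M) + (Im L * Re (g t) + Im (f t) * Re M))%R by (unfold Re, Im; ring).
    apply (is_derive_plus (fun s => Re (f s) * Im (g s))%R (fun s => Im (f s) * Re (g s))%R);
      apply (is_derive_mult (K := R_AbsRing)); auto; intros; apply Rmult_comm.
Qed.

Lemma Rder_affine (z w : C) (t : R) : Rder (fun s => z + s * w) t w.
Proof.
  apply Rder_eps. intros e Pe. exists 1%R. split. lra. intros h _.
  rewrite RtoC_plus.
  replace (z + (t + h) * w - (z + t * w) - w * h) with (RtoC 0) by ring.
  rewrite Cmod_0. pose proof (Rabs_pos h). nra.
Qed.

Lemma is_derive_zero_const (f : R -> R) (a b : R) :
  (forall t, (Rmin a b <= t <= Rmax a b) -> is_derive f t 0%R) -> f a = f b.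
Proof.
  intros H. destruct (MVT_gen f a b (fun _ => 0%R)) as [c [_ Hc]].
  - intros t Ht. apply H. lra.
  - intros t Ht. apply continuity_pt_filterlim.
    apply (ex_derive_continuous f t). exists 0%R. now apply H.
  - lra.
Qed.

Lemma Rder_zero_const (f : R -> C) (a b : R) :
  (forall t, (Rmin a b <= t <= Rmax a b) -> Rder f t 0) -> f a = f b.
Proof.
  intros H. apply C_ext.
  - apply (is_derive_zero_const (fun s => Re (f s))). intros t Ht. apply (H t Ht).
  - apply (is_derive_zero_const (fun s => Im (f s))). intros t Ht. apply (H t Ht).
Qed.


(** * Goursat's theorem, mean values and the identity theorem *)

(** Total differentiability in two real variables at a single point. How the partial derivatives px
    and py vary with the point is left open. *)
Definition diff2_at (P : R -> R -> R) (x y px py : R) : Prop :=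
  forall eps, 0 < eps -> exists d, 0 < d /\ forall x' y',
    Rabs (x' - x) < d -> Rabs (y' - y) < d ->
    Rabs (P x' y' - P x y - px * (x' - x) - py * (y' - y))
      <= eps * (Rabs (x' - x) + Rabs (y' - y)).

Lemma diff2_at_continuous (P : R -> R -> R) (x y px py : R) : diff2_at P x y px py ->
  forall eps, 0 < eps -> exists d, 0 < d /\ forall x' y',
    Rabs (x' - x) < d -> Rabs (y' - y) < d -> Rabs (P x' y' - P x y) < eps.
Proof.
  intros H e Pe. destruct (H 1%R) as [d [Pd Hd]]. lra.
  pose proof (Rabs_pos px). pose proof (Rabs_pos py).
  assert (Pq : 0 < e / (Rabs px + Rabs py + 3)) by (apply Rdiv_lt_0_compat; lra).
  exists (Rmin d (e / (Rabs px + Rabs py + 3))). split. now apply Rmin_pos.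
  intros x' y' Hx Hy.
  pose proof (Rmin_l d (e / (Rabs px + Rabs py + 3))).
  pose proof (Rmin_r d (e / (Rabs px + Rabs py + 3))).
  set (q := (e / (Rabs px + Rabs py + 3))%R) in *.
  specialize (Hd x' y' ltac:(lra) ltac:(lra)).
  assert (E : (e = (Rabs px + Rabs py + 3) * q)%R) by (unfold q; field; lra).
  replace (P x' y' - P x y)%R with ((P x' y' - P x y - px * (x' - x) - py * (y' - y))
     + (px * (x' - x) + py * (y' - y)))%R by ring.
  eapply Rle_lt_trans. apply Rabs_triang.
  eapply Rle_lt_trans. apply Rplus_le_compat. exact Hd. apply Rabs_triang.
  rewrite !Rabs_mult.
  assert (Rabs px * Rabs (x' - x) <= Rabs px * q) by (apply Rmult_le_compat_l; lra).
  assert (Rabs py * Rabs (y' - y) <= Rabs py * q) by (apply Rmult_le_compat_l; lra).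
  nra.
Qed.

Lemma diff2_at_continuous_l (P : R -> R -> R) (x y px py : R) :
  diff2_at P x y px py -> continuous (fun s => P s y) x.
Proof.
  intros H. apply continuity_pt_filterlim. intros e Pe.
  destruct (diff2_at_continuous _ _ _ _ _ H e Pe) as [d [Pd Hd]].
  exists d. split. exact Pd. intros x' [_ Hx]. apply Hd. exact Hx.
  rewrite Rminus_diag, Rabs_R0. exact Pd.
Qed.

Lemma diff2_at_continuous_r (P : R -> R -> R) (x y px py : R) :
  diff2_at P x y px py -> continuous (fun t => P x t) y.
Proof.
  intros H. apply continuity_pt_filterlim. intros e Pe.
  destruct (diff2_at_continuous _ _ _ _ _ H e Pe) as [d [Pd Hd]].
  exists d. split. exact Pd. intros x' [_ Hx]. apply Hd; [|exact Hx].
  rewrite Rminus_diag, Rabs_R0. exact Pd.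
Qed.

Lemma RInt_near_const (f : R -> R) (a b c M : R) : a <= b -> ex_RInt f a b ->
  (forall t, a <= t <= b -> Rabs (f t - c) <= M) ->
  Rabs (RInt f a b - (b - a) * c) <= (b - a) * M.
Proof.
  intros Hab Hf HM.
  replace (RInt f a b - (b - a) * c)%R with (RInt (fun t => minus (f t) c) a b).
  - apply abs_RInt_le_const; auto. apply (ex_RInt_minus f (fun _ => c)); auto.
    apply ex_RInt_const.
  - rewrite (RInt_minus f (fun _ => c)), RInt_const; auto. apply ex_RInt_const.
Qed.

(** The counterclockwise circulation of P dx + Q dy around the boundary of [x1,x2] x [y1,y2]. *)
Definition rect_circ (P Q : R -> R -> R) (x1 x2 y1 y2 : R) : R :=
  (RInt (fun s => P s y1) x1 x2 - RInt (fun s => P s y2) x1 x2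
   + (RInt (fun t => Q x2 t) y1 y2 - RInt (fun t => Q x1 t) y1 y2))%R.

Section Goursat.

Variables (P Q : R -> R -> R) (a b c d : R).
Hypothesis Hab : a <= b.
Hypothesis Hcd : c <= d.
(** The shared p2 is dP/dy = dQ/dx: the form P dx + Q dy is closed at every point. *)
Hypothesis Hclosed : forall x y, a <= x <= b -> c <= y <= d ->
  exists p1 p2 q2, diff2_at P x y p1 p2 /\ diff2_at Q x y p2 q2.

Lemma ex_RInt_hor (x1 x2 y : R) : a <= x1 <= x2 -> x2 <= b -> c <= y <= d ->
  ex_RInt (fun s => P s y) x1 x2.
Proof.
  intros H1 H2 Hy. apply (ex_RInt_continuous (fun s => P s y)). intros z Hz.
  rewrite Rmin_left, Rmax_right in Hz by lra.
  destruct (Hclosed z y) as (p1 & p2 & q2 & D & _); try lra.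
  eapply diff2_at_continuous_l, D.
Qed.

Lemma ex_RInt_ver (y1 y2 x : R) : c <= y1 <= y2 -> y2 <= d -> a <= x <= b ->
  ex_RInt (fun t => Q x t) y1 y2.
Proof.
  intros H1 H2 Hy. apply (ex_RInt_continuous (fun t => Q x t)). intros z Hz.
  rewrite Rmin_left, Rmax_right in Hz by lra.
  destruct (Hclosed x z) as (p1 & p2 & q2 & _ & D); try lra.
  eapply diff2_at_continuous_r, D.
Qed.

Lemma rect_circ_split (x1 x2 x3 y1 y2 y3 : R) :
  a <= x1 <= x2 -> x2 <= x3 <= b -> c <= y1 <= y2 -> y2 <= y3 <= d ->
  (rect_circ P Q x1 x3 y1 y3
   = rect_circ P Q x1 x2 y1 y2 + rect_circ P Q x2 x3 y1 y2
     + rect_circ P Q x1 x2 y2 y3 + rect_circ P Q x2 x3 y2 y3)%R.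
Proof.
  intros. unfold rect_circ.
  assert (CP : forall y, c <= y <= d ->
    (RInt (fun s => P s y) x1 x3 = RInt (fun s => P s y) x1 x2 + RInt (fun s => P s y) x2 x3)%R).
  { intros y Hy. symmetry. apply (RInt_Chasles (fun s => P s y)); apply ex_RInt_hor; lra. }
  assert (CQ : forall x, a <= x <= b ->
    (RInt (fun t => Q x t) y1 y3 = RInt (fun t => Q x t) y1 y2 + RInt (fun t => Q x t) y2 y3)%R).
  { intros x Hx. symmetry. apply (RInt_Chasles (fun t => Q x t)); apply ex_RInt_ver; lra. }
  rewrite (CP y1), (CP y3), (CQ x1), (CQ x3) by lra. ring.
Qed.

(** On a w by h rectangle the linear part of P contributes - p2 w h and that of Q contributes p2 w
    h, so closedness cancels them. What remains is the error of differentiability, at most eps (w +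
    h) on each pair of opposite sides per unit length. *)
Lemma rect_circ_small (x y : R) : a <= x <= b -> c <= y <= d ->
  forall eps, 0 < eps -> exists r, 0 < r /\ forall x1 x2 y1 y2,
    a <= x1 <= x -> x <= x2 <= b -> c <= y1 <= y -> y <= y2 <= d ->
    x2 - x1 < r -> y2 - y1 < r ->
    Rabs (rect_circ P Q x1 x2 y1 y2) <= eps * ((x2 - x1) + (y2 - y1)) ^ 2.
Proof.
  intros Hx Hy e Pe.
  destruct (Hclosed x y Hx Hy) as (p1 & p2 & q2 & DP & DQ).
  destruct (DP (e / 2)%R) as [r1 [R1 H1]]. lra.
  destruct (DQ (e / 2)%R) as [r2 [R2 H2]]. lra.
  exists (Rmin r1 r2). split. now apply Rmin_pos.
  intros x1 x2 y1 y2 X1 X2 Y1 Y2 Hw Hh.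
  pose proof (Rmin_l r1 r2). pose proof (Rmin_r r1 r2).
  set (w := (x2 - x1)%R) in *. set (h := (y2 - y1)%R) in *.
  assert (BP : forall s t, x1 <= s <= x2 -> y1 <= t <= y2 ->
    Rabs (P s t - P x y - p1 * (s - x) - p2 * (t - y)) <= e / 2 * (w + h)).
  { intros s t Hs Ht.
    assert (Rabs (s - x) <= w) by (apply Rabs_le; unfold w; lra).
    assert (Rabs (t - y) <= h) by (apply Rabs_le; unfold h; lra).
    eapply Rle_trans. apply H1; lra. apply Rmult_le_compat_l; lra. }
  assert (BQ : forall s t, x1 <= s <= x2 -> y1 <= t <= y2 ->
    Rabs (Q s t - Q x y - p2 * (s - x) - q2 * (t - y)) <= e / 2 * (w + h)).
  { intros s t Hs Ht.
    assert (Rabs (s - x) <= w) by (apply Rabs_le; unfold w; lra).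
    assert (Rabs (t - y) <= h) by (apply Rabs_le; unfold h; lra).
    eapply Rle_trans. apply H2; lra. apply Rmult_le_compat_l; lra. }
  unfold rect_circ.
  assert (E1 : (RInt (fun s => P s y1) x1 x2 - RInt (fun s => P s y2) x1 x2
    = RInt (fun s => minus (P s y1) (P s y2)) x1 x2)%R).
  { symmetry. apply (RInt_minus (fun s => P s y1) (fun s => P s y2)); apply ex_RInt_hor; lra. }
  assert (E2 : (RInt (fun t => Q x2 t) y1 y2 - RInt (fun t => Q x1 t) y1 y2
    = RInt (fun t => minus (Q x2 t) (Q x1 t)) y1 y2)%R).
  { symmetry. apply (RInt_minus (fun t => Q x2 t) (fun t => Q x1 t)); apply ex_RInt_ver; lra. }
  rewrite E1, E2.
  assert (I1 := RInt_near_const (fun s => minus (P s y1) (P s y2)) x1 x2 (- (p2 * h)) (e * (w + h))).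
  assert (I2 := RInt_near_const (fun t => minus (Q x2 t) (Q x1 t)) y1 y2 (p2 * w) (e * (w + h))).
  fold w in I1. fold h in I2.
  assert (J1 : Rabs (RInt (fun s => minus (P s y1) (P s y2)) x1 x2 - w * - (p2 * h)) <= w * (e * (w + h))).
  { apply I1. lra. apply (ex_RInt_minus (fun s => P s y1) (fun s => P s y2)); apply ex_RInt_hor; lra.
    intros s Hs. unfold minus, plus, opp; simpl.
    pose proof (BP s y1 Hs ltac:(lra)) as A1. pose proof (BP s y2 Hs ltac:(lra)) as A2.
    apply Rabs_le_between in A1. apply Rabs_le_between in A2. apply Rabs_le. unfold h in *. lra. }
  assert (J2 : Rabs (RInt (fun t => minus (Q x2 t) (Q x1 t)) y1 y2 - h * (p2 * w)) <= h * (e * (w + h))).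
  { apply I2. lra. apply (ex_RInt_minus (fun t => Q x2 t) (fun t => Q x1 t)); apply ex_RInt_ver; lra.
    intros t Ht. unfold minus, plus, opp; simpl.
    pose proof (BQ x1 t ltac:(lra) Ht) as A1. pose proof (BQ x2 t ltac:(lra) Ht) as A2.
    apply Rabs_le_between in A1. apply Rabs_le_between in A2. apply Rabs_le. unfold w in *. lra. }
  apply Rabs_le_between in J1. apply Rabs_le_between in J2. apply Rabs_le. nra.
Qed.

(** z is the lower left corner of a 2w by 2h rectangle, and the result is the corner of one of its w
    by h quarters. The fourth quarter is the default when the other three fail the test. *)
Definition quarter (z : R * R) (w h : R) : R * R :=
  let J x y := Rabs (rect_circ P Q x (x + w) y (y + h)) in
  let J0 := (Rabs (rect_circ P Q (fst z) (fst z + 2 * w) (snd z) (snd z + 2 * h)) / 4)%R in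
  if Rle_dec J0 (J (fst z) (snd z)) then z
  else if Rle_dec J0 (J (fst z + w)%R (snd z)) then ((fst z + w)%R, snd z)
  else if Rle_dec J0 (J (fst z) (snd z + h)%R) then (fst z, (snd z + h)%R)
  else ((fst z + w)%R, (snd z + h)%R).

(** By the triangle inequality the four circulations cannot all be below a quarter of the whole in
    absolute value, so the default choice is sound. *)
Lemma quarter_spec (z : R * R) (w h : R) : 0 <= w -> 0 <= h ->
  a <= fst z -> fst z + 2 * w <= b -> c <= snd z -> snd z + 2 * h <= d ->
  Rabs (rect_circ P Q (fst z) (fst z + 2 * w) (snd z) (snd z + 2 * h)) / 4
   <= Rabs (rect_circ P Q (fst (quarter z w h)) (fst (quarter z w h) + w)
             (snd (quarter z w h)) (snd (quarter z w h) + h))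
  /\ fst z <= fst (quarter z w h) <= fst z + w
  /\ snd z <= snd (quarter z w h) <= snd z + h.
Proof.
  intros Hw Hh H1 H2 H3 H4. unfold quarter.
  destruct Rle_dec as [L|N1]. { repeat split; auto; lra. }
  destruct Rle_dec as [L|N2]. { simpl. repeat split; auto; lra. }
  destruct Rle_dec as [L|N3]. { simpl. repeat split; auto; lra. }
  simpl. repeat split; try lra.
  pose proof (rect_circ_split (fst z) (fst z + w) (fst z + 2 * w) (snd z) (snd z + h) (snd z + 2 * h)
    ltac:(lra) ltac:(lra) ltac:(lra) ltac:(lra)) as S.
  replace (fst z + w + w)%R with (fst z + 2 * w)%R by ring.
  replace (snd z + h + h)%R with (snd z + 2 * h)%R by ring.
  replace (fst z + w + w)%R with (fst z + 2 * w)%R in N2 by ring.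
  replace (snd z + h + h)%R with (snd z + 2 * h)%R in N3 by ring.
  rewrite S in *.
  match goal with |- Rabs (?A + ?B + ?C + ?D) / 4 <= _ =>
    pose proof (Rabs_triang (A + B + C) D); pose proof (Rabs_triang (A + B) C);
    pose proof (Rabs_triang A B) end.
  lra.
Qed.

Fixpoint nest (n : nat) : R * R :=
  match n with
  | O => (a, c)
  | S n' => quarter (nest n') ((b - a) / 2 ^ S n') ((d - c) / 2 ^ S n')
  end.

Lemma nest_spec (n : nat) :
  a <= fst (nest n) /\ fst (nest n) + (b - a) / 2 ^ n <= b /\
  c <= snd (nest n) /\ snd (nest n) + (d - c) / 2 ^ n <= d /\
  Rabs (rect_circ P Q a b c d) / 4 ^ n
  <= Rabs (rect_circ P Q (fst (nest n)) (fst (nest n) + (b - a) / 2 ^ n)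
             (snd (nest n)) (snd (nest n) + (d - c) / 2 ^ n)).
Proof.
  induction n as [|n (I1 & I2 & I3 & I4 & I5)].
  - simpl. replace (a + (b - a) / 1)%R with b by field. replace (c + (d - c) / 1)%R with d by field.
    repeat split; lra.
  - assert (P2 : 0 < 2 ^ n) by (apply pow_lt; lra).
    assert (P4 : 0 < 4 ^ n) by (apply pow_lt; lra).
    assert (Ew : ((b - a) / 2 ^ n = 2 * ((b - a) / 2 ^ S n))%R) by (simpl; field; lra).
    assert (Eh : ((d - c) / 2 ^ n = 2 * ((d - c) / 2 ^ S n))%R) by (simpl; field; lra).
    assert (Pw : 0 <= (b - a) / 2 ^ S n).
    { apply Rdiv_le_0_compat; [lra|]. apply pow_lt; lra. }
    assert (Ph : 0 <= (d - c) / 2 ^ S n).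
    { apply Rdiv_le_0_compat; [lra|]. apply pow_lt; lra. }
    change (nest (S n)) with (quarter (nest n) ((b - a) / 2 ^ S n) ((d - c) / 2 ^ S n)).
    rewrite Ew, Eh in *.
    destruct (quarter_spec (nest n) ((b - a) / 2 ^ S n) ((d - c) / 2 ^ S n)) as (S1 & S2 & S3); auto.
    repeat split; try lra.
    eapply Rle_trans; [|exact S1]. simpl.
    replace (Rabs (rect_circ P Q a b c d) / (4 * 4 ^ n))%R
      with (Rabs (rect_circ P Q a b c d) / 4 ^ n / 4)%R by (field; lra).
    simpl in I5. lra.
Qed.

Lemma nest_step (n : nat) :
  fst (nest n) <= fst (nest (S n)) /\
  fst (nest (S n)) + (b - a) / 2 ^ S n <= fst (nest n) + (b - a) / 2 ^ n /\
  snd (nest n) <= snd (nest (S n)) /\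
  snd (nest (S n)) + (d - c) / 2 ^ S n <= snd (nest n) + (d - c) / 2 ^ n.
Proof.
  destruct (nest_spec n) as (I1 & I2 & I3 & I4 & I5).
  assert (P2 : 0 < 2 ^ n) by (apply pow_lt; lra).
  assert (Ew : ((b - a) / 2 ^ n = 2 * ((b - a) / 2 ^ S n))%R) by (simpl; field; lra).
  assert (Eh : ((d - c) / 2 ^ n = 2 * ((d - c) / 2 ^ S n))%R) by (simpl; field; lra).
  assert (Pw : 0 <= (b - a) / 2 ^ S n).
  { apply Rdiv_le_0_compat; [lra|]. apply pow_lt; lra. }
  assert (Ph : 0 <= (d - c) / 2 ^ S n).
  { apply Rdiv_le_0_compat; [lra|]. apply pow_lt; lra. }
  change (nest (S n)) with (quarter (nest n) ((b - a) / 2 ^ S n) ((d - c) / 2 ^ S n)).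
  rewrite Ew, Eh in *.
  destruct (quarter_spec (nest n) ((b - a) / 2 ^ S n) ((d - c) / 2 ^ S n)) as (S1 & S2 & S3); auto.
  lra.
Qed.

Lemma nested_point (u w : nat -> R) : (forall n, 0 <= w n) ->
  (forall n, u n <= u (S n)) -> (forall n, u (S n) + w (S n) <= u n + w n) ->
  exists l, forall n, u n <= l <= u n + w n.
Proof.
  intros Hw Hu Hv.
  assert (Mu : forall n k, u n <= u (n + k)%nat).
  { intros n k. induction k. rewrite Nat.add_0_r; lra. rewrite Nat.add_succ_r.
    eapply Rle_trans. exact IHk. apply Hu. }
  assert (Mv : forall n k, u (n + k)%nat + w (n + k)%nat <= u n + w n).
  { intros n k. induction k. rewrite Nat.add_0_r; lra. rewrite Nat.add_succ_r.
    eapply Rle_trans. apply Hv. exact IHk. }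
  assert (B : forall n k, u k <= u n + w n).
  { intros n k. destruct (Nat.le_ge_cases n k) as [L|L].
    - replace k with (n + (k - n))%nat by lia. pose proof (Mv n (k - n)%nat).
      pose proof (Hw (n + (k - n))%nat). lra.
    - pose proof (Mu k (n - k)%nat). replace (k + (n - k))%nat with n in H by lia.
      pose proof (Hw n). lra. }
  destruct (ex_finite_lim_seq_incr u (u 0%nat + w 0%nat)) as [l Hl]; auto.
  exists l. intros n. split.
  - apply (is_lim_seq_incr_compare u l); auto.
  - apply (is_lim_seq_le u (fun _ => u n + w n)%R l (u n + w n)%R); auto.
    apply is_lim_seq_const.
Qed.

Lemma goursat : rect_circ P Q a b c d = 0%R.
Proof.
  assert (P2 : forall n, 0 < 2 ^ n) by (intros; apply pow_lt; lra).
  destruct (nested_point (fun n => fst (nest n)) (fun n => (b - a) / 2 ^ n)%R) as [x Hx].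
  { intros n. apply Rdiv_le_0_compat; auto; lra. }
  { intros n. apply nest_step. } { intros n. apply nest_step. }
  destruct (nested_point (fun n => snd (nest n)) (fun n => (d - c) / 2 ^ n)%R) as [y Hy].
  { intros n. apply Rdiv_le_0_compat; auto; lra. }
  { intros n. apply nest_step. } { intros n. apply nest_step. }
  assert (Bx : a <= x <= b) by (pose proof (Hx 0%nat); simpl in *; lra).
  assert (By : c <= y <= d) by (pose proof (Hy 0%nat); simpl in *; lra).
  set (J := Rabs (rect_circ P Q a b c d)).
  (* The n-th rectangle has circulation at least J / 4^n, while near (x, y) it is at most e times
     the square of its half perimeter, which also scales by 4^(-n); the factors cancel. *)
  assert (K : forall e, 0 < e -> J <= e * ((b - a) + (d - c)) ^ 2).
  { intros e Pe. destruct (rect_circ_small x y Bx By e Pe) as [r [Pr Hr]].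
    destruct (pow_lt_1_zero (/ 2) ltac:(rewrite Rabs_pos_eq; lra)
       (r / ((b - a) + (d - c) + 1)) ltac:(apply Rdiv_lt_0_compat; lra)) as [n Hn].
    specialize (Hn n ltac:(lia)). rewrite Rabs_pos_eq in Hn by (apply pow_le; lra).
    rewrite pow_inv in Hn. pose proof (Rinv_0_lt_compat _ (P2 n)) as I2.
    assert (Hn' : / 2 ^ n * ((b - a) + (d - c) + 1) < r).
    { apply Rmult_lt_reg_r with (/ ((b - a) + (d - c) + 1))%R. apply Rinv_0_lt_compat; lra.
      replace (/ 2 ^ n * ((b - a) + (d - c) + 1) * / ((b - a) + (d - c) + 1))%R with (/ 2 ^ n)%R.
      exact Hn. field. split; [lra|]. specialize (P2 n). lra. }
    destruct (nest_spec n) as (I1 & I3 & I4 & I5 & I6).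
    specialize (Hx n). specialize (Hy n). simpl in Hx, Hy.
    unfold Rdiv in *.
    specialize (Hr (fst (nest n)) (fst (nest n) + (b - a) * / 2 ^ n)%R
      (snd (nest n)) (snd (nest n) + (d - c) * / 2 ^ n)%R ltac:(lra) ltac:(lra) ltac:(lra) ltac:(lra)
      ltac:(nra) ltac:(nra)).
    fold J in I6.
    assert (L : J * / 4 ^ n <= e * (b - a + (d - c)) ^ 2 * / 4 ^ n).
    { eapply Rle_trans. exact I6. eapply Rle_trans. exact Hr. right.
      replace (4 ^ n)%R with (2 ^ n * 2 ^ n)%R by (rewrite <- Rpow_mult_distr; f_equal; lra).
      rewrite Rinv_mult. ring. }
    apply Rmult_le_reg_r with (/ 4 ^ n)%R; auto. apply Rinv_0_lt_compat, pow_lt; lra. }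
  assert (J0 : 0 <= J) by apply Rabs_pos.
  destruct (Req_dec J 0) as [Z|Nz]. { unfold J in Z. now apply Rabs_eq_0. }
  exfalso. set (T := ((b - a + (d - c)) ^ 2)%R) in *.
  assert (PT : 0 <= T) by apply pow2_ge_0.
  specialize (K (J / (2 * (T + 1)))%R ltac:(apply Rdiv_lt_0_compat; lra)).
  assert (J * T / (2 * (T + 1)) < J).
  { apply Rmult_lt_reg_r with (2 * (T + 1))%R. lra.
    replace (J * T / (2 * (T + 1)) * (2 * (T + 1)))%R with (J * T)%R by (field; lra). nra. }
  replace (J / (2 * (T + 1)) * T)%R with (J * T / (2 * (T + 1)))%R in K by (field; lra). lra.
Qed.

End Goursat.


(** * Cauchy-Riemann equations and mean values over circles *)

(** The partials are read off from M h with h = dx + i dy. Together with [Cder_diff2_im], the shared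
    partial Re M makes Im F dx + Re F dy a closed form. *)
Lemma Cder_diff2_re (F : C -> C) (x y : R) (M : C) : Cder F (x, y) M ->
  diff2_at (fun s t => Re (F (s, t))) x y (Re M) (- Im M).
Proof.
  intros H e Pe. destruct (H e Pe) as [d [Pd Hd]]. exists (d / 2)%R. split. lra.
  intros x' y' Hx Hy. set (h := (x' - x, y' - y)%R : C).
  assert (Ch : Cmod h <= Rabs (x' - x) + Rabs (y' - y)) by apply (Cmod_le_ReIm h).
  specialize (Hd h ltac:(lra)).
  replace ((x, y) + h) with ((x', y') : C) in Hd by (apply C_ext; simpl; ring).
  eapply Rle_trans; [|apply Rmult_le_compat_l; [lra|exact Ch]].
  eapply Rle_trans; [|exact Hd]. eapply Rle_trans; [|apply re_le_Cmod]. right. f_equal.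
  unfold h. destruct (F (x', y')), (F (x, y)), M; simpl. ring.
Qed.

Lemma Cder_diff2_im (F : C -> C) (x y : R) (M : C) : Cder F (x, y) M ->
  diff2_at (fun s t => Im (F (s, t))) x y (Im M) (Re M).
Proof.
  intros H e Pe. destruct (H e Pe) as [d [Pd Hd]]. exists (d / 2)%R. split. lra.
  intros x' y' Hx Hy. set (h := (x' - x, y' - y)%R : C).
  assert (Ch : Cmod h <= Rabs (x' - x) + Rabs (y' - y)) by apply (Cmod_le_ReIm h).
  specialize (Hd h ltac:(lra)).
  replace ((x, y) + h) with ((x', y') : C) in Hd by (apply C_ext; simpl; ring).
  eapply Rle_trans; [|apply Rmult_le_compat_l; [lra|exact Ch]].
  eapply Rle_trans; [|exact Hd]. eapply Rle_trans; [|apply im_le_Cmod]. right. f_equal.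
  unfold h. destruct (F (x', y')), (F (x, y)), M; simpl. ring.
Qed.

Lemma Cexp_2PI (s : R) : Cexp (s, 2 * PI)%R = Cexp (s, 0%R).
Proof. unfold Cexp. simpl. now rewrite cos_2PI, sin_2PI, cos_0, sin_0. Qed.

Section MeanValue.

Variable K : C -> C.
Hypothesis HK : forall z, Cmod z <= 1 -> exists L, Cder K z L.

Lemma Cder_K_exp (s t : R) : s <= 0 -> exists M, Cder (fun z => K (Cexp z)) (s, t) M.
Proof.
  intros Hs. destruct (HK (Cexp (s, t))) as [L HL].
  - rewrite Cmod_Cexp. simpl. rewrite <- exp_0. destruct Hs as [Hs| ->]; [|lra].
    left. now apply exp_increasing.
  - eexists. apply (Cder_comp K Cexp). apply Cder_exp. exact HL.
Qed.

Lemma ex_RInt_circle (s : R) : s <= 0 ->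
  ex_RInt (fun t => Re (K (Cexp (s, t)))) 0 (2 * PI).
Proof.
  intros Hs. apply (ex_RInt_continuous (fun t => Re (K (Cexp (s, t))))). intros t _.
  destruct (Cder_K_exp s t Hs) as [M HM].
  apply (diff2_at_continuous_r _ _ _ _ _ (Cder_diff2_re _ _ _ _ HM)).
Qed.

(* Goursat for [K o exp] on [[s,0] x [0,2pi]]: the horizontal sides cancel by periodicity. *)
Lemma circle_RInt_invariant (s : R) : s <= 0 ->
  RInt (fun t => Re (K (Cexp (s, t)))) 0 (2 * PI) = RInt (fun t => Re (K (Cexp (0%R, t)))) 0 (2 * PI).
Proof.
  intros Hs. pose proof PI_RGT_0.
  pose proof (goursat (fun x y => Im (K (Cexp (x, y)))) (fun x y => Re (K (Cexp (x, y)))) s 0 0 (2 * PI)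
    Hs ltac:(lra)) as G.
  unfold rect_circ in G.
  rewrite (RInt_ext (fun x => Im (K (Cexp (x, 2 * PI)%R))) (fun x => Im (K (Cexp (x, 0%R))))) in G.
  - assert (H0 : forall A B C : R, (A - A + (B - C) = 0)%R -> C = B) by (intros; lra).
    symmetry. eapply eq_sym, H0, G. intros x y Hx _.
    destruct (Cder_K_exp x y ltac:(lra)) as [M HM].
    exists (Im M), (Re M), (- Im M)%R. split.
    apply (Cder_diff2_im (fun z => K (Cexp z))), HM.
    apply (Cder_diff2_re (fun z => K (Cexp z))), HM.
  - intros. now rewrite Cexp_2PI.
Qed.

(** The mean over the circle of radius exp s does not depend on s, and continuity at 0 brings it
    arbitrarily close to Re (K 0) once exp s is small. *)
Lemma mean_value_circle :
  RInt (fun t => Re (K (Cexp (0%R, t)))) 0 (2 * PI) = (2 * PI * Re (K 0))%R.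
Proof.
  pose proof PI_RGT_0 as PP.
  destruct (HK 0) as [L HL]. { rewrite Cmod_0. lra. }
  set (I := RInt (fun t => Re (K (Cexp (0%R, t)))) 0 (2 * PI)).
  destruct (Req_dec I (2 * PI * Re (K 0))) as [E|N]; auto. exfalso.
  set (e := Rabs (I - 2 * PI * Re (K 0))).
  assert (Pe : 0 < e) by (apply Rabs_pos_lt; lra).
  destruct (Cder_cont _ _ _ HL (e / (4 * PI))) as [d [Pd Hd]].
  { apply Rdiv_lt_0_compat; lra. }
  (* The minimum with 0 keeps the circle in the closed unit disc, where [K] is differentiable. *)
  set (s := Rmin 0 (ln (d / 2))).
  assert (S1 : s <= 0) by apply Rmin_l. assert (S2 : s <= ln (d / 2)) by apply Rmin_r.
  assert (Es : exp s < d).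
  { apply Rle_lt_trans with (exp (ln (d / 2))).
    destruct S2 as [S2| ->]; [left; now apply exp_increasing|lra]. rewrite exp_ln; lra. }
  assert (B := RInt_near_const (fun t => Re (K (Cexp (s, t)))) 0 (2 * PI) (Re (K 0)) (e / (4 * PI))
    ltac:(lra) (ex_RInt_circle s S1)).
  rewrite circle_RInt_invariant in B by exact S1. fold I in B.
  assert (B' : Rabs (I - 2 * PI * Re (K 0)) <= 2 * PI * (e / (4 * PI))).
  { rewrite Rminus_0_r in B. apply B. intros t _.
    specialize (Hd (Cexp (s, t))). rewrite Cmod_Cexp in Hd. simpl in Hd. specialize (Hd Es).
    rewrite Cplus_0_l in Hd. eapply Rle_trans; [|left; exact Hd].
    apply (re_le_Cmod (K (Cexp (s, t)) - K 0)). }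
  fold e in B'. replace (2 * PI * (e / (4 * PI)))%R with (e / 2)%R in B' by (field; lra). lra.
Qed.

End MeanValue.

(** Mean values are available for real parts only. Applied to c K with c = 1, -1, i, -i they bound
    |Re (K 0)| and |Im (K 0)| separately, whence the factor 2; it is harmless later, where the bound
    is multiplied by a vanishing geometric term. *)
Lemma mean_value_bound (K : C -> C) (g : R -> R) :
  (forall z, Cmod z <= 1 -> exists L, Cder K z L) ->
  ex_RInt g 0 (2 * PI) ->
  (forall t, Cmod (K (Cexp (0%R, t))) <= g t) ->
  2 * PI * Cmod (K 0) <= 2 * RInt g 0 (2 * PI).
Proof.
  intros HK Hg HB. pose proof PI_RGT_0 as PP.
  assert (A : forall K : C -> C, (forall z, Cmod z <= 1 -> exists L, Cder K z L) ->
    (forall t, Cmod (K (Cexp (0%R, t))) <= g t) -> 2 * PI * Re (K 0) <= RInt g 0 (2 * PI)).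
  { intros K' HK' HB'. rewrite <- mean_value_circle by exact HK'.
    apply RInt_le; auto. lra. apply ex_RInt_circle; auto. lra.
    intros t _. eapply Rle_trans; [|apply HB']. eapply Rle_trans; [apply Rle_abs|apply re_le_Cmod]. }
  assert (A' : forall c : C, Cmod c = 1%R -> 2 * PI * Re (c * K 0) <= RInt g 0 (2 * PI)).
  { intros c Hc. apply (A (fun z => c * K z)).
    - intros z Hz. destruct (HK z Hz) as [L HL]. eexists. apply Cder_scal, HL.
    - intros t. rewrite Cmod_mult, Hc, Rmult_1_l. apply HB. }
  pose proof (A' 1 Cmod_1) as A1. pose proof (A' (-(1)) Cmod_m1) as A2.
  pose proof (A' Ci Cmod_Ci) as A3. pose proof (A' (- Ci) ltac:(rewrite Cmod_opp; apply Cmod_Ci)) as A4.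
  apply Rle_trans with (2 * PI * (Rabs (Re (K 0)) + Rabs (Im (K 0))))%R.
  apply Rmult_le_compat_l. lra. apply Cmod_le_ReIm.
  destruct (K 0) as [u v]. simpl in *.
  unfold Rabs. destruct (Rcase_abs u), (Rcase_abs v); nra.
Qed.

(** For |w| < 1 the automorphism of the unit disc that sends 0 to w; it lets the mean value at the
    centre serve in place of Cauchy's formula at w. *)
Definition moebius (w z : C) : C := (z + w) / (1 + Cconj w * z).

Section Moebius.

Variable w : C.
Hypothesis Hw : Cmod w < 1.

Lemma moebius_den (z : C) : Cmod z <= 1 -> 1 + Cconj w * z <> 0.
Proof.
  intros Hz. apply Cmod_gt_0.
  pose proof (Cmod_triangle (1 + Cconj w * z) (- (Cconj w * z))) as T.
  replace (1 + Cconj w * z + - (Cconj w * z)) with (RtoC 1) in T by ring.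
  rewrite Cmod_1, Cmod_opp, Cmod_mult, Cmod_conj in T.
  pose proof (Cmod_ge_0 w). pose proof (Cmod_ge_0 z). nra.
Qed.

(* |1 + conj(w) z|^2 - |z + w|^2 = (1 - |w|^2) (1 - |z|^2) *)
Lemma moebius_identity (z : C) :
  (Cmod (1 + Cconj w * z) ^ 2 - Cmod (z + w) ^ 2 = (1 - Cmod w ^ 2) * (1 - Cmod z ^ 2))%R.
Proof. rewrite !Cmod2_alt. destruct w, z; simpl. ring. Qed.

Lemma Cmod_moebius_le (z : C) : Cmod z <= 1 -> Cmod (moebius w z) <= 1.
Proof.
  intros Hz. pose proof (moebius_den z Hz) as D. unfold moebius. rewrite Cmod_div by exact D.
  apply Cmod_gt_0 in D. pose proof (moebius_identity z) as E.
  pose proof (Cmod_ge_0 w). pose proof (Cmod_ge_0 z). pose proof (Cmod_ge_0 (z + w)).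
  apply Rmult_le_reg_r with (Cmod (1 + Cconj w * z)); auto.
  unfold Rdiv. rewrite Rmult_assoc, Rinv_l, Rmult_1_r, Rmult_1_l by lra.
  assert (0 <= (1 - Cmod w ^ 2) * (1 - Cmod z ^ 2)) by (apply Rmult_le_pos; nra).
  apply Rnot_lt_le. intros L. nra.
Qed.

Lemma Cmod_moebius_circle (z : C) : Cmod z = 1%R -> Cmod (moebius w z) = 1%R.
Proof.
  intros Hz. pose proof (moebius_den z ltac:(lra)) as D. unfold moebius. rewrite Cmod_div by exact D.
  apply Cmod_gt_0 in D. pose proof (moebius_identity z) as E. rewrite Hz in E.
  pose proof (Cmod_ge_0 (z + w)).
  replace (Cmod (z + w)) with (Cmod (1 + Cconj w * z)). field; lra.
  nra.
Qed.

Lemma Cder_moebius (z : C) : Cmod z <= 1 -> exists L, Cder (moebius w) z L.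
Proof.
  intros Hz. eexists. apply (Cder_div (fun z => z + w) (fun z => 1 + Cconj w * z)).
  - now apply moebius_den.
  - apply (Cder_plus (fun z => z) (fun _ => w)). apply Cder_id. apply Cder_const.
  - apply (Cder_plus (fun _ => 1) (fun z => Cconj w * z)). apply Cder_const.
    apply Cder_scal, Cder_id.
Qed.

Lemma moebius_0 : moebius w 0 = w.
Proof. unfold moebius. rewrite Cmult_0_r. field. Qed.

End Moebius.

(* Since [G] vanishes near 0, [G z / z^n] is again holomorphic in the disc; averaging it over
   the circle of radius [R0], moved by a Moebius map so that the centre goes to [w], gives
   |G w| <= (|w| / R0)^n * const for every n. *)
Lemma identity_theorem (G : C -> C) (r : R) : 0 < r ->
  (forall z, Cmod z < 1 -> exists L, Cder G z L) ->
  (forall z, Cmod z < r -> G z = 0) ->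
  forall w, Cmod w < 1 -> G w = 0.
Proof.
  intros Pr HG H0 w Hw.
  destruct (Req_dec (Cmod w) 0) as [Z|Nw]. { apply H0. lra. }
  pose proof (Cmod_ge_0 w) as Pw.
  set (R0 := ((Cmod w + 1) / 2)%R).
  assert (PR : 0 < R0) by (unfold R0; lra). assert (R1 : R0 < 1) by (unfold R0; lra).
  assert (WR : Cmod w < R0) by (unfold R0; lra).
  assert (NR : RtoC R0 <> 0) by (intros E; apply RtoC_inj in E; lra).
  set (v := w / R0).
  assert (Hv : Cmod v < 1).
  { unfold v. rewrite Cmod_div, Cmod_R, Rabs_pos_eq by (auto; lra).
    apply Rmult_lt_reg_r with R0; auto. unfold Rdiv. rewrite Rmult_assoc, Rinv_l; lra. }
  (* At 0 the quotient is locally the constant 0, because G vanishes nearby and total division gives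
     0 at the centre too. *)
  assert (Hn : forall n z, Cmod z < 1 -> exists L, Cder (fun z => G z / z ^ n) z L).
  { intros n z Hz. destruct (Req_dec (Cmod z) 0) as [Z0|Nz].
    - apply Cmod_eq_0 in Z0. subst z. exists 0. apply Cder_ext_loc with (fun _ => 0) r; auto.
      intros h Hh. rewrite Cplus_0_l, (H0 h Hh). unfold Cdiv. ring. apply Cder_const.
    - destruct (HG z Hz) as [L HL]. destruct (Cder_pow (fun z => z) z 1 n (Cder_id z)) as [M HM].
      eexists. apply (Cder_div G (fun z => z ^ n)); eauto.
      apply Cpow_nz. intros ->. rewrite Cmod_0 in Nz. lra. }
  (* [phi] takes 0 to w and the unit circle to the circle of radius R0, so |phi z|^n is the constant
     R0^n under the integral. *)
  set (phi := fun z => R0 * moebius v z).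
  assert (Hphi : forall z, Cmod z <= 1 -> Cmod (phi z) < 1).
  { intros z Hz. unfold phi. rewrite Cmod_mult, Cmod_R, Rabs_pos_eq by lra.
    pose proof (Cmod_moebius_le v Hv z Hz). nra. }
  assert (Dphi : forall z, Cmod z <= 1 -> exists L, Cder phi z L).
  { intros z Hz. destruct (Cder_moebius v Hv z Hz) as [L HL]. eexists. apply Cder_scal, HL. }
  assert (Hcomp : forall F : C -> C, (forall z, Cmod z < 1 -> exists L, Cder F z L) ->
    forall z, Cmod z <= 1 -> exists L, Cder (fun z => F (phi z)) z L).
  { intros F HF z Hz. destruct (HF _ (Hphi z Hz)) as [L HL]. destruct (Dphi z Hz) as [M HM].
    eexists. apply (Cder_comp F phi); eauto. }
  assert (Ccirc : forall t, Cmod (Cexp (0%R, t)) = 1%R).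
  { intros t. rewrite Cmod_Cexp. apply exp_0. }
  set (g := fun t => Cmod (G (phi (Cexp (0%R, t))))).
  assert (Cg : forall t, continuous g t).
  { intros t. apply continuity_pt_filterlim.
    destruct (Hcomp G HG (Cexp (0%R, t)) ltac:(rewrite Ccirc; lra)) as [L HL].
    pose proof (Cder_comp (fun z => G (phi z)) Cexp _ _ _ (Cder_exp (0%R, t)) HL) as D.
    intros e Pe. destruct (Cder_cont _ _ _ D e Pe) as [d [Pd Hd]]. exists d. split. exact Pd.
    change (forall t' : R, D_x no_cond t t' /\ Rabs (t' - t) < d -> Rabs (g t' - g t) < e).
    intros t' [_ Ht].
    specialize (Hd (0%R, (t' - t)%R)).
    replace ((0%R, t) + (0%R, (t' - t)%R)) with ((0%R, t') : C) in Hd by (apply C_ext; simpl; ring).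
    eapply Rle_lt_trans; [|apply Hd].
    - unfold g. set (A := G (phi (Cexp (0%R, t')))). set (B := G (phi (Cexp (0%R, t)))).
      change (Rabs (Cmod A - Cmod B) <= Cmod (A - B)).
      apply Rabs_le. pose proof (Cmod_triangle (A - B) B) as T1.
      pose proof (Cmod_triangle (- (A - B)) A) as T2. rewrite Cmod_opp in T2.
      replace (A - B + B) with A in T1 by ring. replace (- (A - B) + A) with B in T2 by ring. lra.
    - eapply Rle_lt_trans. apply Cmod_le_ReIm. simpl. rewrite Rabs_R0. lra. }
  assert (Ig : ex_RInt g 0 (2 * PI)) by (apply (ex_RInt_continuous g); auto).
  set (I := RInt g 0 (2 * PI)).
  pose proof PI_RGT_0 as PP.
  assert (B : forall n, Cmod (G w) <= / PI * I * (Cmod w / R0) ^ n).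
  { intros n. assert (PRn : 0 < R0 ^ n) by now apply pow_lt.
    pose proof (mean_value_bound (fun z => G (phi z) / (phi z) ^ n) (fun t => / R0 ^ n * g t)%R
      (Hcomp _ (Hn n)) (ex_RInt_scal g 0 (2 * PI) (/ R0 ^ n)%R Ig)) as M.
    assert (Es : RInt (fun t => (/ R0 ^ n * g t)%R) 0 (2 * PI) = (/ R0 ^ n * I)%R)
      by exact (RInt_scal g 0 (2 * PI) (/ R0 ^ n)%R Ig).
    rewrite Es in M.
    assert (Ephi : phi 0 = w).
    { unfold phi. rewrite moebius_0. unfold v. field. exact NR. }
    assert (Nwc : w <> 0) by (intros E; rewrite E, Cmod_0 in Nw; lra).
    rewrite Ephi, Cmod_div, Cmod_pow in M by now apply Cpow_nz.
    assert (Pwn : 0 < Cmod w ^ n) by (apply pow_lt; lra).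
    assert (M' : 2 * PI * (Cmod (G w) / Cmod w ^ n) <= 2 * (/ R0 ^ n * I)).
    { apply M. intros t.
      assert (Cp : Cmod (phi (Cexp (0%R, t))) = R0).
      { unfold phi. rewrite Cmod_mult, Cmod_R, Cmod_moebius_circle, Rabs_pos_eq; auto; lra. }
      rewrite Cmod_div, Cmod_pow, Cp.
      - unfold g, Rdiv. lra.
      - apply Cpow_nz. intros E. rewrite E, Cmod_0 in Cp. lra. }
    unfold Rdiv. rewrite Rpow_mult_distr, pow_inv.
    apply Rmult_le_reg_l with (2 * PI / Cmod w ^ n)%R. apply Rdiv_lt_0_compat; lra.
    replace (2 * PI / Cmod w ^ n * Cmod (G w))%R with (2 * PI * (Cmod (G w) / Cmod w ^ n))%R by (field; lra).
    replace (2 * PI / Cmod w ^ n * (/ PI * I * (Cmod w ^ n * / R0 ^ n)))%R with (2 * (/ R0 ^ n * I))%R by (field; lra).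
    exact M'. }
  assert (Lm : is_lim_seq (fun n => / PI * I * (Cmod w / R0) ^ n)%R (/ PI * I * 0)%R).
  { apply (is_lim_seq_scal_l (fun n => (Cmod w / R0) ^ n)%R (/ PI * I)%R 0).
    apply is_lim_seq_geom. rewrite Rabs_pos_eq by (apply Rdiv_le_0_compat; lra).
    apply Rmult_lt_reg_r with R0; auto. unfold Rdiv. rewrite Rmult_assoc, Rinv_l; lra. }
  pose proof (is_lim_seq_le (fun _ => Cmod (G w)) _ (Cmod (G w)) _ B (is_lim_seq_const _) Lm) as F.
  simpl in F. apply Cmod_eq_0. pose proof (Cmod_ge_0 (G w)). lra.
Qed.


(** * Complex power series *)

(** The shape of [hyp_series], which is therefore a [CSeries] by conversion. *)
Definition CSeries (s : nat -> C) : C :=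
  (Series (fun n => Re (s n)), Series (fun n => Im (s n))).

Definition Csummable (s : nat -> C) : Prop := ex_series (fun n => Cmod (s n)).

Lemma CSeries_ext (s t : nat -> C) : (forall n, s n = t n) -> CSeries s = CSeries t.
Proof. intros H. unfold CSeries. f_equal; apply Series_ext; intros n; now rewrite H. Qed.

Lemma Csummable_ext (s t : nat -> C) : (forall n, s n = t n) -> Csummable s -> Csummable t.
Proof. intros H. apply ex_series_ext. intros n. now rewrite H. Qed.

Lemma Csummable_Re (s : nat -> C) : Csummable s -> ex_series (fun n => Re (s n)).
Proof.
  apply (ex_series_le (fun n => Re (s n)) (fun n => Cmod (s n))).
  intros n. apply re_le_Cmod.
Qed.

Lemma Csummable_Im (s : nat -> C) : Csummable s -> ex_series (fun n => Im (s n)).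
Proof.
  apply (ex_series_le (fun n => Im (s n)) (fun n => Cmod (s n))).
  intros n. apply im_le_Cmod.
Qed.

Lemma Csummable_plus (s t : nat -> C) :
  Csummable s -> Csummable t -> Csummable (fun n => s n + t n).
Proof.
  intros Hs Ht. apply (ex_series_le (fun n => Cmod (s n + t n)) (fun n => Cmod (s n) + Cmod (t n))%R).
  - intros n. change (Rabs (Cmod (s n + t n)) <= Cmod (s n) + Cmod (t n)).
    rewrite Rabs_pos_eq by apply Cmod_ge_0. apply Cmod_triangle.
  - now apply (ex_series_plus (fun n => Cmod (s n)) (fun n => Cmod (t n))).
Qed.

Lemma Csummable_scal (c : C) (s : nat -> C) : Csummable s -> Csummable (fun n => c * s n).
Proof.
  intros Hs. apply (ex_series_ext (fun n => Cmod c * Cmod (s n))%R).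
  - intros n. now rewrite Cmod_mult.
  - now apply (ex_series_scal (Cmod c) (fun n => Cmod (s n))).
Qed.

Lemma CSeries_plus (s t : nat -> C) : Csummable s -> Csummable t ->
  CSeries (fun n => s n + t n) = CSeries s + CSeries t.
Proof.
  intros Hs Ht. unfold CSeries. apply C_ext; simpl.
  - apply (Series_plus (fun n => Re (s n)) (fun n => Re (t n))); now apply Csummable_Re.
  - apply (Series_plus (fun n => Im (s n)) (fun n => Im (t n))); now apply Csummable_Im.
Qed.

Lemma CSeries_scal (c : C) (s : nat -> C) : Csummable s ->
  CSeries (fun n => c * s n) = c * CSeries s.
Proof.
  intros Hs. pose proof (Csummable_Re _ Hs) as HR. pose proof (Csummable_Im _ Hs) as HI.
  unfold CSeries. apply C_ext; simpl.
  - change (Series (fun n => fst c * Re (s n) - snd c * Im (s n))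
      = fst c * Series (fun n => Re (s n)) - snd c * Series (fun n => Im (s n)))%R.
    rewrite (Series_minus (fun n => fst c * Re (s n))%R (fun n => snd c * Im (s n))%R).
    + now rewrite !Series_scal_l.
    + now apply (ex_series_scal (fst c) (fun n => Re (s n))).
    + now apply (ex_series_scal (snd c) (fun n => Im (s n))).
  - change (Series (fun n => fst c * Im (s n) + snd c * Re (s n))
      = fst c * Series (fun n => Im (s n)) + snd c * Series (fun n => Re (s n)))%R.
    rewrite (Series_plus (fun n => fst c * Im (s n))%R (fun n => snd c * Re (s n))%R).
    + now rewrite !Series_scal_l.
    + now apply (ex_series_scal (fst c) (fun n => Im (s n))).
    + now apply (ex_series_scal (snd c) (fun n => Re (s n))).
Qed.

Lemma is_series_zero : is_series (fun _ => 0%R) 0%R.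
Proof.
  apply filterlim_ext with (fun _ => 0%R). intros n. now rewrite sum_n_const, Rmult_0_r.
  apply filterlim_const.
Qed.

Lemma Series_zero : Series (fun _ => 0%R) = 0%R.
Proof. apply is_series_unique, is_series_zero. Qed.

Lemma CSeries_zero : CSeries (fun _ => 0) = 0.
Proof. unfold CSeries. simpl. now rewrite Series_zero. Qed.

Lemma Series_le_abs (u v : nat -> R) : (forall n, Rabs (u n) <= v n) -> ex_series v ->
  Rabs (Series u) <= Series v.
Proof.
  intros H Hv. eapply Rle_trans. apply Series_Rabs.
  - apply (ex_series_le (fun n => Rabs (u n)) v); auto.
    intros n. change (Rabs (Rabs (u n)) <= v n). now rewrite Rabs_Rabsolu.
  - apply Series_le; auto. intros n. split; auto. apply Rabs_pos.
Qed.

Lemma Cmod_CSeries_le (s : nat -> C) (v : nat -> R) :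
  (forall n, Cmod (s n) <= v n) -> ex_series v -> Cmod (CSeries s) <= 2 * Series v.
Proof.
  intros H Hv. eapply Rle_trans. apply Cmod_le_ReIm. simpl.
  pose proof (Series_le_abs (fun n => Re (s n)) v
    ltac:(intros; eapply Rle_trans; [apply re_le_Cmod | apply H]) Hv).
  pose proof (Series_le_abs (fun n => Im (s n)) v
    ltac:(intros; eapply Rle_trans; [apply im_le_Cmod | apply H]) Hv).
  lra.
Qed.

Lemma CSeries_incr_1 (s : nat -> C) : Csummable s ->
  CSeries s = s 0%nat + CSeries (fun n => s (S n)).
Proof.
  intros Hs. unfold CSeries. apply C_ext; simpl.
  - rewrite (Series_incr_1 (fun n => Re (s n))); auto. now apply Csummable_Re.
  - rewrite (Series_incr_1 (fun n => Im (s n))); auto. now apply Csummable_Im.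
Qed.

Lemma CSeries_incr_n_aux (s : nat -> C) (l : nat) : (forall k, (k < l)%nat -> s k = 0) ->
  CSeries s = CSeries (fun n => s (l + n)%nat).
Proof.
  intros Hs. unfold CSeries. f_equal.
  - apply (Series_incr_n_aux (fun n => Re (s n))). intros k Hk. now rewrite Hs.
  - apply (Series_incr_n_aux (fun n => Im (s n))). intros k Hk. now rewrite Hs.
Qed.

(** Bounded terms rather than convergence at each rho < 1: this form passes easily to sums, shifts
    and factors n, and absolute convergence in the disc follows by Abel's comparison with a
    geometric series. *)
Definition radius_ge_1 (c : nat -> C) : Prop :=
  forall rho, 0 < rho < 1 -> exists M, forall n, Cmod (c n) * rho ^ n <= M.

Definition CPS (c : nat -> C) (z : C) : C := CSeries (fun n => c n * z ^ n).

Lemma CPS_ext (c d : nat -> C) (z : C) : (forall n, c n = d n) -> CPS c z = CPS d z.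
Proof. intros H. apply CSeries_ext. intros n. now rewrite H. Qed.

Lemma radius_ge_1_ext (c d : nat -> C) : (forall n, c n = d n) -> radius_ge_1 c -> radius_ge_1 d.
Proof. intros H Hc r Hr. destruct (Hc r Hr) as [M HM]. exists M. intros n. now rewrite <- H. Qed.

Lemma radius_ge_1_summable_R (c : nat -> C) (q : R) : radius_ge_1 c -> 0 <= q < 1 ->
  ex_series (fun n => Cmod (c n) * q ^ n)%R.
Proof.
  intros Hc Hq. set (r := ((q + 1) / 2)%R).
  assert (Hr : 0 < r < 1) by (unfold r; lra). assert (Hqr : q < r) by (unfold r; lra).
  destruct (Hc r Hr) as [M HM].
  apply (ex_series_le (fun n => Cmod (c n) * q ^ n)%R (fun n => M * (q / r) ^ n)%R).
  - intros n. change (Rabs (Cmod (c n) * q ^ n) <= M * (q / r) ^ n).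
    assert (0 <= q ^ n) by (apply pow_le; lra).
    assert (Pr : 0 < r ^ n) by (apply pow_lt; lra).
    rewrite Rabs_pos_eq by (apply Rmult_le_pos; auto using Cmod_ge_0).
    unfold Rdiv. rewrite Rpow_mult_distr, pow_inv.
    replace (Cmod (c n) * q ^ n)%R with (Cmod (c n) * r ^ n * (q ^ n * / r ^ n))%R by (field; lra).
    apply Rmult_le_compat_r; auto. apply Rmult_le_pos; auto. left. now apply Rinv_0_lt_compat.
  - apply (ex_series_scal M (fun n => (q / r) ^ n)%R). apply ex_series_geom.
    rewrite Rabs_pos_eq by (apply Rdiv_le_0_compat; lra).
    apply Rmult_lt_reg_r with r. lra. unfold Rdiv. rewrite Rmult_assoc, Rinv_l; lra.
Qed.

Lemma radius_ge_1_summable (c : nat -> C) (z : C) : radius_ge_1 c -> Cmod z < 1 ->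
  Csummable (fun n => c n * z ^ n).
Proof.
  intros Hc Hz. apply (ex_series_ext (fun n => Cmod (c n) * Cmod z ^ n)%R).
  - intros n. now rewrite Cmod_mult, Cmod_pow.
  - apply radius_ge_1_summable_R; auto. split; auto. apply Cmod_ge_0.
Qed.

Lemma radius_ge_1_scal (k : C) (c : nat -> C) : radius_ge_1 c -> radius_ge_1 (fun n => k * c n).
Proof.
  intros Hc r Hr. destruct (Hc r Hr) as [M HM]. exists (Cmod k * M)%R. intros n.
  rewrite Cmod_mult, Rmult_assoc. apply Rmult_le_compat_l; auto. apply Cmod_ge_0.
Qed.

Lemma radius_ge_1_bounded_mult (d c : nat -> C) (B : R) : (forall n, Cmod (d n) <= B) ->
  radius_ge_1 c -> radius_ge_1 (fun n => c n * d n).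
Proof.
  intros Hd Hc r Hr. destruct (Hc r Hr) as [M HM]. exists (M * B)%R. intros n.
  rewrite Cmod_mult.
  replace (Cmod (c n) * Cmod (d n) * r ^ n)%R with (Cmod (c n) * r ^ n * Cmod (d n))%R by ring.
  apply Rmult_le_compat; auto using Cmod_ge_0.
  apply Rmult_le_pos. apply Cmod_ge_0. apply pow_le; lra.
Qed.

Lemma radius_ge_1_plus (c d : nat -> C) : radius_ge_1 c -> radius_ge_1 d -> radius_ge_1 (fun n => c n + d n).
Proof.
  intros Hc Hd r Hr. destruct (Hc r Hr) as [M HM]. destruct (Hd r Hr) as [M' HM'].
  exists (M + M')%R. intros n. specialize (HM n). specialize (HM' n).
  assert (0 <= r ^ n) by (apply pow_le; lra).
  apply Rle_trans with ((Cmod (c n) + Cmod (d n)) * r ^ n)%R; [|lra].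
  apply Rmult_le_compat_r; auto. apply Cmod_triangle.
Qed.

Lemma radius_ge_1_succ (c : nat -> C) : radius_ge_1 c -> radius_ge_1 (fun n => c (S n)).
Proof.
  intros Hc r Hr. destruct (Hc r Hr) as [M HM]. exists (M / r)%R. intros n.
  specialize (HM (S n)). simpl in HM. apply Rmult_le_reg_r with r. lra.
  unfold Rdiv. rewrite (Rmult_assoc M), Rinv_l by lra. lra.
Qed.

(** Passing from r to a larger r' < 1 gains the factor (r'/r)^n, which dominates n h with h = r'/r -
    1 by Bernoulli's inequality. *)
Lemma radius_ge_1_mult_INR (c : nat -> C) : radius_ge_1 c -> radius_ge_1 (fun n => INR n * c n).
Proof.
  intros Hc r Hr. set (r' := ((r + 1) / 2)%R).
  assert (Hr' : 0 < r' < 1) by (unfold r'; lra). assert (Hl : r < r') by (unfold r'; lra).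
  destruct (Hc r' Hr') as [M HM].
  set (h := (r' / r - 1)%R).
  assert (Ph : 0 < h).
  { unfold h. apply Rmult_lt_reg_r with r. lra.
    replace ((r' / r - 1) * r)%R with (r' - r)%R by (field; lra). lra. }
  exists (M / h)%R. intros n. rewrite Cmod_mult, Cmod_R, Rabs_pos_eq by apply pos_INR.
  pose proof (poly n h Ph) as Bern.
  assert (Prn : 0 < r ^ n) by (apply pow_lt; lra).
  assert (E : (r' ^ n = r ^ n * (1 + h) ^ n)%R).
  { rewrite <- Rpow_mult_distr. f_equal. unfold h. field. lra. }
  apply Rmult_le_reg_r with h; auto.
  unfold Rdiv. rewrite (Rmult_assoc M), Rinv_l, Rmult_1_r by lra.
  eapply Rle_trans; [|apply (HM n)]. rewrite E.
  replace (INR n * Cmod (c n) * r ^ n * h)%R with (Cmod (c n) * (r ^ n * (INR n * h)))%R by ring.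
  apply Rmult_le_compat_l. apply Cmod_ge_0. apply Rmult_le_compat_l; lra.
Qed.

Lemma bounded_of_eventually (u : nat -> R) (N : nat) (M : R) :
  (forall n, (N <= n)%nat -> u n <= M) -> exists M', forall n, u n <= M'.
Proof.
  revert M. induction N as [|N IH]; intros M H.
  - exists M. intros n. apply H. lia.
  - apply (IH (Rmax M (u N))). intros n Hn.
    destruct (Nat.eq_dec n N) as [->|Ne]. apply Rmax_r.
    eapply Rle_trans; [apply H; lia|apply Rmax_l].
Qed.

(** The ratio (u + n) / (v + n) tends to 1 in modulus and r < 1, so |c_n| r^n is nonincreasing from
    some N on. *)
Lemma radius_ge_1_rec (u v : C) (c : nat -> C) :
  (forall n, (v + INR n) * c (S n) = (u + INR n) * c n) -> radius_ge_1 c.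
Proof.
  intros H r Hr.
  destruct (INR_unbounded ((Cmod u + Cmod v) / (1 - r) + Cmod v + 1)) as [N HN].
  apply (bounded_of_eventually (fun n => Cmod (c n) * r ^ n)%R N (Cmod (c N) * r ^ N)).
  pose proof (Cmod_ge_0 u) as Pu. pose proof (Cmod_ge_0 v) as Pv.
  assert (Pq : 0 <= (Cmod u + Cmod v) / (1 - r)) by (apply Rdiv_le_0_compat; lra).
  assert (Eq : ((Cmod u + Cmod v) / (1 - r) * (1 - r) = Cmod u + Cmod v)%R) by (field; lra).
  intros n Hn. induction Hn as [|n Hn IH]. lra.
  eapply Rle_trans; [|exact IH]. apply le_INR in Hn.
  assert (Cn : Cmod (RtoC (INR n)) = INR n) by (rewrite Cmod_R; apply Rabs_pos_eq, pos_INR).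
  assert (A1 : Cmod (u + INR n) <= Cmod u + INR n).
  { eapply Rle_trans. apply Cmod_triangle. lra. }
  assert (A2 : INR n - Cmod v <= Cmod (v + INR n)).
  { pose proof (Cmod_triangle (v + INR n) (- v)) as T.
    replace (v + INR n + - v) with (RtoC (INR n)) in T by ring. rewrite Cmod_opp in T. lra. }
  specialize (H n). apply (f_equal Cmod) in H. rewrite !Cmod_mult in H.
  assert (K : Cmod (u + INR n) * r <= Cmod (v + INR n)) by nra.
  assert (Pd : 0 < Cmod (v + INR n)) by lra.
  apply Rmult_le_reg_l with (Cmod (v + INR n)); auto. simpl.
  replace (Cmod (v + INR n) * (Cmod (c (S n)) * (r * r ^ n)))%R
    with (Cmod (v + INR n) * Cmod (c (S n)) * r * r ^ n)%R by ring.
  rewrite H.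
  replace (Cmod (u + INR n) * Cmod (c n) * r * r ^ n)%R
    with (Cmod (u + INR n) * r * (Cmod (c n) * r ^ n))%R by ring.
  apply Rmult_le_compat_r; auto. apply Rmult_le_pos. apply Cmod_ge_0. apply pow_le; lra.
Qed.

Lemma CPS_plus (c d : nat -> C) (z : C) : radius_ge_1 c -> radius_ge_1 d -> Cmod z < 1 ->
  CPS (fun n => c n + d n) z = CPS c z + CPS d z.
Proof.
  intros Hc Hd Hz. unfold CPS. rewrite <- CSeries_plus; auto using radius_ge_1_summable.
  apply CSeries_ext. intros n. ring.
Qed.

Lemma CPS_scal (k : C) (c : nat -> C) (z : C) : radius_ge_1 c -> Cmod z < 1 ->
  CPS (fun n => k * c n) z = k * CPS c z.
Proof.
  intros Hc Hz. unfold CPS. rewrite <- CSeries_scal; auto using radius_ge_1_summable.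
  apply CSeries_ext. intros n. ring.
Qed.

Lemma radius_ge_1_csum (N : nat) (c : nat -> nat -> C) :
  (forall k, (k < N)%nat -> radius_ge_1 (c k)) -> radius_ge_1 (fun n => csum N (fun k => c k n)).
Proof.
  induction N as [|N IH]; intros H; simpl.
  - intros r _. exists 0%R. intros n. rewrite Cmod_0. lra.
  - apply (radius_ge_1_plus (fun n => csum N (fun k => c k n))). apply IH; auto. apply H; lia.
Qed.

Lemma CPS_csum (N : nat) (c : nat -> nat -> C) (z : C) :
  (forall k, (k < N)%nat -> radius_ge_1 (c k)) -> Cmod z < 1 ->
  CPS (fun n => csum N (fun k => c k n)) z = csum N (fun k => CPS (c k) z).
Proof.
  intros H Hz. induction N as [|N IH]; simpl.
  - unfold CPS. rewrite (CSeries_ext _ (fun _ => 0)). apply CSeries_zero. intros; ring.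
  - rewrite (CPS_plus (fun n => csum N (fun k => c k n))), IH; auto using radius_ge_1_csum.
Qed.

Lemma CPS_unfold (c : nat -> C) (z : C) : radius_ge_1 c -> Cmod z < 1 ->
  CPS c z = c 0%nat + z * CPS (fun n => c (S n)) z.
Proof.
  intros Hc Hz. unfold CPS at 1. rewrite CSeries_incr_1 by now apply radius_ge_1_summable.
  unfold CPS. rewrite <- CSeries_scal by (apply (radius_ge_1_summable (fun n => c (S n))); auto using radius_ge_1_succ).
  f_equal. simpl; ring. apply CSeries_ext. intros n. simpl. ring.
Qed.

(** The factor r^2 on the left stands for an exponent n - 2 on the right, which would be negative
    for n < 2; n^2 is a crude form of n (n - 1) / 2. *)
Lemma pow_taylor_bound (z h : C) (r : R) (n : nat) : Cmod z <= r -> Cmod (z + h) <= r ->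
  r ^ 2 * Cmod ((z + h) ^ n - z ^ n - INR n * z ^ pred n * h) <= INR n * INR n * Cmod h ^ 2 * r ^ n.
Proof.
  intros Hz Hzh. pose proof (Cmod_ge_0 z) as Pz. pose proof (Cmod_ge_0 h) as Ph.
  induction n as [|n IH].
  - simpl. replace (1 - 1 - 0 * 1 * h) with (RtoC 0) by ring. rewrite Cmod_0. lra.
  - destruct n as [|n].
    + simpl. replace ((z + h) * 1 - z * 1 - 1 * 1 * h) with (RtoC 0) by ring. rewrite Cmod_0.
      rewrite Rmult_0_r. apply Rmult_le_pos; [|lra]. pose proof (pow2_ge_0 (Cmod h)). simpl in *. lra.
    + replace ((z + h) ^ S (S n) - z ^ S (S n) - INR (S (S n)) * z ^ pred (S (S n)) * h)
        with ((z + h) * ((z + h) ^ S n - z ^ S n - INR (S n) * z ^ pred (S n) * h)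
              + INR (S n) * z ^ n * (h * h))
        by (rewrite (S_INR (S n)), RtoC_plus; simpl pred; simpl Cpow; ring).
      set (E := (z + h) ^ S n - z ^ S n - INR (S n) * z ^ pred (S n) * h) in *.
      assert (Pr : 0 <= r ^ n) by (apply pow_le; lra).
      assert (Q1 : Cmod ((z + h) * E + INR (S n) * z ^ n * (h * h))
        <= r * Cmod E + INR (S n) * r ^ n * Cmod h ^ 2).
      { eapply Rle_trans. apply Cmod_triangle. rewrite !Cmod_mult, Cmod_pow, Cmod_R.
        rewrite (Rabs_pos_eq (INR (S n))) by apply pos_INR.
        apply Rplus_le_compat. apply Rmult_le_compat_r; auto using Cmod_ge_0.
        replace (Cmod h * Cmod h)%R with (Cmod h ^ 2)%R by ring.
        apply Rmult_le_compat_r. apply pow2_ge_0.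
        apply Rmult_le_compat_l. apply pos_INR. apply pow_incr. lra. }
      apply Rle_trans with (r * (r ^ 2 * Cmod E) + INR (S n) * r ^ S (S n) * Cmod h ^ 2)%R.
      { eapply Rle_trans. apply Rmult_le_compat_l. apply pow2_ge_0. exact Q1. simpl. right. ring. }
      apply Rle_trans with (r * (INR (S n) * INR (S n) * Cmod h ^ 2 * r ^ S n)
        + INR (S n) * r ^ S (S n) * Cmod h ^ 2)%R.
      { apply Rplus_le_compat_r. apply Rmult_le_compat_l; lra. }
      replace (r * (INR (S n) * INR (S n) * Cmod h ^ 2 * r ^ S n)
        + INR (S n) * r ^ S (S n) * Cmod h ^ 2)%R
        with ((INR (S n) * INR (S n) + INR (S n)) * (Cmod h ^ 2 * r ^ S (S n)))%R by (simpl; ring).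
      rewrite Rmult_assoc. apply Rmult_le_compat_r.
      apply Rmult_le_pos. apply pow2_ge_0. apply pow_le; lra.
      rewrite (S_INR (S n)). pose proof (pos_INR (S n)). nra.
Qed.

Lemma Cder_CPS (c : nat -> C) (z : C) : radius_ge_1 c -> Cmod z < 1 ->
  Cder (CPS c) z (CPS (fun n => INR (S n) * c (S n)) z).
Proof.
  intros Hc Hz. pose proof (Cmod_ge_0 z) as Pz.
  set (r := ((Cmod z + 1) / 2)%R).
  assert (Hr : 0 < r < 1) by (unfold r; lra). assert (Hzr : Cmod z < r) by (unfold r; lra).
  assert (Pr2 : 0 < r ^ 2) by (apply pow_lt; lra).
  assert (G1 : radius_ge_1 (fun n => INR n * c n)) by now apply radius_ge_1_mult_INR.
  assert (G2 : radius_ge_1 (fun n => INR n * (INR n * c n))) by now apply radius_ge_1_mult_INR.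
  assert (Sd : Csummable (fun n => c n * INR n * z ^ pred n)).
  { apply (ex_series_incr_1 (fun n => Cmod (c n * INR n * z ^ pred n))).
    apply (Csummable_ext (fun n => INR (S n) * c (S n) * z ^ n)).
    intros n. simpl pred. ring. apply (radius_ge_1_summable (fun n => INR (S n) * c (S n))); auto.
    apply (radius_ge_1_succ _ G1). }
  assert (Ed : CPS (fun n => INR (S n) * c (S n)) z = CSeries (fun n => c n * INR n * z ^ pred n)).
  { rewrite CSeries_incr_1 by exact Sd. unfold CPS. simpl INR at 2. simpl pred.
    rewrite Cmult_0_r, Cmult_0_l, Cplus_0_l. apply CSeries_ext. intros n. ring. }
  rewrite Ed. intros e Pe.
  pose proof (radius_ge_1_summable_R _ r G2 ltac:(lra)) as Sm.
  (* Summing [pow_taylor_bound] bounds the remainder of the series by 2 T |h|^2 / r^2, and |h| < e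
     r^2 / (2 T + 1) turns this into e |h|. *)
  set (T := Series (fun n => Cmod (INR n * (INR n * c n)) * r ^ n)%R).
  assert (PT : 0 <= T).
  { replace 0%R with (Series (fun _ : nat => 0%R)) by apply Series_zero. apply Series_le; auto.
    intros n. split. lra. apply Rmult_le_pos. apply Cmod_ge_0. apply pow_le; lra. }
  assert (Pd : 0 < e * r ^ 2 / (2 * T + 1)).
  { apply Rdiv_lt_0_compat; [|lra]. apply Rmult_lt_0_compat; lra. }
  exists (Rmin (r - Cmod z) (e * r ^ 2 / (2 * T + 1))). split. apply Rmin_pos; lra.
  intros h Hh. pose proof (Rmin_l (r - Cmod z) (e * r ^ 2 / (2 * T + 1))).
  pose proof (Rmin_r (r - Cmod z) (e * r ^ 2 / (2 * T + 1))).
  pose proof (Cmod_ge_0 h) as Ph.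
  assert (Hzh : Cmod (z + h) <= r) by (eapply Rle_trans; [apply Cmod_triangle | lra]).
  assert (E : CPS c (z + h) - CPS c z - CSeries (fun n => c n * INR n * z ^ pred n) * h
    = CSeries (fun n => c n * ((z + h) ^ n - z ^ n - INR n * z ^ pred n * h))).
  { unfold CPS.
    replace (CSeries (fun n => c n * (z + h) ^ n) - CSeries (fun n => c n * z ^ n)
       - CSeries (fun n => c n * INR n * z ^ pred n) * h)
      with (CSeries (fun n => c n * (z + h) ^ n) + ((-(1)) * CSeries (fun n => c n * z ^ n)
       + (- h) * CSeries (fun n => c n * INR n * z ^ pred n))) by ring.
    assert (S1 : Csummable (fun n => c n * (z + h) ^ n)) by (apply radius_ge_1_summable; auto; lra).
    assert (S2 : Csummable (fun n => c n * z ^ n)) by (apply radius_ge_1_summable; auto; lra).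
    rewrite <- !CSeries_scal, <- !CSeries_plus; auto using Csummable_scal, Csummable_plus.
    apply CSeries_ext. intros n. ring. }
  rewrite E.
  eapply Rle_trans.
  - apply (Cmod_CSeries_le _ (fun n => / r ^ 2 * Cmod h ^ 2 * (Cmod (INR n * (INR n * c n)) * r ^ n))%R).
    + intros n. pose proof (pow_taylor_bound z h r n ltac:(lra) Hzh) as Tb.
      rewrite !Cmod_mult, !Cmod_R, !(Rabs_pos_eq (INR n)) by apply pos_INR.
      apply Rmult_le_reg_l with (r ^ 2)%R; auto.
      replace (r ^ 2 * (/ r ^ 2 * Cmod h ^ 2 * (INR n * (INR n * Cmod (c n)) * r ^ n)))%R
        with (Cmod (c n) * (INR n * INR n * Cmod h ^ 2 * r ^ n))%R by (field; lra).
      rewrite <- Rmult_assoc, (Rmult_comm (r ^ 2)), Rmult_assoc.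
      apply Rmult_le_compat_l; auto using Cmod_ge_0.
    + now apply (ex_series_scal (/ r ^ 2 * Cmod h ^ 2)%R (fun n => Cmod (INR n * (INR n * c n)) * r ^ n)%R).
  - rewrite Series_scal_l. fold T.
    apply Rmult_le_reg_l with (r ^ 2)%R; auto.
    replace (r ^ 2 * (2 * (/ r ^ 2 * Cmod h ^ 2 * T)))%R with (2 * T * Cmod h * Cmod h)%R by (field; lra).
    replace (r ^ 2 * (e * Cmod h))%R with (e * r ^ 2 * Cmod h)%R by ring.
    apply Rmult_le_compat_r; auto.
    apply Rle_trans with ((2 * T + 1) * (e * r ^ 2 / (2 * T + 1)))%R.
    apply Rmult_le_compat; lra. right. field. lra.
Qed.

Lemma CPS_theta (c : nat -> C) (z : C) : radius_ge_1 c -> Cmod z < 1 ->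
  z * CPS (fun n => INR (S n) * c (S n)) z = CPS (fun n => INR n * c n) z.
Proof.
  intros Hc Hz. rewrite (CPS_unfold (fun n => INR n * c n)); auto using radius_ge_1_mult_INR.
  simpl INR at 2. ring.
Qed.


(** * The binomial series and the equation x D' + beta D = 0 *)

Lemma poch_S (a : C) (n : nat) : poch a (S n) = poch a n * (a + INR n).
Proof. reflexivity. Qed.

Lemma poch_add (a : C) (k n : nat) : poch a (k + n) = poch a k * poch (a + INR k) n.
Proof.
  induction n as [|n IH].
  - rewrite Nat.add_0_r. simpl. ring.
  - rewrite Nat.add_succ_r. simpl. rewrite IH, plus_INR, RtoC_plus. ring.
Qed.

Lemma add_INR_neq_0 (v : C) (n : nat) : not_nonpos_int v -> v + INR n <> 0.
Proof.
  intros Hv E. apply (Hv n). replace v with (v + INR n + - INR n) by ring.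
  rewrite E, RtoC_opp. ring.
Qed.

Lemma not_nonpos_int_add (v : C) (n : nat) : not_nonpos_int v -> not_nonpos_int (v + INR n).
Proof.
  intros Hv k E. apply (add_INR_neq_0 v (n + k)%nat Hv).
  rewrite plus_INR, RtoC_plus. rewrite Cplus_assoc, E, RtoC_opp. ring.
Qed.

Lemma poch_neq_0 (v : C) (n : nat) : not_nonpos_int v -> poch v n <> 0.
Proof.
  intros Hv. induction n as [|n IH]; simpl. apply C1_nz.
  apply Cmult_neq_0; auto. now apply add_INR_neq_0.
Qed.

Lemma Cfact_neq_0 (n : nat) : RtoC (INR (fact n)) <> 0.
Proof. intros E. apply RtoC_inj in E. now apply INR_fact_neq_0 in E. Qed.

Lemma CINR_S_neq_0 (n : nat) : RtoC (INR (S n)) <> 0.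
Proof. intros E. apply RtoC_inj in E. now apply not_0_INR in E. Qed.

(** The Taylor coefficients of (1 - x)^(-a); see [binser_Cpowc]. *)
Definition bin (a : C) (n : nat) : C := poch a n / INR (fact n).

Lemma bin_rec (a : C) (n : nat) : INR (S n) * bin a (S n) = (a + INR n) * bin a n.
Proof.
  unfold bin. rewrite poch_S, fact_simpl, mult_INR, RtoC_mult.
  field. split. apply Cfact_neq_0. apply CINR_S_neq_0.
Qed.

Lemma radius_ge_1_bin (a : C) : radius_ge_1 (bin a).
Proof.
  apply (radius_ge_1_rec a 1). intros n. rewrite <- bin_rec, S_INR, RtoC_plus. ring.
Qed.

Definition binser (a x : C) : C := CPS (bin a) x.

Lemma binser_0 (a : C) : binser a 0 = 1.
Proof.
  unfold binser. rewrite CPS_unfold; [|apply radius_ge_1_bin|rewrite Cmod_0; lra].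
  rewrite Cmult_0_l. unfold bin. simpl. field.
Qed.

Lemma sub_1_neq_0 (x : C) : Cmod x < 1 -> 1 - x <> 0.
Proof. intros Hx E. replace x with (1 - (1 - x)) in Hx by ring. rewrite E in Hx.
  replace (1 - 0) with (RtoC 1) in Hx by ring. rewrite Cmod_1 in Hx. lra. Qed.

(** Summed against x^n, the recurrence [bin_rec] says B' = a B + x B'. *)
Lemma Cder_binser (a x : C) : Cmod x < 1 ->
  Cder (binser a) x (a * binser a x / (1 - x)).
Proof.
  intros Hx. pose proof (Cder_CPS _ _ (radius_ge_1_bin a) Hx) as D.
  set (L := CPS (fun n => INR (S n) * bin a (S n)) x) in *.
  assert (E : L = a * binser a x + x * L).
  { unfold L at 2. rewrite (CPS_theta (bin a)) by (auto; apply radius_ge_1_bin).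
    unfold binser. rewrite <- (CPS_scal a (bin a) x (radius_ge_1_bin a) Hx).
    rewrite <- (CPS_plus (fun n => a * bin a n) (fun n => INR n * bin a n) x);
      auto using radius_ge_1_bin, radius_ge_1_scal, radius_ge_1_mult_INR.
    apply CPS_ext. intros n. rewrite bin_rec. ring. }
  replace (a * binser a x / (1 - x)) with L. exact D.
  replace (a * binser a x) with (L * (1 - x)).
  field. now apply sub_1_neq_0.
  replace (L * (1 - x)) with (L - x * L) by ring. rewrite E at 1. ring.
Qed.

Lemma Re_1_minus_pos (t : R) (x : C) : Cmod (t * x) < 1 -> 0 < 1 - t * Re x.
Proof.
  intros H. pose proof (re_le_Cmod (t * x)) as A.
  replace (Re (t * x)) with (t * Re x)%R in A by (simpl; unfold Re; ring).
  apply Rabs_le_between in A. lra.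
Qed.

Lemma Rder_Clog (x : C) (t : R) : Cmod (t * x) < 1 ->
  Rder (fun s => Clog (1 - s * x)) t (- x / (1 - t * x)).
Proof.
  intros H. pose proof (Re_1_minus_pos t x H) as P0.
  destruct x as [x1 x2]. simpl in P0.
  assert (N1 : 0 < (1 - t * x1) * (1 - t * x1) + (t * x2) * (t * x2)).
  { pose proof (Rmult_lt_0_compat _ _ P0 P0). pose proof (Rle_0_sqr (t * x2)). unfold Rsqr in *. lra. }
  assert (N0 : ((1 - t * x1) * (1 - t * x1) + (t * x2) * (t * x2) <> 0)%R) by lra.
  split.
  - apply is_derive_ext with
      (fun s => ln (sqrt ((1 - s * x1) * (1 - s * x1) + (s * x2) * (s * x2)))).
    { intros s. unfold Clog, Cmod. simpl. f_equal. f_equal. ring. }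
    auto_derive. { repeat split; auto. now apply sqrt_lt_R0. }
    assert (Sq := sqrt_sqrt _ (Rlt_le _ _ N1)).
    set (q := sqrt ((1 - t * x1) * (1 - t * x1) + t * x2 * (t * x2))) in *.
    assert (Pq : 0 < q) by now apply sqrt_lt_R0.
    simpl.
    replace ((1 + - (t * x1 - 0 * x2)) * ((1 + - (t * x1 - 0 * x2)) * 1) + (0 + - (t * x2 + 0 * x1)) * ((0 + - (t * x2 + 0 * x1)) * 1))%R
      with (q * q)%R by (rewrite Sq; ring).
    change (1 + - (t * x1))%R with (1 - t * x1)%R. fold q. field. lra.
  (* For s within d of t the real part 1 - s x1 stays positive, so [Carg] is given by its first
     branch. *)
  - apply is_derive_ext_loc with (fun s => atan (- (s * x2) / (1 - s * x1))).
    { set (d := ((1 - t * x1) / (Rabs x1 + 1))%R).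
      pose proof (Rabs_pos x1) as Px.
      assert (Pd : 0 < d) by (apply Rdiv_lt_0_compat; lra).
      exists (mkposreal d Pd). intros s Hs.
      change (Rabs (s - t) < d) in Hs.
      assert (Hs' : 0 < 1 - s * x1).
      { assert (Rabs ((s - t) * x1) < 1 - t * x1).
        { rewrite Rabs_mult. apply Rle_lt_trans with (Rabs (s - t) * (Rabs x1 + 1))%R.
          pose proof (Rabs_pos (s - t)). nra.
          replace (1 - t * x1)%R with (d * (Rabs x1 + 1))%R by (unfold d; field; lra).
          apply Rmult_lt_compat_r; lra. }
        apply Rabs_lt_between in H0. lra. }
      unfold Clog, Carg. simpl.
      replace (1 + - (s * x1 - 0 * x2))%R with (1 - s * x1)%R by ring.
      replace (0 + - (s * x2 + 0 * x1))%R with (- (s * x2))%R by ring.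
      destruct Rlt_dec; [reflexivity | lra]. }
    auto_derive. { lra. }
    simpl. field. repeat split; nra.
Qed.

Lemma Clog_1 : Clog 1 = 0.
Proof.
  unfold Clog. rewrite Cmod_1, ln_1. unfold Carg. simpl. destruct Rlt_dec; [|lra].
  unfold Rdiv. rewrite Rmult_0_l, atan_0. reflexivity.
Qed.

Lemma Cpowc_plus (w a b : C) : Cpowc w (a + b) = Cpowc w a * Cpowc w b.
Proof. unfold Cpowc. rewrite <- Cexp_plus. f_equal. ring. Qed.

Lemma Cexp_Clog (w : C) : 0 < Re w -> Cexp (Clog w) = w.
Proof.
  intros H. destruct w as [u v]. simpl in H. unfold Clog, Carg, Cexp. simpl.
  destruct Rlt_dec; [|lra].
  assert (N1 : 0 < u * u + v * v) by nra.
  assert (Pm : 0 < Cmod (u, v)).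
  { unfold Cmod. apply sqrt_lt_R0. simpl. lra. }
  rewrite exp_ln by exact Pm. rewrite cos_atan, sin_atan.
  assert (E : Cmod (u, v) = (u * sqrt (1 + (v / u)²))%R).
  { transitivity (sqrt (u * u) * sqrt (1 + (v / u)²))%R; [|now rewrite sqrt_square by lra].
    rewrite <- sqrt_mult_alt by nra. unfold Cmod, Rsqr. simpl. f_equal. field. lra. }
  assert (Ps : 0 < sqrt (1 + (v / u)²)).
  { apply sqrt_lt_R0. pose proof (Rle_0_sqr (v / u)). lra. }
  rewrite E. apply C_ext; simpl; field; lra.
Qed.

(** The product of the series at t x with (1 - t x)^a has derivative 0 along 0 <= t <= 1 and equals
    1 at t = 0. *)
Lemma binser_Cpowc (a x : C) : Cmod x < 1 -> binser a x = Cpowc (1 - x) (- a).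
Proof.
  intros Hx.
  assert (K : binser a x * Cpowc (1 - x) a = 1).
  { set (phi := fun t : R => binser a (0 + t * x) * Cpowc (1 - t * x) a).
    assert (Z : phi 0%R = phi 1%R).
    2: { unfold phi in Z. rewrite !Cmult_0_l, !Cmult_1_l, !Cplus_0_l, binser_0 in Z.
      rewrite <- Z. replace (1 - 0) with (RtoC 1) by ring. unfold Cpowc.
      rewrite Clog_1, Cmult_0_r, Cexp_0. ring. }
    apply Rder_zero_const.
    intros t Ht. rewrite Rmin_left, Rmax_right in Ht by lra.
    assert (Htx : Cmod (t * x) < 1).
    { rewrite Cmod_mult, Cmod_R, Rabs_pos_eq by lra. pose proof (Cmod_ge_0 x). nra. }
    pose proof (sub_1_neq_0 _ Htx) as N.
    assert (D1 := Rder_comp (binser a) (fun t => 0 + t * x) t x _ (Rder_affine 0 x t)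
      (Cder_binser a (0 + t * x) ltac:(now rewrite Cplus_0_l))).
    assert (D2 := Rder_comp (fun z => Cexp (a * z)) _ t _ _ (Rder_Clog x t Htx)
      (Cder_comp Cexp (fun z => a * z) _ _ _ (Cder_scal a (fun z => z) _ _ (Cder_id _)) (Cder_exp _))).
    pose proof (Rder_mult _ _ _ _ _ D1 D2) as D.
    refine (eq_rect _ (Rder phi t) D 0 _). cbv beta. rewrite Cplus_0_l. field. exact N. }
  assert (K2 : Cpowc (1 - x) a * Cpowc (1 - x) (- a) = 1).
  { rewrite <- Cpowc_plus. unfold Cpowc. replace ((a + - a) * Clog (1 - x)) with (RtoC 0) by ring.
    apply Cexp_0. }
  transitivity (binser a x * (Cpowc (1 - x) a * Cpowc (1 - x) (- a))).
  rewrite K2. ring. rewrite Cmult_assoc, K. ring.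
Qed.

Lemma Cpowc_binser (a x : C) : Cmod x < 1 -> Cpowc (1 - x) a = binser (- a) x.
Proof. intros Hx. rewrite binser_Cpowc by exact Hx. f_equal. ring. Qed.

Lemma Cpowc_1 (x : C) : Cmod x < 1 -> Cpowc (1 - x) 1 = 1 - x.
Proof.
  intros Hx. unfold Cpowc. rewrite Cmult_1_l. apply Cexp_Clog.
  pose proof (Re_1_minus_pos 1 x ltac:(now rewrite Cmult_1_l)). destruct x. simpl in *. lra.
Qed.

Lemma binser_plus (a b x : C) : Cmod x < 1 -> binser (a + b) x = binser a x * binser b x.
Proof.
  intros Hx. rewrite !binser_Cpowc by exact Hx. rewrite <- Cpowc_plus. f_equal. ring.
Qed.

Lemma binser_pred (a x : C) : Cmod x < 1 -> binser (a - 1) x = (1 - x) * binser a x.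
Proof.
  intros Hx. replace (a - 1) with (- (1) + a) by ring. rewrite binser_plus by exact Hx.
  rewrite (binser_Cpowc (- (1))) by exact Hx. replace (- - (1)) with (RtoC 1) by ring.
  now rewrite Cpowc_1.
Qed.

(** If exp (2 pi i beta) = 1, the modulus makes beta real and sin (pi beta) = 0 makes it an integer,
    which Re beta <= 0 would force to be nonpositive. *)
Lemma Cexp_period_int (beta : C) : Re beta <= 0 -> not_nonpos_int beta ->
  Cexp (Ci * beta * (2 * PI)%R) <> 1.
Proof.
  intros Hr Hb E. pose proof PI_RGT_0 as PP.
  pose proof (f_equal Cmod E) as M. rewrite Cmod_Cexp, Cmod_1 in M.
  destruct beta as [u v]. simpl in *.
  assert (V : v = 0%R).
  { assert (M' : exp (- (v * (2 * PI))) = exp 0) by (rewrite exp_0, <- M; f_equal; ring).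
    apply exp_inv in M'. nra. }
  subst v. apply (f_equal Re) in E. unfold Cexp in E. simpl in E.
  assert (C1 : cos (2 * (PI * u)) = 1%R).
  { rewrite <- E. rewrite <- (Rmult_1_l (cos (2 * (PI * u)))). f_equal.
    - rewrite <- exp_0. f_equal. ring.
    - f_equal. ring. }
  rewrite cos_2a_sin in C1.
  assert (S0 : sin (PI * u) = 0%R) by nra.
  apply sin_eq_0_0 in S0. destruct S0 as [k Hk].
  assert (U : u = IZR k) by nra.
  apply (Hb (Z.abs_nat k)). rewrite U in *. apply le_IZR in Hr.
  rewrite INR_IZR_INZ. rewrite Zabs2Nat.id_abs, <- opp_IZR.
  replace (- Z.abs k)%Z with k by lia. reflexivity.
Qed.

(* Along z e^{kappa t} the equation makes D(z e^{kappa t}) e^{kappa beta t} constant: the full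
   circle (kappa = i) forces beta to be an integer, the ray (kappa = -1) excludes Re beta > 0. *)
Lemma euler_ode_unique (D : C -> C) (beta : C) (r : R) : not_nonpos_int beta ->
  (forall z, Cmod z < r -> exists L, Cder D z L /\ z * L = - beta * D z) ->
  forall z, Cmod z < r -> D z = 0.
Proof.
  intros Hb HD z Hz. pose proof (Cmod_ge_0 z) as Pz.
  assert (Cst : forall (kappa : C) (T : R), 0 <= T -> Re kappa <= 0 ->
    D (z * Cexp (kappa * T)) * Cexp (kappa * beta * T) = D z).
  { intros kappa T PT Hk.
    set (phi := fun t : R => D (z * Cexp (0 + t * kappa)) * Cexp (0 + t * (kappa * beta))).
    assert (Z : phi 0%R = phi T).
    2: { unfold phi in Z. rewrite !Cmult_0_l, !Cplus_0_l, Cexp_0, !Cmult_1_r in Z.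
      now rewrite (Cmult_comm kappa T), (Cmult_comm (kappa * beta) T). }
    apply Rder_zero_const.
    intros t Ht. rewrite Rmin_left, Rmax_right in Ht by lra.
    destruct (HD (z * Cexp (0 + t * kappa))) as [L [HL EL]].
    { rewrite Cmod_mult, Cmod_Cexp. apply Rle_lt_trans with (Cmod z * 1)%R; [|lra].
      apply Rmult_le_compat_l; auto. rewrite <- exp_0. apply Rnot_lt_le. intros X.
      apply exp_lt_inv in X. destruct kappa as [k1 k2]. simpl in *. nra. }
    assert (D1 := Rder_comp (fun u => D (z * Cexp u)) _ t _ _ (Rder_affine 0 kappa t)
      (Cder_comp D (fun u => z * Cexp u) _ _ _ (Cder_scal z Cexp _ _ (Cder_exp _)) HL)).
    assert (D2 := Rder_comp Cexp _ t _ _ (Rder_affine 0 (kappa * beta) t) (Cder_exp _)).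
    pose proof (Rder_mult _ _ _ _ _ D1 D2) as DD.
    refine (eq_rect _ (Rder phi t) DD 0 _). cbv beta. set (e := Cexp (0 + t * (kappa * beta))). set (w := z * Cexp (0 + t * kappa)) in *.
    replace (L * w * kappa * e + D w * (e * (kappa * beta)))
      with (kappa * e * (w * L + beta * D w)) by ring.
    rewrite EL. ring. }
  destruct (Rle_dec (Re beta) 0) as [Hr|Hr].
  (* A full turn returns to z, so D z exp (2 pi i beta) = D z. *)
  - pose proof PI_RGT_0 as PP.
    pose proof (Cst Ci (2 * PI)%R ltac:(lra) ltac:(simpl; lra)) as E.
    replace (Cexp (Ci * (2 * PI)%R)) with (RtoC 1) in E.
    2: { unfold Cexp. simpl. apply C_ext; simpl.
         - replace (0 * (2 * PI) - 1 * 0)%R with 0%R by ring.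
           replace (0 * 0 + 1 * (2 * PI))%R with (2 * PI)%R by ring. rewrite exp_0, cos_2PI; ring.
         - replace (0 * (2 * PI) - 1 * 0)%R with 0%R by ring.
           replace (0 * 0 + 1 * (2 * PI))%R with (2 * PI)%R by ring. rewrite sin_2PI; ring. }
    rewrite Cmult_1_r in E. pose proof (Cexp_period_int beta Hr Hb) as N.
    set (e := Cexp (Ci * beta * (2 * PI)%R)) in *.
    destruct (Ceq_dec (D z) 0) as [Z|Nz]; auto. exfalso. apply N.
    replace e with (D z * e / D z) by (field; auto). rewrite E. field. auto.
  - destruct (HD 0) as [L0 [HL0 _]]. { rewrite Cmod_0. lra. }
    destruct (Cder_cont _ _ _ HL0 1%R) as [d [Pd Hd]]. lra.
    set (B := (Cmod (D 0) + 1)%R).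
    assert (Bd : forall T, 0 <= T -> Cmod z * exp (- T) < d -> Cmod (D z) <= B * exp (- (Re beta * T))).
    { intros T PT HT. rewrite <- (Cst (-(1)) T PT ltac:(simpl; lra)), Cmod_mult, Cmod_Cexp.
      replace (Re (- (1) * beta * T)) with (- (Re beta * T))%R by (destruct beta; simpl; ring).
      apply Rmult_le_compat_r. left; apply exp_pos.
      specialize (Hd (z * Cexp (- (1) * T))). rewrite Cplus_0_l in Hd.
      pose proof (Cmod_triangle (D (z * Cexp (- (1) * T)) - D 0) (D 0)) as Tr.
      replace (D (z * Cexp (- (1) * T)) - D 0 + D 0) with (D (z * Cexp (- (1) * T))) in Tr by ring.
      eapply Rle_trans. exact Tr. unfold B. rewrite Rplus_comm. apply Rplus_le_compat_l. left. apply Hd.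
      rewrite Cmod_mult, Cmod_Cexp.
      replace (Re (- (1) * T)) with (- T)%R by (simpl; ring). exact HT. }
    apply Cmod_eq_0. apply Rle_antisym; [|apply Cmod_ge_0].
    apply Rnot_lt_le. intros Pos.
    assert (PB : 0 < B) by (unfold B; pose proof (Cmod_ge_0 (D 0)); lra).
    (* T achieves both |z| exp (-T) < d, where [B] bounds D, and B exp (- Re beta T) < |D z|. The
       summands 1 make both strict, and |z| + 1 avoids dividing by 0. *)
    set (T := Rmax 0 (Rmax (1 - ln (d / (Cmod z + 1))) ((1 - ln (Cmod (D z) / B)) / Re beta))).
    assert (T0 : 0 <= T) by apply Rmax_l.
    assert (T1 : 1 - ln (d / (Cmod z + 1)) <= T) by (eapply Rle_trans; [apply Rmax_l|apply Rmax_r]).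
    assert (T2 : (1 - ln (Cmod (D z) / B)) / Re beta <= T) by (eapply Rle_trans; [apply Rmax_r|apply Rmax_r]).
    assert (Q1 : exp (- T) < d / (Cmod z + 1)).
    { rewrite <- (exp_ln (d / (Cmod z + 1))) by (apply Rdiv_lt_0_compat; lra).
      apply exp_increasing. lra. }
    assert (Q2 : exp (- (Re beta * T)) < Cmod (D z) / B).
    { rewrite <- (exp_ln (Cmod (D z) / B)) by (apply Rdiv_lt_0_compat; lra).
      apply exp_increasing.
      assert (1 - ln (Cmod (D z) / B) <= Re beta * T).
      { replace (1 - ln (Cmod (D z) / B))%R with (Re beta * ((1 - ln (Cmod (D z) / B)) / Re beta))%R by (field; lra).
        apply Rmult_le_compat_l; lra. }
      lra. }
    assert (Q1' : Cmod z * exp (- T) < d).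
    { pose proof (exp_pos (- T)).
      apply Rle_lt_trans with ((Cmod z + 1) * exp (- T))%R. nra.
      replace d with ((Cmod z + 1) * (d / (Cmod z + 1)))%R by (field; lra).
      apply Rmult_lt_compat_l; lra. }
    specialize (Bd T T0 Q1').
    assert (B * exp (- (Re beta * T)) < Cmod (D z)).
    { replace (Cmod (D z)) with (B * (Cmod (D z) / B))%R by (field; lra).
      apply Rmult_lt_compat_l; lra. }
    lra.
Qed.


(** * Euler's and Pfaff's transformations of 2F1(a, beta; beta+1; x) *)

Lemma Cinv_add_INR_bounded (beta : C) : not_nonpos_int beta ->
  exists B, forall n, Cmod (/ (beta + INR n)) <= B.
Proof.
  intros Hb. destruct (INR_unbounded (Cmod beta + 1)) as [N HN].
  apply (bounded_of_eventually (fun n => Cmod (/ (beta + INR n))) N 1).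
  intros n Hn. apply le_INR in Hn. rewrite Cmod_inv by now apply add_INR_neq_0.
  pose proof (Cmod_triangle (beta + INR n) (- beta)) as T.
  replace (beta + INR n + - beta) with (RtoC (INR n)) in T by ring.
  rewrite Cmod_opp, Cmod_R, Rabs_pos_eq in T by apply pos_INR.
  rewrite <- Rinv_1. apply Rinv_le_contravar; lra.
Qed.

(* The generating functions are 2F1(a, beta; beta+1; x) / beta and 2F1(u, 1; beta+1; x) / beta. *)
Definition Ucoef (a beta : C) (n : nat) : C := bin a n * / (beta + INR n).
Definition Vcoef (u beta : C) (n : nat) : C := poch u n / poch beta (S n).

Section EulerPfaff.

Variable beta : C.
Hypothesis Hb : not_nonpos_int beta.

Lemma radius_ge_1_Ucoef (a : C) : radius_ge_1 (Ucoef a beta).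
Proof.
  destruct (Cinv_add_INR_bounded beta Hb) as [B HB].
  exact (radius_ge_1_bounded_mult _ _ B HB (radius_ge_1_bin a)).
Qed.

Lemma Vcoef_rec (u : C) (n : nat) :
  (beta + INR (S n)) * Vcoef u beta (S n) = (u + INR n) * Vcoef u beta n.
Proof.
  unfold Vcoef. rewrite (poch_S u), (poch_S beta (S n)).
  field. split; [now apply poch_neq_0 | now apply add_INR_neq_0].
Qed.

Lemma radius_ge_1_Vcoef (u : C) : radius_ge_1 (Vcoef u beta).
Proof.
  apply (radius_ge_1_rec u (beta + 1)). intros n. rewrite <- Vcoef_rec, S_INR, RtoC_plus. ring.
Qed.

Lemma Cder_U (a x : C) : Cmod x < 1 -> exists L,
  Cder (CPS (Ucoef a beta)) x L /\ x * L = binser a x - beta * CPS (Ucoef a beta) x.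
Proof.
  intros Hx. pose proof (radius_ge_1_Ucoef a) as G.
  eexists. split. apply Cder_CPS; auto. rewrite CPS_theta by auto.
  assert (E : CPS (fun n => INR n * Ucoef a beta n) x + beta * CPS (Ucoef a beta) x = binser a x).
  { rewrite <- (CPS_scal beta), <- (CPS_plus (fun n => INR n * Ucoef a beta n));
      auto using radius_ge_1_mult_INR, radius_ge_1_scal.
    apply CPS_ext. intros n. unfold Ucoef. field. now apply add_INR_neq_0. }
  rewrite <- E. ring.
Qed.

(** Summing [Vcoef_rec] against x^(n+1) and adding the constant term beta v_0 = 1 gives x V' + beta
    V = 1 + x (u V + x V'). *)
Lemma Cder_V (u x : C) : Cmod x < 1 -> exists L,
  Cder (CPS (Vcoef u beta)) x L /\
  (1 - x) * (x * L) = 1 - (beta - u * x) * CPS (Vcoef u beta) x.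
Proof.
  intros Hx. pose proof (radius_ge_1_Vcoef u) as G.
  eexists. split. apply Cder_CPS; auto.
  set (L := CPS (fun n => INR (S n) * Vcoef u beta (S n)) x).
  set (V := CPS (Vcoef u beta) x).
  assert (E0 : V = Vcoef u beta 0 + x * CPS (fun n => Vcoef u beta (S n)) x) by now apply CPS_unfold.
  assert (E1 : beta * Vcoef u beta 0 = 1).
  { unfold Vcoef. simpl. pose proof (add_INR_neq_0 beta 0 Hb). simpl in H. field.
    intros E. apply H. rewrite E. ring. }
  assert (E2 : x * L = CPS (fun n => INR n * Vcoef u beta n) x) by now apply CPS_theta.
  assert (E3 : L + beta * CPS (fun n => Vcoef u beta (S n)) x = u * V + x * L).
  { rewrite E2. unfold L, V. rewrite <- (CPS_scal beta), <- (CPS_scal u);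
      auto using radius_ge_1_succ.
    rewrite <- (CPS_plus (fun n => INR (S n) * Vcoef u beta (S n))),
      <- (CPS_plus (fun n => u * Vcoef u beta n));
      auto using radius_ge_1_scal, radius_ge_1_mult_INR, radius_ge_1_succ.
    - apply CPS_ext. intros n.
      replace (INR (S n) * Vcoef u beta (S n) + beta * Vcoef u beta (S n))
        with ((beta + INR (S n)) * Vcoef u beta (S n)) by ring.
      rewrite Vcoef_rec. ring.
    - apply (radius_ge_1_succ (fun n => INR n * Vcoef u beta n)). auto using radius_ge_1_mult_INR. }
  assert (E4 : x * L + beta * V = 1 + x * (u * V + x * L)).
  { rewrite <- E3, <- E1. rewrite E0 at 1. ring. }
  replace ((1 - x) * (x * L)) with (x * L + beta * V - beta * V - x * x * L) by ring.
  rewrite E4. ring.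
Qed.

Lemma Cmult_cancel_l (c z w : C) : c <> 0 -> c * z = c * w -> z = w.
Proof. intros Hc E. replace z with (c * z / c) by (field; auto). rewrite E. field. auto. Qed.

Lemma euler_transform (a x : C) : Cmod x < 1 ->
  CPS (Ucoef a beta) x = binser (a - 1) x * CPS (Vcoef (beta + 1 - a) beta) x.
Proof.
  intros Hx.
  assert (Z := euler_ode_unique
    (fun x => CPS (Ucoef a beta) x - binser (a - 1) x * CPS (Vcoef (beta + 1 - a) beta) x) beta 1 Hb).
  cbv beta in Z.
  replace (CPS (Ucoef a beta) x) with (CPS (Ucoef a beta) x
    - binser (a - 1) x * CPS (Vcoef (beta + 1 - a) beta) x
    + binser (a - 1) x * CPS (Vcoef (beta + 1 - a) beta) x) by ring.
  rewrite Z; auto. ring. clear x Hx Z.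
  intros x Hx.
  destruct (Cder_U a x Hx) as [LU [DU EU]].
  destruct (Cder_V (beta + 1 - a) x Hx) as [LV [DV EV]].
  eexists. split.
  - apply (Cder_minus (CPS (Ucoef a beta)) (fun x => binser (a - 1) x * CPS (Vcoef (beta + 1 - a) beta) x)).
    exact DU. apply (Cder_mult (binser (a - 1))). now apply Cder_binser. exact DV.
  - pose proof (sub_1_neq_0 x Hx) as N.
    pose proof (binser_pred a x Hx) as EB.
    (* Clearing 1 - x lets [EV] be used as it stands; the inhomogeneous terms of both equations are
       then [binser (a - 1) x] and cancel. *)
    apply (Cmult_cancel_l (1 - x)); auto.
    set (B := binser (a - 1) x) in *. set (V := CPS (Vcoef (beta + 1 - a) beta) x) in *.
    set (U := CPS (Ucoef a beta) x) in *.
    replace ((1 - x) * (x * (LU - ((a - 1) * B / (1 - x) * V + B * LV))))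
      with ((1 - x) * (x * LU) - x * (a - 1) * B * V - B * ((1 - x) * (x * LV))) by (field; auto).
    rewrite EU, EV.
    replace ((1 - x) * (binser a x - beta * U)) with (B - (1 - x) * (beta * U)) by (rewrite EB; ring).
    ring.
Qed.

(** The disc lies in the half plane Re x < 1/2 of the points nearer to 0 than to 1. *)
Lemma Cmod_pfaff_arg (x : C) : Cmod x < / 2 -> Cmod (x / (x - 1)) < 1.
Proof.
  intros Hx. pose proof (Cmod_ge_0 x).
  pose proof (Cmod_triangle (1 - x) x) as T. replace (1 - x + x) with (RtoC 1) in T by ring.
  rewrite Cmod_1 in T.
  assert (N : x - 1 <> 0).
  { intros E. apply (sub_1_neq_0 x ltac:(lra)). replace (1 - x) with (- (x - 1)) by ring. rewrite E. ring. }
  rewrite Cmod_div by exact N.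
  replace (x - 1) with (- (1 - x)) by ring. rewrite Cmod_opp.
  apply Rmult_lt_reg_r with (Cmod (1 - x)). lra.
  unfold Rdiv. rewrite Rmult_assoc, Rinv_l; lra.
Qed.

Lemma Cder_pfaff_arg (x : C) : Cmod x < 1 ->
  Cder (fun x => x / (x - 1)) x (- (1) / ((1 - x) * (1 - x))).
Proof.
  intros Hx. pose proof (sub_1_neq_0 x Hx) as N.
  assert (N' : x - 1 <> 0).
  { intros E. apply N. replace (1 - x) with (- (x - 1)) by ring. rewrite E. ring. }
  replace (- (1) / ((1 - x) * (1 - x))) with ((1 * (x - 1) - x * (1 - 0)) / ((x - 1) * (x - 1)))
    by (field; auto).
  apply (Cder_div (fun x => x) (fun x => x - 1)); auto. apply Cder_id.
  apply (Cder_minus (fun x => x) (fun _ => 1)). apply Cder_id. apply Cder_const.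
Qed.

Lemma pfaff_transform (a x : C) : Cmod x < / 2 ->
  CPS (Ucoef a beta) x = binser a x * CPS (Vcoef a beta) (x / (x - 1)).
Proof.
  intros Hx.
  assert (Z := euler_ode_unique
    (fun x => CPS (Ucoef a beta) x - binser a x * CPS (Vcoef a beta) (x / (x - 1))) beta (/ 2) Hb).
  cbv beta in Z.
  replace (CPS (Ucoef a beta) x) with (CPS (Ucoef a beta) x
    - binser a x * CPS (Vcoef a beta) (x / (x - 1))
    + binser a x * CPS (Vcoef a beta) (x / (x - 1))) by ring.
  rewrite Z; auto. ring. clear x Hx Z.
  intros x Hx2. assert (Hx : Cmod x < 1) by lra.
  destruct (Cder_U a x Hx) as [LU [DU EU]].
  destruct (Cder_V a _ (Cmod_pfaff_arg x Hx2)) as [LV [DV EV]].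
  eexists. split.
  - apply (Cder_minus (CPS (Ucoef a beta)) (fun x => binser a x * CPS (Vcoef a beta) (x / (x - 1)))).
    exact DU. apply (Cder_mult (binser a) (fun x => CPS (Vcoef a beta) (x / (x - 1)))).
    now apply Cder_binser. apply (Cder_comp (CPS (Vcoef a beta)) (fun x => x / (x - 1))).
    now apply Cder_pfaff_arg. exact DV.
  - pose proof (sub_1_neq_0 x Hx) as N.
    assert (N' : x - 1 <> 0).
    { intros E. apply N. replace (1 - x) with (- (x - 1)) by ring. rewrite E. ring. }
    set (B := binser a x) in *. set (y := x / (x - 1)) in *. set (V := CPS (Vcoef a beta) y) in *.
    set (U := CPS (Ucoef a beta) x) in *.
    (* Since x dy/dx = y (1 - y), the chain rule produces exactly the left side of [EV]; a x / (1 -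
       x) = - a y then cancels its term in u = a. *)
    replace (x * (LU - (a * B / (1 - x) * V + B * (LV * (- (1) / ((1 - x) * (1 - x)))))))
      with (x * LU - B * (a * x / (1 - x) * V + (1 - y) * (y * LV))) by (unfold y; field; auto).
    rewrite EU, EV.
    replace (a * x / (1 - x)) with (- (a * y)) by (unfold y; field; auto). ring.
Qed.

End EulerPfaff.


(** * The Gamma function *)

Definition is_Clim (s : nat -> C) (l : C) : Prop :=
  is_lim_seq (fun n => Re (s n)) (Re l) /\ is_lim_seq (fun n => Im (s n)) (Im l).

Lemma is_Clim_unique (s : nat -> C) (l m : C) : is_Clim s l -> is_Clim s m -> l = m.
Proof.
  intros [A B] [A' B']. apply C_ext.
  - apply is_lim_seq_unique in A. apply is_lim_seq_unique in A'. rewrite A in A'. now injection A'.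
  - apply is_lim_seq_unique in B. apply is_lim_seq_unique in B'. rewrite B in B'. now injection B'.
Qed.

Lemma is_Clim_mult (s t : nat -> C) (l m : C) :
  is_Clim s l -> is_Clim t m -> is_Clim (fun n => s n * t n) (l * m).
Proof.
  intros [A B] [A' B']. split; simpl.
  - apply (is_lim_seq_minus' (fun n => Re (s n) * Re (t n))%R (fun n => Im (s n) * Im (t n))%R);
      now apply is_lim_seq_mult'.
  - apply (is_lim_seq_plus' (fun n => Re (s n) * Im (t n))%R (fun n => Im (s n) * Re (t n))%R);
      now apply is_lim_seq_mult'.
Qed.

Lemma is_Clim_ext_loc (s t : nat -> C) (l : C) (N : nat) :
  (forall n, (N <= n)%nat -> s n = t n) -> is_Clim s l -> is_Clim t l.
Proof.
  intros H [A B]. split.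
  - apply is_lim_seq_ext_loc with (2 := A). exists N. intros n Hn. now rewrite H.
  - apply is_lim_seq_ext_loc with (2 := B). exists N. intros n Hn. now rewrite H.
Qed.

Lemma is_Clim_const (c : C) : is_Clim (fun _ => c) c.
Proof. split; apply is_lim_seq_const. Qed.

Lemma is_lim_seq_dist (u v : nat -> R) (l : R) (N : nat) :
  (forall n, (N <= n)%nat -> Rabs (u n - l) <= v n) -> is_lim_seq v 0%R -> is_lim_seq u l.
Proof.
  intros H Hv. apply is_lim_seq_le_le_loc with (fun n => l - v n)%R (fun n => l + v n)%R.
  - exists N. intros n Hn. specialize (H n Hn). apply Rabs_le_between in H. lra.
  - replace (Finite l) with (Finite (l - 0)) by (f_equal; ring).
    apply is_lim_seq_minus'; auto. apply is_lim_seq_const.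
  - replace (Finite l) with (Finite (l + 0)) by (f_equal; ring).
    apply is_lim_seq_plus'; auto. apply is_lim_seq_const.
Qed.

Lemma is_Clim_dist (s : nat -> C) (v : nat -> R) (l : C) (N : nat) :
  (forall n, (N <= n)%nat -> Cmod (s n - l) <= v n) -> is_lim_seq v 0%R -> is_Clim s l.
Proof.
  intros H Hv. split.
  - apply is_lim_seq_dist with v N; auto. intros n Hn. eapply Rle_trans; [|apply (H n Hn)].
    apply (re_le_Cmod (s n - l)).
  - apply is_lim_seq_dist with v N; auto. intros n Hn. eapply Rle_trans; [|apply (H n Hn)].
    apply (im_le_Cmod (s n - l)).
Qed.

Lemma ex_lim_of_summable_steps (u : nat -> R) :
  ex_series (fun n => u (S n) - u n)%R -> exists l : R, is_lim_seq u l.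
Proof.
  intros [l Hl]. exists (l + u 0%nat)%R. apply is_lim_seq_incr_1.
  apply is_lim_seq_ext with (fun n => sum_n (fun n => u (S n) - u n) n + u 0%nat)%R.
  - intros n. induction n as [|n IH]. rewrite sum_O; ring.
    rewrite sum_Sn. unfold plus; simpl. lra.
  - apply is_lim_seq_plus'. exact Hl. apply is_lim_seq_const.
Qed.

(** |P_(n+1)| <= (1 + a_n) |P_n| <= exp (a_n) |P_n|, so the exponential of the sum of a bounds the
    growth. *)
Lemma product_bounded (P : nat -> C) (a : nat -> R) :
  (forall n, 0 <= a n) -> ex_series a ->
  (forall n, Cmod (P (S n) - P n) <= a n * Cmod (P n)) ->
  exists B, forall n, Cmod (P n) <= B.
Proof.
  intros Pa Ha HP.
  assert (St : forall n, Cmod (P (S n)) <= exp (a n) * Cmod (P n)).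
  { intros n. pose proof (Cmod_triangle (P (S n) - P n) (P n)) as T.
    replace (P (S n) - P n + P n) with (P (S n)) in T by ring.
    pose proof (HP n). pose proof (exp_ineq1_le (a n)). pose proof (Cmod_ge_0 (P n)). nra. }
  assert (Bd : forall n, Cmod (P (S n)) <= exp (sum_n a n) * Cmod (P 0%nat)).
  { induction n as [|n IH]. rewrite sum_O. apply St.
    rewrite sum_Sn. unfold plus; simpl. rewrite Rplus_comm, exp_plus.
    eapply Rle_trans. apply St. rewrite Rmult_assoc. apply Rmult_le_compat_l; auto.
    left; apply exp_pos. }
  assert (Sb : forall n, sum_n a n <= Series a).
  { intros n. apply (is_lim_seq_incr_compare (sum_n a) (Series a)).
    apply Series_correct, Ha. intros k. rewrite sum_Sn. unfold plus; simpl. specialize (Pa (S k)). lra. }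
  apply (bounded_of_eventually (fun n => Cmod (P n)) 1 (exp (Series a) * Cmod (P 0%nat))).
  intros [|n] Hn. lia. eapply Rle_trans. apply Bd.
  apply Rmult_le_compat_r. apply Cmod_ge_0.
  destruct (Sb n) as [L|E]. left; now apply exp_increasing. rewrite E; lra.
Qed.

Lemma product_converges (P : nat -> C) (a : nat -> R) :
  (forall n, 0 <= a n) -> ex_series a ->
  (forall n, Cmod (P (S n) - P n) <= a n * Cmod (P n)) ->
  exists l, is_Clim P l.
Proof.
  intros Pa Ha HP. destruct (product_bounded P a Pa Ha HP) as [B HB].
  assert (K : forall n, Cmod (P (S n) - P n) <= B * a n).
  { intros n. eapply Rle_trans. apply HP. rewrite Rmult_comm. now apply Rmult_le_compat_r. }
  assert (Sa : ex_series (fun n => B * a n)%R) by now apply (ex_series_scal B a).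
  destruct (ex_lim_of_summable_steps (fun n => Re (P n))) as [l1 L1].
  { apply (ex_series_le (fun n => Re (P (S n)) - Re (P n))%R (fun n => B * a n)%R); auto.
    intros n. eapply Rle_trans; [|apply K]. apply (re_le_Cmod (P (S n) - P n)). }
  destruct (ex_lim_of_summable_steps (fun n => Im (P n))) as [l2 L2].
  { apply (ex_series_le (fun n => Im (P (S n)) - Im (P n))%R (fun n => B * a n)%R); auto.
    intros n. eapply Rle_trans; [|apply K]. apply (im_le_Cmod (P (S n) - P n)). }
  exists (l1, l2). split; assumption.
Qed.

(** a_n <= 1/2 gives |P_n| <= 2 |P_(n+1)|, so the reciprocals satisfy the same estimate with 2 a_n
    and converge as well; the product of the two limits is 1. *)
Lemma product_converges_neq_0 (P : nat -> C) (a : nat -> R) :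
  (forall n, 0 <= a n <= / 2) -> ex_series a -> (forall n, P n <> 0) ->
  (forall n, Cmod (P (S n) - P n) <= a n * Cmod (P n)) ->
  exists l : C, l <> 0 /\ is_Clim P l.
Proof.
  intros Pa Ha Nz HP.
  destruct (product_converges P a) as [l Hl]; auto. { intros n; apply Pa. }
  destruct (product_converges (fun n => / P n) (fun n => 2 * a n)%R) as [m Hm].
  - intros n. specialize (Pa n). lra.
  - now apply (ex_series_scal 2 a).
  - intros n.
    replace (/ P (S n) - / P n) with (- (P (S n) - P n) / (P n * P (S n))) by (field; auto).
    rewrite Cmod_div, Cmod_opp, Cmod_mult, Cmod_inv by auto using Cmult_neq_0.
    pose proof (proj1 (Cmod_gt_0 (P n)) (Nz n)) as P0.
    pose proof (proj1 (Cmod_gt_0 (P (S n))) (Nz (S n))) as P1.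
    specialize (Pa n). specialize (HP n).
    pose proof (Cmod_triangle (P n - P (S n)) (P (S n))) as T.
    replace (P n - P (S n) + P (S n)) with (P n) in T by ring.
    replace (P n - P (S n)) with (- (P (S n) - P n)) in T by ring. rewrite Cmod_opp in T.
    assert (H2 : Cmod (P n) <= 2 * Cmod (P (S n))) by nra.
    apply Rmult_le_reg_r with (Cmod (P n) * Cmod (P (S n)))%R. apply Rmult_lt_0_compat; lra.
    replace (Cmod (P (S n) - P n) / (Cmod (P n) * Cmod (P (S n))) * (Cmod (P n) * Cmod (P (S n))))%R
      with (Cmod (P (S n) - P n)) by (field; lra).
    replace (2 * a n * / Cmod (P n) * (Cmod (P n) * Cmod (P (S n))))%R
      with (a n * (2 * Cmod (P (S n))))%R by (field; lra).
    eapply Rle_trans. exact HP. apply Rmult_le_compat_l; lra.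
  - exists l. split; auto. intros E. rewrite E in Hl.
    pose proof (is_Clim_mult _ _ _ _ Hl Hm) as H1. rewrite Cmult_0_l in H1.
    apply (is_Clim_ext_loc _ (fun _ => 1) _ 0) in H1.
    + apply C1_nz. apply (is_Clim_unique (fun _ => 1)); auto. apply is_Clim_const.
    + intros n _. field. auto.
Qed.

(** [Cder_exp_0] gives no rate, and summability of the increments of Gauss' sequence needs one. The
    real and imaginary parts contribute 7/2 and 9/2; 10 is a round bound. *)
Lemma Cexp_second_order (w : C) : Cmod w <= / 2 -> Cmod (Cexp w - 1 - w) <= 10 * Cmod w ^ 2.
Proof.
  intros Hw. pose proof (re_le_Cmod w) as Rx. pose proof (im_le_Cmod w) as Ry.
  destruct w as [x y]. simpl in Rx, Ry. set (c := Cmod (x, y)) in *.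
  assert (Bx : - / 2 <= x <= / 2) by (apply Rabs_le_between; lra).
  assert (Pc : 0 <= c) by apply Cmod_ge_0.
  pose proof (Rabs_pos x). pose proof (Rabs_pos y).
  assert (X2 : x * x <= c ^ 2).
  { replace (x * x)%R with (Rabs x * Rabs x)%R by (rewrite <- Rabs_mult; apply Rabs_pos_eq; nra). nra. }
  assert (Y2 : y * y <= c ^ 2).
  { replace (y * y)%R with (Rabs y * Rabs y)%R by (rewrite <- Rabs_mult; apply Rabs_pos_eq; nra). nra. }
  assert (E1 : 0 <= exp x - 1 - x <= 2 * (x * x)).
  { pose proof (exp_ineq1_le x). pose proof (exp_ineq1_le (- x)) as En. split. lra.
    rewrite exp_Ropp in En. pose proof (exp_pos x) as Ep.
    assert (exp x * (1 - x) <= 1).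
    { replace 1%R with (exp x * / exp x)%R at 2 by (field; lra). apply Rmult_le_compat_l; lra. }
    assert (1 <= (1 + x + 2 * (x * x)) * (1 - x)) by nra.
    assert (exp x <= 1 + x + 2 * (x * x)).
    { apply Rmult_le_reg_r with (1 - x)%R; lra. }
    lra. }
  assert (E2 : forall u, Rabs (sin u) <= Rabs u).
  { intros u. destruct (MVT_gen sin 0 u cos) as [k [_ Hk]].
    - intros t _. apply is_derive_sin.
    - intros t _. apply continuity_sin.
    - rewrite sin_0, !Rminus_0_r in Hk. rewrite Hk, Rabs_mult.
      pose proof (COS_bound k). assert (Rabs (cos k) <= 1) by (apply Rabs_le; lra).
      pose proof (Rabs_pos u). nra. }
  assert (E3 : forall u, Rabs (cos u - 1) <= u * u).
  { intros u. replace (cos u) with (cos (2 * (u / 2))) by (f_equal; field). rewrite cos_2a_sin.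
    replace (1 - 2 * sin (u / 2) * sin (u / 2) - 1)%R with (- (2 * (sin (u / 2) * sin (u / 2))))%R by ring.
    rewrite Rabs_Ropp, !Rabs_mult. rewrite (Rabs_pos_eq 2) by lra.
    pose proof (E2 (u / 2)%R) as S. pose proof (Rabs_pos (sin (u / 2))).
    assert (Rabs (u / 2) * Rabs (u / 2) = u * u / 4)%R.
    { rewrite <- Rabs_mult. rewrite Rabs_pos_eq by nra. field. }
    nra. }
  assert (E4 : Rabs (sin y - y) <= y * y).
  { destruct (MVT_gen (fun u => sin u - u)%R 0 y (fun u => cos u - 1)%R) as [k [Bk Hk]].
    - intros t _. auto_derive; auto. ring.
    - intros t _. apply continuity_pt_minus. apply continuity_sin. apply derivable_continuous_pt, derivable_pt_id.
    - rewrite sin_0, !Rminus_0_r in Hk. rewrite Hk, Rabs_mult.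
      assert (Kk : Rabs k <= Rabs y).
      { unfold Rmin, Rmax in Bk. destruct (Rle_dec 0 y).
        rewrite !Rabs_pos_eq; lra. rewrite !Rabs_left1; lra. }
      pose proof (E3 k) as S. pose proof (Rabs_pos k). pose proof (Rabs_pos (cos k - 1)).
      replace (k * k)%R with (Rabs k * Rabs k)%R in S by (rewrite <- Rabs_mult; apply Rabs_pos_eq; nra).
      replace (y * y)%R with (Rabs y * Rabs y)%R by (rewrite <- Rabs_mult; apply Rabs_pos_eq; nra).
      nra. }
  eapply Rle_trans. apply Cmod_le_ReIm. unfold Cexp. simpl.
  replace (exp x * cos y + - (1) + - x)%R
    with ((exp x - 1 - x) * cos y + (1 + x) * (cos y - 1))%R by ring.
  replace (exp x * sin y + - 0 + - y)%R
    with ((exp x - 1 - x) * sin y + (1 + x) * (sin y - y) + x * y)%R by ring.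
  assert (B1 : Rabs (cos y) <= 1) by (apply Rabs_le; pose proof (COS_bound y); lra).
  assert (B2 : Rabs (sin y) <= 1) by (apply Rabs_le; pose proof (SIN_bound y); lra).
  assert (B3 : Rabs (1 + x) <= 3 / 2) by (apply Rabs_le; lra).
  pose proof (E3 y) as E3y.
  assert (B4 : Rabs (exp x - 1 - x) <= 2 * c ^ 2) by (apply Rabs_le; lra).
  assert (B5 : Rabs (x * y) <= c ^ 2) by (rewrite Rabs_mult; nra).
  assert (P2 : 0 <= c ^ 2) by apply pow2_ge_0.
  assert (T1 : Rabs ((exp x - 1 - x) * cos y + (1 + x) * (cos y - 1)) <= 2 * c ^ 2 * 1 + 3 / 2 * c ^ 2).
  { eapply Rle_trans. apply Rabs_triang. rewrite !Rabs_mult.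
    apply Rplus_le_compat; apply Rmult_le_compat; auto using Rabs_pos. lra. }
  assert (T2 : Rabs ((exp x - 1 - x) * sin y + (1 + x) * (sin y - y) + x * y)
    <= 2 * c ^ 2 * 1 + 3 / 2 * c ^ 2 + c ^ 2).
  { eapply Rle_trans. apply Rabs_triang. apply Rplus_le_compat; auto.
    eapply Rle_trans. apply Rabs_triang. rewrite !Rabs_mult.
    apply Rplus_le_compat; apply Rmult_le_compat; auto using Rabs_pos. lra. }
  lra.
Qed.

Lemma ln_succ_bounds (t : R) : 0 < t -> / (t + 1) <= ln (t + 1) - ln t <= / t.
Proof.
  intros Ht.
  assert (L : forall u, 0 < u -> ln u <= u - 1).
  { intros u Hu. pose proof (exp_ineq1_le (ln u)) as E. rewrite exp_ln in E; lra. }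
  pose proof (L ((t + 1) / t)%R ltac:(apply Rdiv_lt_0_compat; lra)) as L1.
  pose proof (L (t / (t + 1))%R ltac:(apply Rdiv_lt_0_compat; lra)) as L2.
  rewrite ln_div in L1, L2 by lra.
  replace ((t + 1) / t - 1)%R with (/ t)%R in L1 by (field; lra).
  replace (t / (t + 1) - 1)%R with (- / (t + 1))%R in L2 by (field; lra). lra.
Qed.

Lemma ex_series_inv_prod : ex_series (fun n => / (INR (S n) * INR (S (S n))))%R.
Proof.
  set (f := fun n => (/ (INR (S n) * INR (S (S n))))%R).
  assert (Sf : forall n, @eq R (sum_n f (S n)) (sum_n f n + f (S n))%R) by (intros; apply (sum_Sn (G := R_AbelianMonoid))).
  apply (ex_finite_lim_seq_incr (sum_n f) 1).
  - intros n. rewrite Sf.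
    assert (0 < f (S n)).
    { apply Rinv_0_lt_compat, Rmult_lt_0_compat; apply lt_0_INR; lia. }
    lra.
  - intros n.
    assert (E : @eq R (sum_n f n) (1 - / INR (S (S n)))%R).
    { induction n as [|n IH]. rewrite sum_O. unfold f. simpl. field.
      rewrite Sf, IH. unfold f.
      rewrite (S_INR (S (S n))). pose proof (lt_0_INR (S (S n)) ltac:(lia)). field. lra. }
    rewrite E. pose proof (Rinv_0_lt_compat _ (lt_0_INR (S (S n)) ltac:(lia))). lra.
Qed.

Lemma Gamma_seq_poch (z : C) (n : nat) :
  Gamma_seq z n = INR (fact n) * Cexp (z * ln (INR n)) / poch z (S n).
Proof. unfold Gamma_seq. f_equal. f_equal. induction (S n); simpl; congruence. Qed.

(** Consecutive terms have ratio (n+1) exp (z d) / (z+n+1) with d = ln (n+1) - ln n. Its distance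
    from 1 is split into the second-order error of the exponential and the error (n+1) d - 1 of the
    logarithm; both numerators are O(1/n), so the whole is O(1/n^2). *)
Lemma Gamma_seq_step (z : C) (n : nat) : not_nonpos_int z -> (1 <= n)%nat ->
  Gamma_seq z (S n) - Gamma_seq z n =
  ((INR n + 1) * (Cexp (z * (ln (INR n + 1) - ln (INR n))%R) - 1 - z * (ln (INR n + 1) - ln (INR n))%R)
   + z * ((INR n + 1) * (ln (INR n + 1) - ln (INR n)) - 1)%R) / (z + (INR n + 1)%R) * Gamma_seq z n.
Proof.
  intros Hz Hn. rewrite !Gamma_seq_poch, (poch_S z (S n)), fact_simpl, mult_INR, S_INR.
  pose proof (poch_neq_0 z (S n) Hz) as N1. pose proof (add_INR_neq_0 z (S n) Hz) as N2.
  rewrite S_INR in N2.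
  set (d := (ln (INR n + 1) - ln (INR n))%R).
  replace (z * ln (INR n + 1)) with (z * ln (INR n) + z * d) by (unfold d; rewrite RtoC_minus; ring).
  rewrite Cexp_plus. rewrite !RtoC_mult, RtoC_minus, RtoC_mult, !RtoC_plus in *.
  field. auto.
Qed.

Lemma Gamma_seq_neq_0 (z : C) (n : nat) : not_nonpos_int z -> Gamma_seq z n <> 0.
Proof.
  intros Hz. rewrite Gamma_seq_poch. pose proof (poch_neq_0 z (S n) Hz) as N.
  intros E. apply (Cmult_neq_0 (INR (fact n)) (Cexp (z * ln (INR n)))).
  apply Cfact_neq_0. apply Cexp_neq_0.
  replace (INR (fact n) * Cexp (z * ln (INR n)))
    with (INR (fact n) * Cexp (z * ln (INR n)) / poch z (S n) * poch z (S n)) by (field; auto).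
  rewrite E. ring.
Qed.

(** 2 |z| + 1 <= n gives |z|/n <= 1/2, as the bound on the exponential requires, and |z+n+1| >=
    (n+1)/2. The latter doubles the numerator bounds 40 |z|^2 / n and |z| / n, where 40 is 10 times
    the crude bound 4 for (n+1)/n. *)
Lemma Gamma_seq_step_bound (z : C) (n : nat) : not_nonpos_int z ->
  1 <= INR n -> 2 * Cmod z + 1 <= INR n ->
  Cmod (Gamma_seq z (S n) - Gamma_seq z n)
   <= (80 * Cmod z ^ 2 + 2 * Cmod z) * / (INR n * (INR n + 1)) * Cmod (Gamma_seq z n).
Proof.
  intros Hz H1 H2. assert (Hn : (1 <= n)%nat) by (apply INR_le; exact H1).
  rewrite Gamma_seq_step by auto. rewrite Cmod_mult. apply Rmult_le_compat_r. apply Cmod_ge_0.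
  set (t := INR n) in *. pose proof (ln_succ_bounds t ltac:(lra)) as [D1 D2].
  set (d := (ln (t + 1) - ln t)%R) in *. set (c := Cmod z) in *.
  assert (Pc : 0 <= c) by apply Cmod_ge_0.
  pose proof (Rinv_0_lt_compat t ltac:(lra)) as It. pose proof (Rinv_0_lt_compat (t + 1) ltac:(lra)) as It1.
  assert (Et : (t * / t = 1)%R) by (field; lra).
  assert (Ew : Cmod (z * d) <= c * / t).
  { rewrite Cmod_mult, Cmod_R, Rabs_pos_eq by lra. apply Rmult_le_compat_l; auto. }
  assert (Ct : c * / t <= / 2) by nra.
  pose proof (Cexp_second_order (z * d) ltac:(lra)) as So.
  assert (So' : Cmod (Cexp (z * d) - 1 - z * d) <= 10 * (c * / t) ^ 2).
  { eapply Rle_trans. exact So. apply Rmult_le_compat_l. lra. apply pow_incr. split; auto. apply Cmod_ge_0. }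
  assert (Dn : (t + 1) / 2 <= Cmod (z + (t + 1)%R)).
  { pose proof (Cmod_triangle (z + (t + 1)%R) (- z)) as T.
    replace (z + (t + 1)%R + - z) with (RtoC (t + 1)) in T by ring.
    rewrite Cmod_opp, Cmod_R, Rabs_pos_eq in T by lra. fold c in T. lra. }
  assert (Nz : z + (t + 1)%R <> 0) by (apply Cmod_gt_0; lra).
  rewrite Cmod_div by exact Nz.
  assert (Num : Cmod ((t + 1) * (Cexp (z * d) - 1 - z * d) + z * ((t + 1) * d - 1)%R)
    <= (t + 1) * (10 * (c * / t) ^ 2) + c * / t).
  { eapply Rle_trans. apply Cmod_triangle. rewrite !Cmod_mult.
    rewrite <- RtoC_plus, !Cmod_R, (Rabs_pos_eq (t + 1)) by lra.
    apply Rplus_le_compat. apply Rmult_le_compat_l; auto; lra.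
    apply Rmult_le_compat_l; auto.
    assert (Z1 : (t + 1) * / (t + 1) <= (t + 1) * d) by (apply Rmult_le_compat_l; lra).
    rewrite Rinv_r in Z1 by lra.
    assert (Z2 : (t + 1) * d <= (t + 1) * / t) by (apply Rmult_le_compat_l; lra).
    apply Rabs_le. split; nra. }
  apply Rmult_le_reg_r with (Cmod (z + (t + 1)%R)). lra.
  unfold Rdiv at 1. rewrite Rmult_assoc, Rinv_l, Rmult_1_r by lra.
  eapply Rle_trans. exact Num.
  apply Rle_trans with ((80 * c ^ 2 + 2 * c) * / (t * (t + 1)) * ((t + 1) / 2))%R.
  - replace ((80 * c ^ 2 + 2 * c) * / (t * (t + 1)) * ((t + 1) / 2))%R
      with (40 * c ^ 2 * / t + c * / t)%R by (field; lra).
    apply Rplus_le_compat_r.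
    replace ((t + 1) * (10 * (c * / t) ^ 2))%R with (10 * c ^ 2 * / t * ((t + 1) * / t))%R by ring.
    replace (40 * c ^ 2 * / t)%R with (10 * c ^ 2 * / t * 4)%R by ring.
    apply Rmult_le_compat_l. apply Rmult_le_pos; [|lra]. pose proof (pow2_ge_0 c); lra.
    nra.
  - apply Rmult_le_compat_l; auto. apply Rmult_le_pos. pose proof (pow2_ge_0 c); lra.
    left. apply Rinv_0_lt_compat, Rmult_lt_0_compat; lra.
Qed.

(** [CGamma] rests on the total [Lim_seq] and says nothing until convergence is known. The sequence
    is an infinite product of its ratios, started so late that each relative step is at most 1/2. *)
Lemma CGamma_lim (z : C) : not_nonpos_int z ->
  CGamma z <> 0 /\ is_Clim (Gamma_seq z) (CGamma z).
Proof.
  intros Hz. set (K := (80 * Cmod z ^ 2 + 2 * Cmod z)%R).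
  assert (PK : 0 <= K) by (unfold K; pose proof (pow2_ge_0 (Cmod z)); pose proof (Cmod_ge_0 z); lra).
  destruct (INR_unbounded (2 * Cmod z + 2 * K + 1)) as [N HN]. pose proof (Cmod_ge_0 z).
  assert (HS : forall n, (INR (S N + n) = INR (S N) + INR n)%R) by (intros; apply plus_INR).
  rewrite S_INR in HS.
  destruct (product_converges_neq_0 (fun n => Gamma_seq z (S N + n))
     (fun n => K * / (INR (S N + n) * (INR (S N + n) + 1)))%R) as [l [Nl Hl]].
  - intros n. specialize (HS n). pose proof (pos_INR n).
    set (t := INR (S N + n)) in *.
    assert (P : 0 < t * (t + 1)) by (apply Rmult_lt_0_compat; lra). split.
    + apply Rmult_le_pos; auto. left. now apply Rinv_0_lt_compat.
    + apply Rmult_le_reg_r with (t * (t + 1))%R; auto. rewrite Rmult_assoc, Rinv_l by lra. nra.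
  - apply (ex_series_scal K (fun n => / (INR (S N + n) * (INR (S N + n) + 1)))%R).
    apply (ex_series_ext (fun n => / (INR (S (N + n)) * INR (S (S (N + n)))))%R).
    { intros n. rewrite (S_INR (S (N + n))). reflexivity. }
    apply (ex_series_incr_n (fun n => / (INR (S n) * INR (S (S n))))%R N). apply ex_series_inv_prod.
  - intros n. now apply Gamma_seq_neq_0.
  - intros n. specialize (HS n). pose proof (pos_INR n).
    rewrite Nat.add_succ_r. apply Gamma_seq_step_bound; auto; lra.
  - assert (L : is_Clim (Gamma_seq z) l).
    { destruct Hl as [A B]. split.
      - apply (is_lim_seq_incr_n (fun n => Re (Gamma_seq z n)) (S N)).
        apply is_lim_seq_ext with (2 := A). intros n. f_equal. f_equal. lia.
      - apply (is_lim_seq_incr_n (fun n => Im (Gamma_seq z n)) (S N)).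
        apply is_lim_seq_ext with (2 := B). intros n. f_equal. f_equal. lia. }
    assert (E : CGamma z = l).
    { unfold CGamma. destruct L as [A B].
      apply is_lim_seq_unique in A. apply is_lim_seq_unique in B. rewrite A, B. now destruct l. }
    rewrite E. auto.
Qed.

Lemma CGamma_neq_0 (z : C) : not_nonpos_int z -> CGamma z <> 0.
Proof. intros Hz. now apply CGamma_lim. Qed.

(** At each stage n >= 1 the sequence at z + 1 is z n / (z + n + 1) times the sequence at z, and n /
    (z + n + 1) tends to 1. *)
Lemma CGamma_succ (z : C) : not_nonpos_int z -> CGamma (z + 1) = z * CGamma z.
Proof.
  intros Hz. pose proof (not_nonpos_int_add z 1 Hz) as Hz1. simpl in Hz1.
  destruct (CGamma_lim z Hz) as [_ L]. destruct (CGamma_lim _ Hz1) as [_ L1].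
  apply (is_Clim_unique _ _ _ L1).
  assert (Q : is_Clim (fun n => INR n / (z + INR (S n))) 1).
  { destruct (INR_unbounded (2 * Cmod z + 1)) as [N HN]. pose proof (Cmod_ge_0 z).
    apply is_Clim_dist with (fun n => 2 * Cmod (z + 1) * / INR n)%R N.
    - intros n Hn. apply le_INR in Hn.
      pose proof (add_INR_neq_0 z (S n) Hz) as Nz.
      replace (INR n / (z + INR (S n)) - 1) with (- (z + 1) / (z + INR (S n)))
        by (rewrite S_INR, RtoC_plus in *; field; auto).
      rewrite Cmod_div, Cmod_opp by exact Nz.
      pose proof (Cmod_triangle (z + INR (S n)) (- z)) as T.
      replace (z + INR (S n) + - z) with (RtoC (INR (S n))) in T by ring.
      rewrite Cmod_opp, Cmod_R, Rabs_pos_eq in T by apply pos_INR. rewrite S_INR in T at 1.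
      assert (D : INR n / 2 <= Cmod (z + INR (S n))) by lra.
      replace (2 * Cmod (z + 1) * / INR n)%R with (Cmod (z + 1) * / (INR n / 2))%R by (field; lra).
      apply Rmult_le_compat_l. apply Cmod_ge_0. apply Rinv_le_contravar; lra.
    - replace 0%R with (2 * Cmod (z + 1) * 0)%R by ring.
      apply (is_lim_seq_scal_l (fun n => / INR n)%R (2 * Cmod (z + 1))%R 0%R).
      replace (Finite 0) with (Rbar_inv p_infty) by reflexivity.
      apply is_lim_seq_inv. apply is_lim_seq_INR. discriminate. }
  replace (z * CGamma z) with (z * CGamma z * 1) by ring.
  apply (is_Clim_ext_loc (fun n => z * Gamma_seq z n * (INR n / (z + INR (S n)))) _ _ 1).
  - intros n Hn. rewrite !Gamma_seq_poch.
    pose proof (add_INR_neq_0 z (S n) Hz) as Nz. pose proof (poch_neq_0 z (S n) Hz) as N1.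
    pose proof (poch_neq_0 _ (S n) Hz1) as N2.
    assert (E : poch (z + 1) (S n) * z = poch z (S n) * (z + INR (S n))).
    { rewrite <- poch_S. change (S (S n)) with (1 + S n)%nat. rewrite poch_add. simpl. ring. }
    assert (Nzz : z <> 0) by (intros Z; apply (Hz 0%nat); rewrite Z; simpl; now rewrite Ropp_0).
    replace (Cexp ((z + 1) * ln (INR n))) with (Cexp (z * ln (INR n)) * INR n).
    2: { replace ((z + 1) * ln (INR n)) with (z * ln (INR n) + ln (INR n)) by ring.
      rewrite Cexp_plus. f_equal. unfold Cexp. simpl. rewrite cos_0, sin_0.
      rewrite exp_ln by (apply lt_0_INR; lia). apply C_ext; simpl; ring. }
    replace (poch (z + 1) (S n)) with (poch z (S n) * (z + INR (S n)) / z)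
      by (rewrite <- E; field; auto).
    field. auto.
  - apply is_Clim_mult; auto. apply is_Clim_mult; auto. apply is_Clim_const.
Qed.

Lemma CGamma_poch (z : C) (n : nat) : not_nonpos_int z ->
  CGamma (z + INR n) = poch z n * CGamma z.
Proof.
  intros Hz. induction n as [|n IH].
  - simpl. rewrite Cplus_0_r. ring.
  - rewrite S_INR, RtoC_plus, Cplus_assoc, CGamma_succ by now apply not_nonpos_int_add.
    rewrite IH. simpl. ring.
Qed.


(** * Partial fractions, Stirling numbers and Pochhammer symbols *)

Lemma csum_ext (n : nat) (f g : nat -> C) :
  (forall k, (k < n)%nat -> f k = g k) -> csum n f = csum n g.
Proof.
  induction n as [|n IH]; intros H; simpl; auto. rewrite IH, H; auto.
Qed.

Lemma csum_plus (n : nat) (f g : nat -> C) :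
  csum n (fun k => f k + g k) = csum n f + csum n g.
Proof. induction n as [|n IH]; simpl. ring. rewrite IH. ring. Qed.

Lemma csum_scal (c : C) (n : nat) (f : nat -> C) : c * csum n f = csum n (fun k => c * f k).
Proof. induction n as [|n IH]; simpl. ring. rewrite <- IH. ring. Qed.

Lemma csum_swap (n p : nat) (f : nat -> nat -> C) :
  csum n (fun i => csum p (fun j => f i j)) = csum p (fun j => csum n (fun i => f i j)).
Proof.
  induction n as [|n IH]; simpl.
  - induction p as [|p IHp]; simpl; auto. rewrite <- IHp. ring.
  - rewrite IH, <- csum_plus. reflexivity.
Qed.

Lemma csum_first (n : nat) (f : nat -> C) : csum (S n) f = f 0%nat + csum n (fun k => f (S k)).
Proof. induction n as [|n IH]; simpl in *. ring. rewrite IH. ring. Qed.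

Lemma cprod_ext (n : nat) (f g : nat -> C) :
  (forall k, (k < n)%nat -> f k = g k) -> cprod n f = cprod n g.
Proof. induction n as [|n IH]; intros H; simpl; auto. rewrite IH, H; auto. Qed.

Lemma cprod_mult (n : nat) (f g : nat -> C) :
  cprod n (fun k => f k * g k) = cprod n f * cprod n g.
Proof. induction n as [|n IH]; simpl. ring. rewrite IH. ring. Qed.

Lemma cprod_neq_0 (n : nat) (f : nat -> C) :
  (forall k, (k < n)%nat -> f k <> 0) -> cprod n f <> 0.
Proof.
  induction n as [|n IH]; intros H; simpl. apply C1_nz. apply Cmult_neq_0; auto.
Qed.

(** For q < p, the residue of 1 / (z)_p at z = -q. *)
Definition pfcoef (p q : nat) : C :=
  RtoC (-1) ^ q / (INR (fact q) * INR (fact (p - S q))).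

Lemma pfcoef_sub (p q : nat) : (q < p)%nat ->
  (INR p - INR q) * pfcoef (S p) q = pfcoef p q.
Proof.
  intros H. unfold pfcoef. replace (S p - S q)%nat with (S (p - S q)) by lia.
  rewrite fact_simpl, mult_INR, RtoC_mult, <- RtoC_minus, <- minus_INR by lia.
  replace (p - q)%nat with (S (p - S q)) by lia.
  field. repeat split; auto using Cfact_neq_0, CINR_S_neq_0.
Qed.

Lemma pfcoef_pred (p q : nat) : INR (S q) * pfcoef (S p) (S q) = - pfcoef p q.
Proof.
  unfold pfcoef. change (S p - S (S q))%nat with (p - S q)%nat. rewrite fact_simpl, mult_INR, RtoC_mult, Cpow_S.
  replace (RtoC (-1)) with (- (1)) by (rewrite <- RtoC_opp; reflexivity).
  field. repeat split; auto using Cfact_neq_0, CINR_S_neq_0.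
Qed.

(** Induction through p / (z)_(p+1) = 1 / (z)_p - 1 / (z+1)_p. On the side of the sum the factor p
    is split as (p - q) + q, and the two halves are the two expansions by [pfcoef_sub] and
    [pfcoef_pred]. *)
Lemma partial_fractions (p : nat) (z : C) : (1 <= p)%nat -> not_nonpos_int z ->
  / poch z p = csum p (fun q => pfcoef p q / (z + INR q)).
Proof.
  intros Hp. revert z. induction Hp as [|p Hp IH]; intros z Hz.
  - pose proof (add_INR_neq_0 z 0 Hz) as N. unfold pfcoef. simpl in *. field. rewrite Cplus_0_r in *. exact N.
  - assert (Np : RtoC (INR p) <> 0).
    { intros E. apply RtoC_inj in E. apply (not_0_INR p); auto. lia. }
    pose proof (not_nonpos_int_add z 1 Hz) as Hz1. simpl in Hz1.
    apply (Cmult_cancel_l (INR p)); auto.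
    transitivity (/ poch z p - / poch (z + 1) p).
    + assert (E : poch (z + 1) p * z = poch z p * (z + INR p)).
      { rewrite <- poch_S. change (S p) with (1 + p)%nat. rewrite poch_add. simpl. ring. }
      assert (Nz : z <> 0) by (intros Z; apply (Hz 0%nat); rewrite Z; simpl; now rewrite Ropp_0).
      pose proof (poch_neq_0 z p Hz) as N1. pose proof (add_INR_neq_0 z p Hz) as N2.
      replace (poch (z + 1) p) with (poch z p * (z + INR p) / z) by (rewrite <- E; field; auto).
      rewrite poch_S. field. auto.
    + rewrite IH, IH by auto.
      transitivity (csum (S p) (fun q => (INR p - INR q) * pfcoef (S p) q / (z + INR q))
        + csum (S p) (fun q => INR q * pfcoef (S p) q / (z + INR q))).
      2: { rewrite <- csum_plus, csum_scal. apply csum_ext. intros q _. field.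
           now apply add_INR_neq_0. }
      rewrite (csum_first p (fun q => INR q * pfcoef (S p) q / (z + INR q))).
      simpl csum at 3.
      replace ((INR p - INR p) * pfcoef (S p) p / (z + INR p)) with (RtoC 0)
        by (unfold Cdiv; ring).
      replace (INR 0 * pfcoef (S p) 0 / (z + INR 0)) with (RtoC 0) by (simpl INR; unfold Cdiv; ring).
      rewrite Cplus_0_r, Cplus_0_l.
      unfold Cminus at 1. f_equal.
      * apply csum_ext. intros q Hq. now rewrite pfcoef_sub.
      * replace (- csum p (fun q => pfcoef p q / (z + 1 + INR q)))
          with (- (1) * csum p (fun q => pfcoef p q / (z + 1 + INR q))) by ring.
        rewrite csum_scal. apply csum_ext. intros q _. rewrite pfcoef_pred, S_INR, RtoC_plus.
        replace (z + (INR q + 1)) with (z + 1 + INR q) by ring. unfold Cdiv. ring.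
Qed.

(** * Powers in falling factorials and their generating series *)

Fixpoint falling (x : C) (l : nat) : C :=
  match l with O => 1 | S l' => falling x l' * (x - INR l') end.

Lemma stirling2_small (k l : nat) : (k < l)%nat -> stirling2 k l = 0%nat.
Proof.
  revert l. induction k as [|k IH]; intros [|l] H; try lia; simpl; auto.
  rewrite !IH by lia. lia.
Qed.

(** The terms with l > k vanish, so one bound M serves all exponents k < M and the sums over k and l
    can be exchanged. *)
Lemma pow_stirling (x : C) (k M : nat) : (k < M)%nat ->
  x ^ k = csum M (fun l => INR (stirling2 k l) * falling x l).
Proof.
  revert M. induction k as [|k IH]; intros [|M] H; try lia.
  - rewrite csum_first. simpl. replace (csum M _) with (RtoC 0). ring.
    clear H. induction M; simpl; auto. rewrite <- IHM. ring.
  - rewrite csum_first. rewrite Cpow_S, (IH (S M)), csum_scal by lia.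
    transitivity (csum (S M) (fun l => INR (stirling2 k l) * falling x (S l))
      + csum (S M) (fun l => INR l * INR (stirling2 k l) * falling x l)).
    { rewrite <- csum_plus. apply csum_ext. intros l _. simpl. ring. }
    rewrite (csum_first M (fun l => INR l * INR (stirling2 k l) * falling x l)).
    assert (Es : csum (S M) (fun l => INR (stirling2 k l) * falling x (S l))
      = csum M (fun l => INR (stirling2 k l) * falling x (S l))).
    { cbn [csum]. rewrite (stirling2_small k M) by lia. simpl INR. ring. }
    rewrite Es. change (INR 0) with 0%R. rewrite !Cmult_0_l, !Cplus_0_l.
    rewrite <- csum_plus. apply csum_ext. intros l _.
    change (stirling2 (S k) (S l)) with (S l * stirling2 k (S l) + stirling2 k l)%nat.
    rewrite plus_INR, mult_INR, RtoC_plus, RtoC_mult. ring.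
Qed.

Lemma falling_small (k l : nat) : (k < l)%nat -> falling (INR k) l = 0.
Proof.
  induction l as [|l IH]; intros H. lia. simpl.
  destruct (Nat.eq_dec k l) as [->|N]. ring. rewrite IH by lia. ring.
Qed.

Lemma falling_fact (l j : nat) : falling (INR (l + j)) l * INR (fact j) = INR (fact (l + j)).
Proof.
  revert j. induction l as [|l IH]; intros j. simpl. ring.
  replace (S l + j)%nat with (l + S j)%nat by lia. rewrite <- IH. simpl falling.
  rewrite fact_simpl, mult_INR, RtoC_mult.
  replace (INR (l + S j) - INR l) with (RtoC (INR (S j))) by (rewrite plus_INR, RtoC_plus; ring).
  ring.
Qed.

Lemma radius_ge_1_bin_falling (a : C) (l : nat) : radius_ge_1 (fun n => bin a n * falling (INR n) l).
Proof.
  induction l as [|l IH].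
  - apply radius_ge_1_ext with (bin a). intros; simpl; ring. apply radius_ge_1_bin.
  - apply radius_ge_1_ext with (fun n => INR n * (bin a n * falling (INR n) l)
      + - INR l * (bin a n * falling (INR n) l)).
    intros n. simpl. ring.
    apply radius_ge_1_plus. now apply radius_ge_1_mult_INR. now apply radius_ge_1_scal.
Qed.

(** The terms below l vanish, and the falling factorial turns (a)_(l+j) / (l+j)! into (a)_l (a+l)_j
    / j!. *)
Lemma bin_falling_series (a x : C) (l : nat) : Cmod x < 1 ->
  CPS (fun n => bin a n * falling (INR n) l) x = poch a l * x ^ l * binser (a + INR l) x.
Proof.
  intros Hx. unfold CPS. rewrite (CSeries_incr_n_aux _ l).
  - unfold binser, CPS. rewrite <- CSeries_scal by (apply radius_ge_1_summable; auto using radius_ge_1_bin).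
    apply CSeries_ext. intros j. unfold bin. rewrite poch_add, Cpow_add_r, <- falling_fact.
    assert (N : falling (INR (l + j)) l <> 0).
    { intros E. pose proof (falling_fact l j) as F. rewrite E, Cmult_0_l in F.
      symmetry in F. now apply Cfact_neq_0 in F. }
    field. split; auto using Cfact_neq_0.
  - intros k Hk. rewrite falling_small by exact Hk. ring.
Qed.

Lemma binser_add_INR (a x : C) (l : nat) : Cmod x < 1 ->
  binser (a + INR l) x = binser a x / (1 - x) ^ l.
Proof.
  intros Hx. pose proof (sub_1_neq_0 x Hx) as N.
  induction l as [|l IH].
  - simpl. rewrite Cplus_0_r. field.
  - pose proof (binser_pred (a + INR (S l)) x Hx) as E.
    replace (a + INR (S l) - 1) with (a + INR l) in E by (rewrite S_INR, RtoC_plus; ring).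
    rewrite IH in E. apply (Cmult_cancel_l (1 - x)); auto. rewrite <- E, Cpow_S.
    field. split; auto. now apply Cpow_nz.
Qed.

Lemma radius_ge_1_bin_pow (a : C) (k : nat) : radius_ge_1 (fun n => bin a n * INR n ^ k).
Proof.
  induction k as [|k IH].
  - apply radius_ge_1_ext with (bin a). intros; simpl; ring. apply radius_ge_1_bin.
  - apply radius_ge_1_ext with (fun n => INR n * (bin a n * INR n ^ k)).
    intros n. simpl. ring. now apply radius_ge_1_mult_INR.
Qed.

Lemma bin_pow_series (a x : C) (k M : nat) : Cmod x < 1 -> (k < M)%nat ->
  CPS (fun n => bin a n * INR n ^ k) x
  = binser a x * csum M (fun l => INR (stirling2 k l) * (poch a l * x ^ l / (1 - x) ^ l)).
Proof.
  intros Hx Hk. pose proof (sub_1_neq_0 x Hx) as N.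
  rewrite (CPS_ext _ (fun n => csum M (fun l => INR (stirling2 k l) * (bin a n * falling (INR n) l)))).
  - rewrite (CPS_csum M (fun l n => INR (stirling2 k l) * (bin a n * falling (INR n) l))), csum_scal; auto.
    + apply csum_ext. intros l _.
      rewrite (CPS_scal _ (fun n => bin a n * falling (INR n) l)) by (auto; apply radius_ge_1_bin_falling).
      rewrite bin_falling_series, binser_add_INR by exact Hx. field. now apply Cpow_nz.
    + intros l _. apply (radius_ge_1_scal _ (fun n => bin a n * falling (INR n) l)). apply radius_ge_1_bin_falling.
  - intros n. rewrite (pow_stirling _ k M Hk), csum_scal. apply csum_ext. intros l _. ring.
Qed.

Lemma csum_Yfun (delta : C -> nat -> C) (M : nat) (beta : C) (h : nat -> C) :
  csum M (fun k => delta beta k * csum M (fun l => INR (stirling2 k l) * h l))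
  = csum M (fun l => Yfun delta M beta l * h l).
Proof.
  rewrite (csum_ext M _ (fun k => csum M (fun l => delta beta k * (INR (stirling2 k l) * h l))))
    by (intros; now rewrite csum_scal).
  rewrite csum_swap. apply csum_ext. intros l _. unfold Yfun.
  rewrite Cmult_comm, csum_scal. apply csum_ext. intros k _.
  destruct (Nat.leb_spec l k) as [L|L]. ring. rewrite stirling2_small by exact L. simpl. ring.
Qed.

(** * Hypergeometric terms and parameters that come from roots *)

Lemma fold_poch_map (r : nat) (g : nat -> C) (n : nat) :
  fold_right Cmult 1 (map (fun u => poch u n) (map g (idx r))) = cprod r (fun i => poch (g i) n).
Proof.
  unfold idx. rewrite map_map.
  assert (A : forall l c, fold_right Cmult c l = fold_right Cmult 1 l * c).
  { induction l as [|u l IH]; intros c; simpl. ring. rewrite IH. ring. }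
  induction r as [|r IH]. reflexivity.
  rewrite seq_S, map_app, fold_right_app, A, IH. simpl. ring.
Qed.

Lemma vpoch_neq_0 (r : nat) (f : nat -> C) (m : nat -> nat) :
  (forall i, (i < r)%nat -> not_nonpos_int (f i)) -> vpoch r f m <> 0.
Proof. intros H. apply cprod_neq_0. intros i Hi. apply poch_neq_0. auto. Qed.

(** Both sides are the product of the (f_i)_(m_i + n). *)
Lemma vpoch_shift (r : nat) (f : nat -> C) (m : nat -> nat) (n : nat) :
  cprod r (fun i => poch (f i + Cnat (m i)) n) * vpoch r f m
  = cprod r (fun i => poch (f i) n) * vpoch r (fun i => f i + INR n) m.
Proof.
  unfold vpoch. rewrite <- !cprod_mult. apply cprod_ext. intros i _.
  rewrite <- poch_add, Cmult_comm. unfold Cnat. rewrite <- poch_add. f_equal. lia.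
Qed.

Lemma hyp_series_CPS (us ls : list C) (c : nat -> C) (z : C) :
  (forall n, hyp_term us ls z n = c n * z ^ n) -> hyp_series us ls z = CPS c z.
Proof. intros H. apply (CSeries_ext (hyp_term us ls z)). exact H. Qed.

Lemma poch_1 (n : nat) : poch 1 n = INR (fact n).
Proof.
  induction n as [|n IH]. reflexivity.
  rewrite poch_S, IH, fact_simpl, mult_INR, RtoC_mult, S_INR, RtoC_plus. ring.
Qed.

(** Telescoping gives (1 - lambda)_n (-lambda) = (-lambda)_n (n - lambda) for each root; the product
    over the roots carries P(n) / P(0) into the series. *)
Lemma roots_ratio (P : C -> C) (d : nat) (lam : nat -> C) : roots_of P d lam ->
  (forall i, (i < d)%nat -> forall k, lam i <> Cnat k) ->
  P 0 <> 0 /\ forall n,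
   cprod d (fun i => poch (- lam i) n) <> 0 /\
   P 0 * cprod d (fun i => poch (1 - lam i) n) = P (INR n) * cprod d (fun i => poch (- lam i) n).
Proof.
  intros [c [Hc HP]] Hl. rewrite HP. split.
  - apply Cmult_neq_0; auto. apply cprod_neq_0. intros i Hi E.
    apply (Hl i Hi 0%nat). unfold Cnat. simpl. replace (lam i) with (- (0 - lam i)) by ring. rewrite E. ring.
  - intros n. rewrite HP. split.
    + apply cprod_neq_0. intros i Hi. apply poch_neq_0. intros k E. apply (Hl i Hi k).
      unfold Cnat. replace (lam i) with (- - lam i) by ring. rewrite E, RtoC_opp. ring.
    + rewrite <- !Cmult_assoc, <- !cprod_mult. f_equal. apply cprod_ext. intros i _.
      pose proof (poch_add (- lam i) 1 n) as E1. pose proof (poch_S (- lam i) n) as E2.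
      change (1 + n)%nat with (S n) in E1. rewrite E2 in E1. simpl in E1.
      replace (1 - lam i) with (- lam i + 1) by ring.
      replace (INR n - lam i) with (- lam i + INR n) by ring.
      rewrite (Cmult_comm (- lam i + INR n)), E1. ring.
Qed.


(** * Decomposition of the series *)

Lemma Cdiv_neq_0 (z w : C) : z <> 0 -> w <> 0 -> z / w <> 0.
Proof. intros Hz Hw E. apply Hz. replace z with (z / w * w) by (field; auto). rewrite E. ring. Qed.

Lemma ex_derive_Cder (F : C -> C) (z : C) :
  ex_derive (K := C_AbsRing) F z -> exists L, Cder F z L.
Proof.
  intros [L [_ H]]. exists L. intros e Pe.
  specialize (H z (fun P HP => HP) (mkposreal e Pe)).
  destruct H as [d Hd]. exists d. split. apply cond_pos. intros h Hh.
  specialize (Hd (z + h)).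
  assert (B : ball (M := AbsRing_UniformSpace C_AbsRing) z d (z + h)).
  { unfold ball; simpl. unfold AbsRing_ball. unfold abs, minus, plus, opp; simpl.
    replace (z + h + - z) with h by ring. exact Hh. }
  specialize (Hd B).
  change (Cmod (F (z + h) - F z - (z + h - z) * L) <= e * Cmod (z + h - z)) in Hd.
  replace (z + h - z) with h in Hd by ring. rewrite (Cmult_comm L h).
  exact Hd.
Qed.

(** If z / (z - 1) were a real t >= 1, then z (t - 1) = t and |z| (t - 1) = t, impossible for |z| <
    1. *)
Lemma pfaff_arg_off_cut (z : C) : Cmod z < 1 ->
  ~ (Im (z / (z - 1)) = 0%R /\ 1 <= Re (z / (z - 1))).
Proof.
  intros Hz [H1 H2]. set (y := z / (z - 1)) in *.
  assert (N : z - 1 <> 0).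
  { intros E. apply (sub_1_neq_0 z Hz). replace (1 - z) with (- (z - 1)) by ring. rewrite E. ring. }
  assert (Ey : y = RtoC (Re y)) by (apply C_ext; simpl; auto).
  set (t := Re y) in *.
  assert (E : z * (t - 1)%R = t).
  { rewrite RtoC_minus, <- Ey. unfold y. field. exact N. }
  apply (f_equal Cmod) in E. rewrite Cmod_mult, !Cmod_R, !Rabs_pos_eq in E by lra.
  nra.
Qed.

Section Decomposition.

Variables (r : nat) (m : nat -> nat) (f : nat -> C) (a b : C) (p : nat).
Hypothesis Hp : (1 <= p)%nat.
Hypothesis Hf : forall i : nat, (i < r)%nat -> not_nonpos_int (f i).
Hypothesis Hb : not_nonpos_int b.

(** The residue at n = -(b+q) of (b)_p (f+n)_m / ((b+n)_p (f)_m) as a function of n. *)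
Definition pole_weight (q : nat) : C :=
  poch b p * pfcoef p q * (vpoch r (fun i => f i - (b + INR q)) m / vpoch r f m).

Lemma not_nonpos_int_beta (q : nat) : not_nonpos_int (b + INR q).
Proof. now apply not_nonpos_int_add. Qed.

Lemma beta_neq_0 (q : nat) : b + INR q <> 0.
Proof. now apply add_INR_neq_0. Qed.

Section Polynomial.

Variable delta : C -> nat -> C.
Hypothesis Hdelta : W_coeffs r f m (nsum r m) delta.

Lemma hyp_term_decomposition (x : C) (n : nat) :
  hyp_term (a :: b :: map (fun i => f i + Cnat (m i)) (idx r)) ((b + Cnat p) :: map f (idx r)) x n
  = csum p (fun q => poch b p * pfcoef p q * / (b + INR q)
       * csum (nsum r m) (fun k => delta (b + INR q) k * (bin a n * INR n ^ k))
     + pole_weight q * Ucoef a (b + INR q) n) * x ^ n.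
Proof.
  set (v := vpoch r (fun i => f i + INR n) m).
  pose proof (vpoch_neq_0 r f m Hf) as Nv.
  rewrite (csum_ext p _ (fun q => bin a n * poch b p * v / vpoch r f m * (pfcoef p q / (b + INR n + INR q)))).
  (* With beta = b + q, the definition of [Wfun] gives W / beta + (f-beta)_m / ((f)_m (beta+n)) =
     (f+n)_m / ((f)_m (beta+n)): the polynomial and polar parts at one pole recombine before the sum
     over q is taken. *)
  2: { intros q Hq. unfold pole_weight, Ucoef.
    pose proof (beta_neq_0 q) as N1. pose proof (add_INR_neq_0 (b + INR q) n (not_nonpos_int_beta q)) as N2.
    pose proof (Hdelta (b + INR q) (INR n) N2) as W. unfold Wfun in W. fold v in W.
    rewrite (csum_ext (nsum r m) _ (fun k => bin a n * (delta (b + INR q) k * INR n ^ k))) by (intros; ring).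
    rewrite <- csum_scal, <- W.
    replace (b + INR n + INR q) with (b + INR q + INR n) by ring.
    field. auto. }
  rewrite <- csum_scal, <- partial_fractions by (auto using not_nonpos_int_add).
  unfold hyp_term. cbn [map fold_right]. rewrite !fold_poch_map.
  pose proof (vpoch_shift r f m n) as Sh. fold v in Sh.
  set (X := cprod r (fun i => poch (f i + Cnat (m i)) n)) in *.
  assert (NY : cprod r (fun i => poch (f i) n) <> 0).
  { apply cprod_neq_0. intros i Hi. apply poch_neq_0. auto. }
  set (Y := cprod r (fun i => poch (f i) n)) in *.
  assert (EX : X = Y * v / vpoch r f m) by (rewrite <- Sh; field; auto).
  assert (EB : poch b p * poch (b + INR p) n = poch b n * poch (b + INR n) p).
  { rewrite <- !poch_add. f_equal. lia. }
  pose proof (poch_neq_0 (b + INR p) n (not_nonpos_int_add b p Hb)) as N1.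
  pose proof (poch_neq_0 (b + INR n) p (not_nonpos_int_add b n Hb)) as N2.
  assert (EB' : poch b n = poch b p * poch (b + INR p) n / poch (b + INR n) p)
    by (rewrite EB; field; auto).
  unfold Cnat. rewrite EX, EB'. unfold bin. field. repeat split; auto using Cfact_neq_0.
Qed.

Lemma hyp_series_decomposition (x : C) : Cmod x < 1 ->
  hyp_series (a :: b :: map (fun i => f i + Cnat (m i)) (idx r)) ((b + Cnat p) :: map f (idx r)) x
  = csum p (fun q => poch b p * pfcoef p q * / (b + INR q) * (binser a x *
      csum (nsum r m) (fun l => Yfun delta (nsum r m) (b + INR q) l * (poch a l * x ^ l / (1 - x) ^ l))))
    + csum p (fun q => pole_weight q * CPS (Ucoef a (b + INR q)) x).
Proof.
  intros Hx. rewrite (hyp_series_CPS _ _ _ _ (hyp_term_decomposition x)).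
  assert (G1 : forall q, radius_ge_1 (fun n => csum (nsum r m) (fun k => delta (b + INR q) k * (bin a n * INR n ^ k)))).
  { intros q. apply (radius_ge_1_csum (nsum r m) (fun k n => delta (b + INR q) k * (bin a n * INR n ^ k))).
    intros k _. apply (radius_ge_1_scal _ (fun n => bin a n * INR n ^ k)). apply radius_ge_1_bin_pow. }
  assert (G2 : forall q, radius_ge_1 (Ucoef a (b + INR q))) by (intros; apply radius_ge_1_Ucoef, not_nonpos_int_beta).
  rewrite (CPS_csum p (fun q n => poch b p * pfcoef p q * / (b + INR q)
       * csum (nsum r m) (fun k => delta (b + INR q) k * (bin a n * INR n ^ k))
     + pole_weight q * Ucoef a (b + INR q) n)); auto.
  2: { intros q _. apply radius_ge_1_plus; apply radius_ge_1_scal; auto. }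
  rewrite <- csum_plus. apply csum_ext. intros q _.
  rewrite (CPS_plus (fun n => poch b p * pfcoef p q * / (b + INR q)
       * csum (nsum r m) (fun k => delta (b + INR q) k * (bin a n * INR n ^ k)))
     (fun n => pole_weight q * Ucoef a (b + INR q) n)); auto using radius_ge_1_scal.
  rewrite (CPS_scal (pole_weight q)) by auto.
  rewrite (CPS_scal _ _ _ (G1 q) Hx). f_equal. f_equal.
  rewrite (CPS_csum (nsum r m) (fun k n => delta (b + INR q) k * (bin a n * INR n ^ k))); auto.
  2: { intros k _. apply (radius_ge_1_scal _ (fun n => bin a n * INR n ^ k)). apply radius_ge_1_bin_pow. }
  rewrite <- csum_Yfun, csum_scal. apply csum_ext. intros k Hk.
  rewrite (CPS_scal _ (fun n => bin a n * INR n ^ k)) by (auto; apply radius_ge_1_bin_pow).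
  rewrite (bin_pow_series a x k (nsum r m)) by auto. ring.
Qed.

End Polynomial.

(* The two reduced series share the coefficient (u)_n times a combination of 1/(b+q)_{n+1};
   putting these over the common denominator (b+p)_n gives the polynomial [Tpoly] or [Tstar]. *)
Lemma poch_common_denominator (q n : nat) : (q < p)%nat ->
  poch b q * poch (b + INR (S q) + INR n) (p - S q) / poch (b + INR p) n
  = poch b p / poch (b + INR q) (S n).
Proof.
  intros Hq.
  assert (E : poch b q * poch (b + INR q) (S n) * poch (b + INR (S q) + INR n) (p - S q)
    = poch b p * poch (b + INR p) n).
  { rewrite <- !poch_add.
    replace (b + INR (S q) + INR n) with (b + INR (q + S n))
      by (rewrite plus_INR, !S_INR, !RtoC_plus; ring).
    rewrite <- poch_add. f_equal. lia. }
  pose proof (poch_neq_0 (b + INR q) (S n) (not_nonpos_int_beta q)) as N1.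
  pose proof (poch_neq_0 (b + INR p) n (not_nonpos_int_add b p Hb)) as N2.
  replace (poch b p) with (poch b q * poch (b + INR q) (S n) * poch (b + INR (S q) + INR n) (p - S q)
    / poch (b + INR p) n) by (rewrite E; field; auto).
  field. auto.
Qed.

Lemma vpoch_arg (q : nat) :
  vpoch r (fun i => f i - b - INR (S q) + 1) m = vpoch r (fun i => f i - (b + INR q)) m.
Proof.
  apply cprod_ext. intros i _. f_equal. rewrite S_INR, RtoC_plus. ring.
Qed.

Lemma CGamma_arg (z : C) (q : nat) : not_nonpos_int z ->
  CGamma (z + INR (S q) - 1) = poch z q * CGamma z.
Proof.
  intros Hz. rewrite <- CGamma_poch by exact Hz. f_equal. rewrite S_INR, RtoC_plus. ring.
Qed.

(** Gamma(b+q) = (b)_q Gamma(b) supplies the factor (b)_q that [poch_common_denominator] needs; q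
    counts from 0 here and from 1 inside [Tpoly]. *)
Lemma Tpoly_coef (n : nat) :
  Tpoly r f m b p (INR n) / (CGamma b * vpoch r f m) * (poch a n / poch (b + INR p) n)
  = csum p (fun q => pole_weight q * Vcoef a (b + INR q) n).
Proof.
  unfold Tpoly. pose proof (vpoch_neq_0 r f m Hf) as Nv. pose proof (CGamma_neq_0 b Hb) as Ng.
  set (T := csum p _).
  replace (T / (CGamma b * vpoch r f m) * (poch a n / poch (b + INR p) n))
    with (poch a n / (CGamma b * vpoch r f m * poch (b + INR p) n) * T).
  2: { pose proof (poch_neq_0 (b + INR p) n (not_nonpos_int_add b p Hb)). field. auto. }
  unfold T. rewrite csum_scal. apply csum_ext. intros q Hq. cbv zeta.
  rewrite vpoch_arg, CGamma_arg by exact Hb. unfold pole_weight, Vcoef.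
  pose proof (poch_neq_0 (b + INR p) n (not_nonpos_int_add b p Hb)) as N2.
  replace (poch b p * pfcoef p q * (vpoch r (fun i => f i - (b + INR q)) m / vpoch r f m)
      * (poch a n / poch (b + INR q) (S n)))
    with (poch b p / poch (b + INR q) (S n) * (pfcoef p q
        * (vpoch r (fun i => f i - (b + INR q)) m / vpoch r f m) * poch a n))
    by (unfold Cdiv; ring).
  rewrite <- poch_common_denominator by exact Hq. unfold pfcoef.
  field. repeat split; auto using Cfact_neq_0.
Qed.

(** Euler's transformation leaves a numerator (c+q)_n, c = b+1-a, that depends on the pole. By (c)_q
    (c+q)_n = (c)_n (c+n)_q the common (c)_n comes out; (c+n)_q is the second Pochhammer factor of
    [Tstar], and (c)_q is absorbed by Gamma(c+q). *)
Lemma Tstar_coef (n : nat) : not_nonpos_int (b - a + 1) ->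
  CGamma (b - a + 1) * Tstar r f m a b p (INR n) / (CGamma b * vpoch r f m)
    * (poch (b + 1 - a) n / poch (b + INR p) n)
  = csum p (fun q => pole_weight q * Vcoef (b + INR q + 1 - a) (b + INR q) n).
Proof.
  intros Hc. unfold Tstar. pose proof (vpoch_neq_0 r f m Hf) as Nv. pose proof (CGamma_neq_0 b Hb) as Ng.
  pose proof (CGamma_neq_0 _ Hc) as Ngc.
  pose proof (poch_neq_0 (b + INR p) n (not_nonpos_int_add b p Hb)) as N2.
  set (T := csum p _).
  replace (CGamma (b - a + 1) * T / (CGamma b * vpoch r f m) * (poch (b + 1 - a) n / poch (b + INR p) n))
    with (CGamma (b - a + 1) * poch (b + 1 - a) n / (CGamma b * vpoch r f m * poch (b + INR p) n) * T)
    by (field; auto).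
  unfold T. rewrite csum_scal. apply csum_ext. intros q Hq. cbv zeta.
  rewrite vpoch_arg, CGamma_arg by exact Hb. unfold pole_weight, Vcoef.
  replace (CGamma (b + INR (S q) - a)) with (poch (b - a + 1) q * CGamma (b - a + 1)).
  2: { rewrite <- CGamma_poch by exact Hc. f_equal. rewrite S_INR, RtoC_plus. ring. }
  pose proof (poch_neq_0 _ q Hc) as N3.
  replace (b + 1 - a) with (b - a + 1) by ring.
  assert (E : poch (b - a + 1) n * poch (b - a + 1 + INR n) q
    = poch (b - a + 1) q * poch (b + INR q + 1 - a) n).
  { replace (b + INR q + 1 - a) with (b - a + 1 + INR q) by ring. rewrite <- !poch_add. f_equal. lia. }
  replace (poch b p * pfcoef p q * (vpoch r (fun i => f i - (b + INR q)) m / vpoch r f m)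
      * (poch (b + INR q + 1 - a) n / poch (b + INR q) (S n)))
    with (poch b p / poch (b + INR q) (S n) * (pfcoef p q
        * (vpoch r (fun i => f i - (b + INR q)) m / vpoch r f m) * poch (b + INR q + 1 - a) n))
    by (unfold Cdiv; ring).
  rewrite <- poch_common_denominator by exact Hq. unfold pfcoef.
  replace (poch (b + INR q + 1 - a) n)
    with (poch (b - a + 1) n * poch (b - a + 1 + INR n) q / poch (b - a + 1) q)
    by (rewrite E; field; auto).
  field. repeat split; auto using Cfact_neq_0.
Qed.

Lemma radius_ge_1_Vcoef_sum (u : nat -> C) : radius_ge_1 (fun n => csum p (fun q => pole_weight q * Vcoef (u q) (b + INR q) n)).
Proof.
  apply (radius_ge_1_csum p (fun q n => pole_weight q * Vcoef (u q) (b + INR q) n)).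
  intros q _. apply radius_ge_1_scal, radius_ge_1_Vcoef, not_nonpos_int_beta.
Qed.

Lemma CPS_Vcoef_sum (u : nat -> C) (z : C) : Cmod z < 1 ->
  CPS (fun n => csum p (fun q => pole_weight q * Vcoef (u q) (b + INR q) n)) z
  = csum p (fun q => pole_weight q * CPS (Vcoef (u q) (b + INR q)) z).
Proof.
  intros Hz. rewrite (CPS_csum p (fun q n => pole_weight q * Vcoef (u q) (b + INR q) n)); auto.
  - apply csum_ext. intros q _. apply CPS_scal; auto. apply radius_ge_1_Vcoef, not_nonpos_int_beta.
  - intros q _. apply radius_ge_1_scal, radius_ge_1_Vcoef, not_nonpos_int_beta.
Qed.

(** The upper parameter 1 cancels n!, the parameters from the roots contribute T(n) / T(0), and what
    is left is the coefficient of [Tpoly_coef]. *)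
Lemma hyp_series_Tpoly (lam : nat -> C) (y : C) : Cmod y < 1 ->
  roots_of (Tpoly r f m b p) (p - 1) lam ->
  (forall i : nat, (i < p - 1)%nat -> forall k : nat, lam i <> Cnat k) ->
  Tpoly r f m b p 0 / (CGamma b * vpoch r f m) *
  hyp_series (a :: RtoC 1 :: map (fun i => 1 - lam i) (idx (p - 1)))
    ((b + Cnat p) :: map (fun i => - lam i) (idx (p - 1))) y
  = csum p (fun q => pole_weight q * CPS (Vcoef a (b + INR q)) y).
Proof.
  intros Hy Hr Hl. destruct (roots_ratio _ _ _ Hr Hl) as [N0 HT].
  pose proof (vpoch_neq_0 r f m Hf) as Nv. pose proof (CGamma_neq_0 b Hb) as Ng.
  set (K := Tpoly r f m b p 0 / (CGamma b * vpoch r f m)).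
  assert (NK : K <> 0).
  { apply Cdiv_neq_0; auto using Cmult_neq_0. }
  rewrite (hyp_series_CPS _ _ (fun n => / K * csum p (fun q => pole_weight q * Vcoef a (b + INR q) n)) y).
  - rewrite (CPS_scal (/ K) _ _ (radius_ge_1_Vcoef_sum (fun _ => a)) Hy), (CPS_Vcoef_sum (fun _ => a)) by exact Hy.
    field. exact NK.
  - intros n. rewrite <- Tpoly_coef. unfold hyp_term. cbn [map fold_right]. rewrite !fold_poch_map, poch_1.
    destruct (HT n) as [N1 E1].
    pose proof (poch_neq_0 (b + INR p) n (not_nonpos_int_add b p Hb)) as N2.
    replace (Tpoly r f m b p (INR n)) with (Tpoly r f m b p 0
      * cprod (p - 1) (fun i => poch (1 - lam i) n) / cprod (p - 1) (fun i => poch (- lam i) n))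
      by (rewrite E1; field; auto).
    unfold K, Cnat. field. repeat split; auto using Cfact_neq_0.
Qed.

Lemma hyp_series_Tstar (lam : nat -> C) (y : C) : Cmod y < 1 -> not_nonpos_int (b - a + 1) ->
  roots_of (Tstar r f m a b p) (p - 1) lam ->
  (forall i : nat, (i < p - 1)%nat -> forall k : nat, lam i <> Cnat k) ->
  CGamma (b - a + 1) * Tstar r f m a b p 0 / (CGamma b * vpoch r f m) *
  hyp_series (RtoC 1 :: (b + 1 - a) :: map (fun i => 1 - lam i) (idx (p - 1)))
    ((b + Cnat p) :: map (fun i => - lam i) (idx (p - 1))) y
  = csum p (fun q => pole_weight q * CPS (Vcoef (b + INR q + 1 - a) (b + INR q)) y).
Proof.
  intros Hy Hc Hr Hl. destruct (roots_ratio _ _ _ Hr Hl) as [N0 HT].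
  pose proof (vpoch_neq_0 r f m Hf) as Nv. pose proof (CGamma_neq_0 b Hb) as Ng.
  pose proof (CGamma_neq_0 _ Hc) as Ngc.
  set (K := CGamma (b - a + 1) * Tstar r f m a b p 0 / (CGamma b * vpoch r f m)).
  assert (NK : K <> 0).
  { apply Cdiv_neq_0; auto using Cmult_neq_0. }
  rewrite (hyp_series_CPS _ _ (fun n => / K
     * csum p (fun q => pole_weight q * Vcoef (b + INR q + 1 - a) (b + INR q) n)) y).
  - rewrite (CPS_scal (/ K) _ _ (radius_ge_1_Vcoef_sum (fun q => b + INR q + 1 - a)) Hy),
      (CPS_Vcoef_sum (fun q => b + INR q + 1 - a)) by exact Hy.
    field. exact NK.
  - intros n. rewrite <- Tstar_coef by exact Hc. unfold hyp_term. cbn [map fold_right].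
    rewrite !fold_poch_map, poch_1.
    destruct (HT n) as [N1 E1].
    pose proof (poch_neq_0 (b + INR p) n (not_nonpos_int_add b p Hb)) as N2.
    replace (Tstar r f m a b p (INR n)) with (Tstar r f m a b p 0
      * cprod (p - 1) (fun i => poch (1 - lam i) n) / cprod (p - 1) (fun i => poch (- lam i) n))
      by (rewrite E1; field; auto).
    unfold K, Cnat. field. repeat split; auto using Cfact_neq_0.
Qed.

Lemma binser_inv (c x : C) : Cmod x < 1 -> binser (- c) x * binser c x = 1.
Proof.
  intros Hx. rewrite <- binser_plus by exact Hx. replace (- c + c) with (RtoC 0) by ring.
  rewrite binser_Cpowc by exact Hx. unfold Cpowc. replace (- 0 * Clog (1 - x)) with (RtoC 0) by ring.
  apply Cexp_0.
Qed.

(* For |x| < 1/2 this is Pfaff's transformation term by term; both sides are holomorphic in the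
   unit disc, which gives the rest. *)
Lemma principal_branch_Tpoly (lam : nat -> C) (F : C -> C) (x : C) : Cmod x < 1 ->
  roots_of (Tpoly r f m b p) (p - 1) lam ->
  (forall i : nat, (i < p - 1)%nat -> forall k : nat, lam i <> Cnat k) ->
  principal_branch (a :: RtoC 1 :: map (fun i => 1 - lam i) (idx (p - 1)))
     ((b + Cnat p) :: map (fun i => - lam i) (idx (p - 1))) F ->
  Cpowc (1 - x) a * csum p (fun q => pole_weight q * CPS (Ucoef a (b + INR q)) x)
  = Tpoly r f m b p 0 / (CGamma b * vpoch r f m) * F (x / (x - 1)).
Proof.
  intros Hx Hr Hl [F1 F2].
  set (K := Tpoly r f m b p 0 / (CGamma b * vpoch r f m)).
  assert (Z := identity_theorem
    (fun z => binser (- a) z * csum p (fun q => pole_weight q * CPS (Ucoef a (b + INR q)) z)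
              - K * F (z / (z - 1))) (/ 2)).
  cbv beta in Z. rewrite Cpowc_binser by exact Hx.
  match goal with |- ?A = ?B => replace A with (A - B + B) by ring end.
  rewrite Z; auto. ring. lra.
  - clear x Hx Z. intros z Hz.
    destruct (ex_derive_Cder F (z / (z - 1)) (F2 _ (pfaff_arg_off_cut z Hz))) as [L HL].
    assert (D : exists L', Cder (fun z => csum p (fun q => pole_weight q * CPS (Ucoef a (b + INR q)) z)) z L').
    { eexists. apply (Cder_csum p (fun q z => pole_weight q * CPS (Ucoef a (b + INR q)) z)).
      intros q _. apply Cder_scal. apply Cder_CPS; auto. apply radius_ge_1_Ucoef, not_nonpos_int_beta. }
    destruct D as [L' HL'].
    eexists. apply (Cder_minus (fun z => binser (- a) z * csum p (fun q => pole_weight q * CPS (Ucoef a (b + INR q)) z))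
      (fun z => K * F (z / (z - 1)))).
    + apply (Cder_mult (binser (- a))). now apply Cder_binser. exact HL'.
    + apply (Cder_scal K (fun z => F (z / (z - 1)))).
      apply (Cder_comp F (fun z => z / (z - 1))); [now apply Cder_pfaff_arg | exact HL].
  - clear x Hx Z. intros z Hz2. assert (Hz : Cmod z < 1) by lra.
    pose proof (Cmod_pfaff_arg z Hz2) as Hy.
    rewrite F1 by exact Hy. unfold K. rewrite hyp_series_Tpoly by auto.
    rewrite csum_scal.
    rewrite (csum_ext p _ (fun q => pole_weight q * CPS (Vcoef a (b + INR q)) (z / (z - 1)))). ring.
    intros q _. rewrite pfaff_transform by (auto using not_nonpos_int_beta).
    replace (binser (- a) z * (pole_weight q * (binser a z * CPS (Vcoef a (b + INR q)) (z / (z - 1)))))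
      with (binser (- a) z * binser a z * (pole_weight q * CPS (Vcoef a (b + INR q)) (z / (z - 1)))) by ring.
    rewrite binser_inv by exact Hz. ring.
Qed.

Lemma Tstar_hyp_series (lam : nat -> C) (x : C) : Cmod x < 1 -> not_nonpos_int (b - a + 1) ->
  roots_of (Tstar r f m a b p) (p - 1) lam ->
  (forall i : nat, (i < p - 1)%nat -> forall k : nat, lam i <> Cnat k) ->
  Cpowc (1 - x) (a - 1) * csum p (fun q => pole_weight q * CPS (Ucoef a (b + INR q)) x)
  = CGamma (b - a + 1) * Tstar r f m a b p 0 / (CGamma b * vpoch r f m) *
  hyp_series (RtoC 1 :: (b + 1 - a) :: map (fun i => 1 - lam i) (idx (p - 1)))
    ((b + Cnat p) :: map (fun i => - lam i) (idx (p - 1))) x.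
Proof.
  intros Hx Hc Hr Hl. rewrite hyp_series_Tstar by auto.
  rewrite Cpowc_binser, csum_scal by exact Hx. apply csum_ext. intros q _.
  rewrite euler_transform by (auto using not_nonpos_int_beta).
  match goal with |- ?A * (?B * (?C * ?D)) = _ => replace (A * (B * (C * D))) with (A * C * (B * D)) by ring end.
  rewrite binser_inv by exact Hx. ring.
Qed.

End Decomposition.

Theorem theorem4
  (r : nat) (m : nat -> nat) (f : nat -> C) (a b : C) (p : nat)
  (Hr : (1 <= r)%nat)
  (Hm : forall i : nat, (i < r)%nat -> (1 <= m i)%nat)
  (Hp : (1 <= p)%nat)
  (Hf : forall i : nat, (i < r)%nat -> not_nonpos_int (f i))
  (Hb : not_nonpos_int b)
  (delta : C -> nat -> C) (Hdelta : W_coeffs r f m (nsum r m) delta)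
  (x : C) (Hx : (Cmod x < 1)%R) :
  (forall (lam : nat -> C) (F : C -> C),
     roots_of (Tpoly r f m b p) (p - 1) lam ->
     (forall i : nat, (i < p - 1)%nat -> forall k : nat, lam i <> Cnat k) ->
     principal_branch
       (a :: RtoC 1 :: map (fun i => 1 - lam i) (idx (p - 1)))
       ((b + Cnat p) :: map (fun i => - lam i) (idx (p - 1))) F ->
     Cpowc (1 - x) a
       * hyp_series (a :: b :: map (fun i => f i + Cnat (m i)) (idx r))
                    ((b + Cnat p) :: map f (idx r)) x
     = Tpoly r f m b p 0 / (CGamma b * vpoch r f m) * F (x / (x - 1))
       + csum p (fun q0 => let q := S q0 in
           Cpow (RtoC (-1)) q0 * poch b p
           / ((b + Cnat q - 1) * Cnat (fact q0) * Cnat (fact (p - q)))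
           * csum (nsum r m) (fun l =>
               Yfun delta (nsum r m) (b + Cnat q - 1) l * poch a l
               * Cpow x l / Cpow (1 - x) l)))
  /\
  (not_nonpos_int (b - a + 1) ->
   forall lam : nat -> C,
     roots_of (Tstar r f m a b p) (p - 1) lam ->
     (forall i : nat, (i < p - 1)%nat -> forall k : nat, lam i <> Cnat k) ->
     Cpowc (1 - x) (a - 1)
       * hyp_series (a :: b :: map (fun i => f i + Cnat (m i)) (idx r))
                    ((b + Cnat p) :: map f (idx r)) x
     = CGamma (b - a + 1) * Tstar r f m a b p 0 / (CGamma b * vpoch r f m)
         * hyp_series (RtoC 1 :: (b + 1 - a) :: map (fun i => 1 - lam i) (idx (p - 1)))
                      ((b + Cnat p) :: map (fun i => - lam i) (idx (p - 1))) x
       + csum p (fun q0 => let q := S q0 in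
           Cpow (RtoC (-1)) q0 * poch b p
           / ((b + Cnat q - 1) * Cnat (fact q0) * Cnat (fact (p - q)))
           * csum (nsum r m) (fun l =>
               Yfun delta (nsum r m) (b + Cnat q - 1) l * poch a l
               * Cpow x l / Cpow (1 - x) (S l)))).
Proof.
  (* Common to both claims: c is the power of 1 - x in front, and kappa = c (1-x)^(-a) is 1 in the
     first and 1/(1-x) in the second, which explains the exponents l and l + 1. *)
  assert (Hsum : forall c kappa : C, c * binser a x = kappa ->
    c * hyp_series (a :: b :: map (fun i => f i + Cnat (m i)) (idx r)) ((b + Cnat p) :: map f (idx r)) x
    = c * csum p (fun q => pole_weight r m f b p q * CPS (Ucoef a (b + INR q)) x)
      + csum p (fun q => poch b p * pfcoef p q * / (b + INR q) * csum (nsum r m) (fun l =>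
          Yfun delta (nsum r m) (b + INR q) l * (poch a l * x ^ l / (1 - x) ^ l * kappa)))).
  { intros c kappa Hk. rewrite (hyp_series_decomposition r m f a b p Hp Hf Hb delta Hdelta x Hx).
    rewrite Cmult_plus_distr_l, Cplus_comm. f_equal.
    rewrite csum_scal. apply csum_ext. intros q _.
    match goal with |- c * (?A * (?B * ?S)) = _ =>
      replace (c * (A * (B * S))) with (A * ((c * B) * S)) by ring end.
    rewrite Hk, csum_scal. f_equal. apply csum_ext. intros l _. ring. }
  (* The statement counts q from 1, the decomposition from 0. *)
  assert (Hbeta : forall q0, b + Cnat (S q0) - 1 = b + INR q0).
  { intros q0. unfold Cnat. rewrite S_INR, RtoC_plus. ring. }
  pose proof (sub_1_neq_0 x Hx) as N.
  split.
  - intros lam F Hroot Hl HF. rewrite (Hsum _ 1).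
    2: { rewrite Cpowc_binser by exact Hx. now apply binser_inv. }
    rewrite (principal_branch_Tpoly r m f a b p Hp Hf Hb lam F x Hx Hroot Hl HF). f_equal.
    apply csum_ext. intros q0 _. cbv zeta. rewrite Hbeta. f_equal.
    + unfold pfcoef, Cnat. field. repeat split; auto using Cfact_neq_0, beta_neq_0.
    + apply csum_ext. intros l _. field. now apply Cpow_nz.
  - intros Hc lam Hroot Hl. rewrite (Hsum _ (/ (1 - x))).
    2: { rewrite Cpowc_binser by exact Hx. apply (Cmult_cancel_l (1 - x)); auto.
      replace ((1 - x) * (binser (- (a - 1)) x * binser a x))
        with (binser (- (a - 1)) x * ((1 - x) * binser a x)) by ring.
      rewrite <- binser_pred, binser_inv by exact Hx. field. exact N. }
    rewrite (Tstar_hyp_series r m f a b p Hp Hf Hb lam x Hx Hc Hroot Hl). f_equal.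
    apply csum_ext. intros q0 _. cbv zeta. rewrite Hbeta. f_equal.
    + unfold pfcoef, Cnat. field. repeat split; auto using Cfact_neq_0, beta_neq_0.
    + apply csum_ext. intros l _. rewrite Cpow_S. field. split; auto. now apply Cpow_nz.
Qed.
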